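(* Let $m>2$ and $\mathfrak W:=\mathfrak V\otimes(\mathfrak g/\mathfrak p)$. Then: (i) The $\mathfrak p$-module $\mathfrak W$ admits a filtration $\mathfrak W^{-\frac12}\subset\mathfrak W^{-\frac32}$ of $\mathfrak p$-modules, where $\mathfrak W^{-\frac32}:=\mathfrak V^{-\frac12}\otimes(\mathfrak g^{-1}/\mathfrak g^0)=\mathfrak W$ and $\mathfrak W^{-\frac12}:=\mathfrak V^{\frac12}\otimes(\mathfrak g^{-1}/\mathfrak g^0)$. (ii) The associated graded $\mathfrak p$-module $\mathrm{gr}(\mathfrak W)=\mathrm{gr}_{-\frac12}(\mathfrak W)\oplus\mathrm{gr}_{-\frac32}(\mathfrak W)=\mathfrak W^{-\frac12}\oplus(\mathfrak W^{-\frac32}/\mathfrak W^{-\frac12})$ decomposes as a direct sum $$\mathrm{gr}_{-\frac12}(\mathfrak W)=\mathfrak W^0_{-\frac12}\oplus\mathfrak W^1_{-\frac12},\qquad \mathrm{gr}_{-\frac32}(\mathfrak W)=\mathfrak W^0_{-\frac32}\oplus\mathfrak W^1_{-\frac32}$$ of irreducible $\mathfrak p$-modules, which are isomorphic to the following $\mathfrak g_0$-modules, of the stated dimensions: - $\mathfrak W^0_{-\frac32}\cong\wedge^3\mathfrak V_{-\frac12}$, dimension $\frac1{3!}m(m-1)(m-2)$; - $\mathfrak W^1_{-\frac32}\cong\mathfrak V_{-\frac12}\circledcirc(\wedge^2\mathfrak V_{-\frac12})$, dimension $\frac13m(m^2-1)$; - $\mathfrak W^0_{-\frac12}\cong\mathfrak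 V_{-\frac12}$, dimension $m$; - $\mathfrak W^1_{-\frac12}\cong\mathfrak V_{\frac12}\circledcirc(\wedge^2\mathfrak V_{-\frac12})$, dimension $\frac12m(m+1)(m-2)$. (iii) For $i=-\frac32,-\frac12$ and $j=0,1$, $$\mathfrak W_i^j=\{\Gamma_{abc}\xi^{bB}\xi^{cC}\in\mathfrak W^i:\ {}^{\mathfrak W}_\xi\Pi_i^k(\Gamma)=0\ \text{for all }k\neq j\}/\mathfrak W^{i+1},\qquad \mathfrak W^{\frac12}:=\{0\},$$ where, for $\Gamma_{abc}=\Gamma_{a[bc]}\in\mathfrak V\otimes\mathfrak g$, $${}^{\mathfrak W}_\xi\Pi^0_{-\frac32}(\Gamma):=\Gamma_{abc}\,\xi^{a[A}\xi^{bB}\xi^{cC]},\qquad {}^{\mathfrak W}_\xi\Pi^1_{-\frac32}(\Gamma):=\Gamma_{abc}\,\xi^{a(A}\xi^{bB)}\xi^{cC},$$ $${}^{\mathfrak W}_\xi\Pi^0_{-\frac12}(\Gamma):=\xi^{A'}\Gamma_{bcd}\,\xi^{cdD'}\gamma^b{}_{D'}{}^{B}-\xi^{bB}\Gamma_{bcd}\,\xi^{cdA'},$$ $${}^{\mathfrak W}_\xi\Pi^1_{-\frac12}(\Gamma):=\Gamma_{abc}\xi^{bB}\xi^{cC}-\tfrac1{2(m-1)}\Big(\xi_a{}^{[B|}\Gamma_{bcd}\,\xi^{cdD'}\gamma^b{}_{D'}{}^{|C]}+\xi^{b[B|}\Gamma_{bcd}\,\xi^{cdD'}\gamma_{aD'}{}^{|C]}\Big)\quad\text{if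 }m>3,$$ $${}^{\mathfrak W}_\xi\Pi^1_{-\frac12}(\Gamma):=\Gamma_{abc}\xi^{bB}\xi^{cC}-\tfrac14\Big(\xi_a{}^{[B|}\Gamma_{bcd}\,\xi^{cd}{}_{D}\gamma^{bD|C]}+\xi^{b[B|}\Gamma_{bcd}\,\xi^{cd}{}_{D}\gamma_a{}^{D|C]}\Big)+\tfrac16\,\xi^{bA}\Gamma_{bcd}\,\xi^{cd}{}_{A}\,\gamma_a{}^{BC}\quad\text{if }m=3.$$ (iv) The $\mathfrak p$-module $\mathrm{gr}(\mathfrak W)$ can be expressed by the directed graph with arrows $$\mathfrak W^1_{-\frac12}\to\mathfrak W^1_{-\frac32},\quad \mathfrak W^0_{-\frac12}\to\mathfrak W^1_{-\frac32},\quad \mathfrak W^0_{-\frac12}\to\mathfrak W^0_{-\frac32},\quad\text{and, only when }m>3,\quad \mathfrak W^1_{-\frac12}\to\mathfrak W^0_{-\frac32}.$$ Here an arrow from $\mathfrak W_i^j$ to $\mathfrak W_{i-1}^k$ implies that $\breve{\mathfrak W}_i^j\subset\mathfrak g_1\cdot\breve{\mathfrak W}_{i-1}^k$ for any choice of irreducible $\mathfrak g_0$-modules $\breve{\mathfrak W}_i^j$, $\breve{\mathfrak W}_{i-1}^k$ isomorphic to $\mathfrak W_i^j$, $\mathfrak W_{i-1}^k$ respectively, or equivalently that $\ker{}^{\mathfrak W}_\xi\Pi_i^j\subset\ker{}^{\mathfrak W}_\xi\Pi_{i-1}^k$.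
   Context: Let $\mathfrak V$ be a $2m$-dimensional oriented complex vector space ($m>2$, $n=2m$) with non-degenerate symmetric bilinear form $g_{ab}$, used to raise and lower indices. Round/square brackets denote normalised (skew-)symmetrisation; vertical bars enclose indices excluded from it. $\mathfrak S^\pm$ are the chiral spinor spaces (dimension $2^{m-1}$); elements of $\mathfrak S^+$ have primed upper indices, elements of $\mathfrak S^-$ unprimed upper indices. Clifford multiplication is given by $\gamma_{aA'}{}^B$, $\gamma_{aA}{}^{B'}$ with $\gamma_{(a|A'}{}^{C}\gamma_{|b)C}{}^{B'}=-g_{ab}\delta_{A'}^{B'}$ and $\gamma_{(a|A}{}^{C'}\gamma_{|b)C'}{}^{B}=-g_{ab}\delta_A^B$; set $\gamma_{abA'}{}^{B'}:=\gamma_{[a|A'}{}^{C}\gamma_{|b]C}{}^{B'}$. Fix a pure spinor $\xi^{A'}\in\mathfrak S^+$, i.e. a non-zero spinor for which the kernel of $\xi_a{}^A:=\xi^{B'}\gamma_{aB'}{}^A:\mathfrak V\to\mathfrak S^-$ has dimension $m$ (it is then totally null). Put $\xi_{ab}{}^{A'}:=\xi^{B'}\gamma_{abB'}{}^{A'}$, $\mathfrak V^{-\frac12}:=\mathfrak V$, $\mathfrak V^{\frac12}:=\ker(\xi_a{}^A:\mathfrak V\to\mathfrak S^-)$, $\mathfrak S^{\frac{m-2}4}:=\mathrm{im}(\xi_a{}^A)\subset\mathfrak S^-$. Identify $\mathfrak g:=\mathfrak{so}(2m,\mathbb C)$ with $\wedge^2\mathfrak V^*$. Put $\mathfrak g^{-1}:=\mathfrak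 g$, $\mathfrak p:=\mathfrak g^0:=\{\phi_{ab}\in\mathfrak g:\xi^{aA}\xi^{bB}\phi_{ab}=0\}$ (the stabiliser of the line spanned by $\xi^{A'}$), $\mathfrak g^1:=\{\phi_{ab}\in\mathfrak g:\xi^{bA}\phi_{ba}=0\}$. The map $\phi_{ab}\mapsto\xi^{aA}\xi^{bB}\phi_{ab}$ identifies $\mathfrak g/\mathfrak p$ with $\wedge^2\mathfrak S^{\frac{m-2}4}$; accordingly elements of $\mathfrak W$ are written $\Gamma_{abc}\xi^{bB}\xi^{cC}$ with $\Gamma_{abc}=\Gamma_{a[bc]}\in\mathfrak V\otimes\mathfrak g$. Choose a totally null complement $\mathfrak V_{-\frac12}$ of $\mathfrak V_{\frac12}:=\mathfrak V^{\frac12}$ in $\mathfrak V$. It induces a grading $\mathfrak g=\mathfrak g_{-1}\oplus\mathfrak g_0\oplus\mathfrak g_1$ with $\mathfrak g_{\pm1}\cong\wedge^2\mathfrak V_{\pm\frac12}$, $\mathfrak g_0\cong\mathfrak V_{-\frac12}\otimes\mathfrak V_{\frac12}\cong\mathfrak{gl}(m,\mathbb C)$, $\mathfrak p=\mathfrak g_0\oplus\mathfrak g_1$, $\mathfrak g_1=\mathfrak g^1$ the nilradical of $\mathfrak p$. The statement ''$\mathfrak W_i^j\cong$ a $\mathfrak g_0$-module'' means isomorphic to it as a $\mathfrak g_0$-module. The splitting also induces a splitting of $\mathfrak W$ into graded $\mathfrak g_0$-submodules in which the $\breve{\mathfrak W}_i^j$ live, and $\mathfrak g_1\cdot$ denotes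 the algebraic action (linear span). $\mathfrak M\circledcirc\mathfrak M'$ denotes the Cartan product, the unique irreducible component of highest dimension in $\mathfrak M\otimes\mathfrak M'$. For $m=3$ one uses $\mathfrak S^+\cong(\mathfrak S^-)^*$ to replace upper primed indices by lower unprimed ones: $\xi^{A'}$ becomes $\xi_A$, the $\gamma$-matrices become skew $\gamma_a{}^{AB}$ (for $\gamma_{aA'}{}^{B}$) and $\gamma_{aAB}$ (for $\gamma_{aA}{}^{B'}$), $\xi_a{}^{B}=\xi_A\gamma_a{}^{AB}$ and $\xi_{ab}{}_{D}=\xi_E\,\gamma_{[a}{}^{EF}\gamma_{b]FD}$. *)

(* Defs.v *)
From HB Require Import structures.
From mathcomp Require Import all_boot all_order all_algebra.
From mathcomp Require Import reals complex.

Set Implicit Arguments.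
Unset Strict Implicit.
Unset Printing Implicit Defensive.

Import Order.TTheory GRing.Theory Num.Theory.
Local Open Scope ring_scope.

(** * Modules and subquotients

    A subspace [h] of [L] acts on vector spaces through bilinear maps [act].
    The subquotient [U / B] of [M] is given by two subspaces [B <= U] of [M];
    in particular [U / 0] is the subspace [U] itself. *)

Section Modules.
Variables (F : fieldType) (L M M' : vectType F).
Variables (h : {vspace L}) (act : L -> M -> M) (act' : L -> M' -> M').

Definition stable (U : {vspace M}) : Prop :=
  forall x u, x \in h -> u \in U -> act x u \in U.

Definition irreducible (U B : {vspace M}) : Prop :=
  [/\ stable U, stable B, (B <= U)%VS, U <> B &
      forall X : {vspace M}, stable X -> (B <= X)%VS -> (X <= U)%VS ->
        X = B \/ X = U].

(** [U / B] and [U' / B'] are isomorphic [h]-modules. Every linear map between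
    the quotients is induced by some [f] defined on the ambient spaces; the
    three clauses say that the induced map is onto, injective, equivariant. *)
Definition isomorphic (U B : {vspace M}) (U' B' : {vspace M'}) : Prop :=
  exists f : 'Hom(M, M'),
    [/\ (f @: U + B' = U')%VS, (U :&: f @^-1: B' = B)%VS &
        forall x u, x \in h -> u \in U -> f (act x u) - act' x (f u) \in B'].

Definition quotient_dim (U B : {vspace M}) : nat := (\dim U - \dim B)%N.

(** [h . U] *)
Definition action_span (U : {vspace M}) : {vspace M} :=
  <<[seq act x u | x <- vbasis h, u <- vbasis U]>>%VS.

(** [N] is the unique irreducible submodule of highest dimension of [T]. For
    [T] a tensor product of two modules, [N] is their Cartan product. *)
Definition top_component (T N : {vspace M}) : Prop :=
  [/\ irreducible N 0%VS, (N <= T)%VS &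
      forall N' : {vspace M}, irreducible N' 0%VS -> (N' <= T)%VS ->
        N' <> N -> (\dim N' < \dim N)%N].

End Modules.

(** * Chiral spinors

    The spaces V, S^+ and S^- are given with bases, so that tensors are arrays
    of components; the metric and the gamma matrices are otherwise arbitrary.
    Vectors v^a and spinors psi^A are rows, and psi^{A'} gamma_{aA'}^B is
    [psi *m gammaP a]: composition of gamma matrices reads left to right. *)

Record clifford (F : fieldType) (m : nat) := Clifford {
  metric : 'M[F]_(2 * m);
  gammaP : 'I_(2 * m) -> 'M[F]_(2 ^ (m - 1));  (* gamma_{aA'}^B : S^+ -> S^- *)
  gammaM : 'I_(2 * m) -> 'M[F]_(2 ^ (m - 1));  (* gamma_{aA}^{B'} : S^- -> S^+ *)
  metric_sym : metric^T = metric;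
  metric_unit : metric \in unitmx;
  gammaPM : forall a b,
    2^-1 *: (gammaP a *m gammaM b + gammaP b *m gammaM a) = (- metric a b)%:M;
  gammaMP : forall a b,
    2^-1 *: (gammaM a *m gammaP b + gammaM b *m gammaP a) = (- metric a b)%:M
}.

(** -3/2 and -1/2 *)
Inductive weight := wt_m32 | wt_m12.

Section Spinors.
Variables (F : fieldType) (m : nat) (D : clifford F m).
Local Notation n := (2 * m)%N.
Local Notation N := (2 ^ (m - 1))%N.
Local Notation vec := 'rV[F]_n.
Local Notation form2 := 'M[F]_n.
(* Gamma_{abc} is [G a b c]. *)
Local Notation tensor := {ffun 'I_n -> 'M[F]_n}.

Local Notation g := (metric D).
Local Notation ginv := (invmx (metric D)).

(** so(2m), as the 2-forms phi_{ab}; it acts on V by v^a |-> phi^a_b v^b and,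
    as derivations, on tensors with lower indices. *)
Definition so : {vspace form2} := lker (linfun (idfun \+ @trmx F n n)).

Definition act_vec (phi : form2) (v : vec) : vec := (ginv *m phi *m v^T)^T.

Definition act_tensor (phi : form2) (G : tensor) : tensor :=
  let phi' := phi *m ginv in                                    (* phi_a^d *)
  [ffun a => \matrix_(b, c) \sum_d
    (phi' a d * G d b c + phi' b d * G a d c + phi' c d * G a b d)].

(** Tensor and exterior products, with indices lowered by the metric. *)
Definition lower (v : vec) : vec := v *m g.

Definition tens (u : vec) (phi : form2) : tensor :=
  [ffun a => lower u 0 a *: phi].

Definition wedge2 (u v : vec) : form2 :=
  (lower u)^T *m lower v - (lower v)^T *m lower u.

Definition wedge3 (u v w : vec) : tensor :=
  tens u (wedge2 v w) + tens v (wedge2 w u) + tens w (wedge2 u v).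

Definition tensv (U : {vspace vec}) (H : {vspace form2}) : {vspace tensor} :=
  <<[seq tens u phi | u <- vbasis U, phi <- vbasis H]>>%VS.

Definition wedge2v (U W : {vspace vec}) : {vspace form2} :=
  <<[seq wedge2 u w | u <- vbasis U, w <- vbasis W]>>%VS.

Definition wedge3v (U : {vspace vec}) : {vspace tensor} :=
  <<[seq wedge3 u p.1 p.2 | u <- vbasis U,
       p <- [seq (v, w) | v <- vbasis U, w <- vbasis U]]>>%VS.

(** ** Pure spinors and the associated parabolic subalgebra *)
Variable xi : 'rV[F]_N.

(** xi_a^A and xi^{aA} *)
Definition xi1 : 'M[F]_(n, N) := \matrix_(a, A) (xi *m gammaP D a) 0 A.
Definition xi1up : 'M[F]_(n, N) := ginv *m xi1.

Definition V12 : {vspace vec} := lker (linfun (mulmxr xi1)).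

Definition pure : Prop := xi != 0 /\ \dim V12 = m.

Definition par : {vspace form2} :=
  (so :&: lker (linfun (mulmxr xi1up \o mulmx xi1up^T)))%VS.

Lemma mem_so phi : (phi \in so) = (phi^T == - phi).
Proof. by rewrite memv_ker lfunE /= addrC addr_eq0. Qed.

Lemma mem_V12 v : (v \in V12) = (v *m xi1 == 0).
Proof. by rewrite memv_ker lfunE. Qed.

Lemma mem_par phi :
  (phi \in par) = (phi^T == - phi) && (xi1up^T *m phi *m xi1up == 0).
Proof. by rewrite memv_cap mem_so memv_ker lfunE. Qed.

(** ** The module W = V (x) (g / p) and its filtration

    W is the subquotient (V (x) g) / (V (x) p) of the space of tensors, and
    its subspaces are represented by their preimages, which contain V (x) p.
    An element Gamma_{abc} xi^{bB} xi^{cC} of W is the class of Gamma. *)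
Definition W_m32 : {vspace tensor} := tensv fullv so.
Definition W_p12 : {vspace tensor} := tensv fullv par.
Definition W_m12 : {vspace tensor} := (tensv V12 so + W_p12)%VS.

(** W^i and W^{i+1} *)
Definition Wfil (i : weight) := if i is wt_m32 then W_m32 else W_m12.
Definition Wnext (i : weight) := if i is wt_m32 then W_m12 else W_p12.

(** ** Splittings *)
Definition null_complement (V' : {vspace vec}) : Prop :=
  [/\ (V' :&: V12 = 0)%VS, (V' + V12 = fullv)%VS &
      forall u v, u \in V' -> v \in V' -> u *m g *m v^T = 0].

Definition g_m1 (V' : {vspace vec}) : {vspace form2} := wedge2v V' V'.
Definition g_0 (V' : {vspace vec}) : {vspace form2} := wedge2v V' V12.
Definition g_1 : {vspace form2} := wedge2v V12 V12.

(** The graded pieces of W induced by the splitting (plus V (x) p). *)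
Definition Wgraded (V' : {vspace vec}) (i : weight) : {vspace tensor} :=
  (tensv (if i is wt_m32 then V' else V12) (g_m1 V') + W_p12)%VS.

(** ** The maps Pi_i^j *)
Definition skew2 (t : 'I_N -> 'I_N -> F) (B C : 'I_N) : F :=
  2^-1 * (t B C - t C B).
Definition skew3 (t : 'I_N -> 'I_N -> 'I_N -> F) (A B C : 'I_N) : F :=
  6^-1 * (t A B C + t B C A + t C A B - t A C B - t B A C - t C B A).

(** xi_{ab}^{A'} and xi^{abA'} *)
Definition xi2 (a b : 'I_n) : 'rV[F]_N :=
  xi *m (2^-1 *: (gammaP D a *m gammaM D b - gammaP D b *m gammaM D a)).
Definition xi2up (a b : 'I_n) : 'rV[F]_N :=
  \sum_c \sum_d (ginv a c * ginv b d) *: xi2 c d.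

(** gamma^b_{A'}^B *)
Definition gammaPup (b : 'I_n) : 'M[F]_N := \sum_a ginv b a *: gammaP D a.

(** Gamma_{bcd} xi^{cdA'} *)
Definition contr (G : tensor) (b : 'I_n) (A' : 'I_N) : F :=
  \sum_c \sum_d G b c d * xi2up c d 0 A'.

(** Gamma_{abc} xi^{bB} xi^{cC} and Gamma_{abc} xi^{aA} xi^{bB} xi^{cC} *)
Definition xiG2 (G : tensor) (a : 'I_n) (B C : 'I_N) : F :=
  \sum_b \sum_c G a b c * xi1up b B * xi1up c C.
Definition xiG3 (G : tensor) (A B C : 'I_N) : F :=
  \sum_a xi1up a A * xiG2 G a B C.

Definition Pi0_m32 (G : tensor) (A B C : 'I_N) : F := skew3 (xiG3 G) A B C.

Definition Pi1_m32 (G : tensor) (A B C : 'I_N) : F :=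
  2^-1 * (xiG3 G A B C + xiG3 G B A C).

Definition Pi0_m12 (G : tensor) (A' B : 'I_N) : F :=
  xi 0 A' * (\sum_b \sum_D' contr G b D' * gammaPup b D' B)
  - \sum_b xi1up b B * contr G b A'.

Definition Pi1_m12_gen (G : tensor) (a : 'I_n) (B C : 'I_N) : F :=
  xiG2 G a B C - (2 * (m%:R - 1))^-1 *
   (skew2 (fun B C => xi1 a B *
             \sum_b \sum_D' contr G b D' * gammaPup b D' C) B C
    + skew2 (fun B C => \sum_b \sum_D'
             xi1up b B * contr G b D' * gammaP D a D' C) B C).

(** For m = 3, S^+ is identified with the dual of S^- by psi_A :=
    psi^{A'} eps_{A'A}, which turns gamma_{aA'}^B into gamma_a^{AB} and
    gamma_{aA}^{B'} into gamma_{aAB}. Skewness of both makes eps unique up to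
    scale and equivariant under so(6). *)
Variable eps : 'M[F]_N.

Definition gamma_up (a : 'I_n) : 'M[F]_N := invmx eps *m gammaP D a.
Definition gamma_low (a : 'I_n) : 'M[F]_N := gammaM D a *m eps.

Definition spinor_duality : Prop :=
  [/\ eps \in unitmx, forall a, (gamma_up a)^T = - gamma_up a &
      forall a, (gamma_low a)^T = - gamma_low a].

(** xi_{abD}, xi^{ab}_D, Gamma_{bcd} xi^{cd}_D and gamma^{bDC} *)
Definition xi2_low (a b : 'I_n) : 'rV[F]_N :=
  (xi *m eps) *m
  (2^-1 *: (gamma_up a *m gamma_low b - gamma_up b *m gamma_low a)).
Definition xi2_lowup (a b : 'I_n) : 'rV[F]_N :=
  \sum_c \sum_d (ginv a c * ginv b d) *: xi2_low c d.
Definition contr_low (G : tensor) (b : 'I_n) (E : 'I_N) : F :=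
  \sum_c \sum_d G b c d * xi2_lowup c d 0 E.
Definition gamma_upup (b : 'I_n) : 'M[F]_N := \sum_a ginv b a *: gamma_up a.

Definition Pi1_m12_3 (G : tensor) (a : 'I_n) (B C : 'I_N) : F :=
  xiG2 G a B C - 4^-1 *
   (skew2 (fun B C => xi1 a B *
             \sum_b \sum_E contr_low G b E * gamma_upup b E C) B C
    + skew2 (fun B C => \sum_b \sum_E
             xi1up b B * contr_low G b E * gamma_up a E C) B C)
  + 6^-1 * (\sum_b \sum_A xi1up b A * contr_low G b A) * gamma_up a B C.

Definition Pi1_m12 (G : tensor) : 'I_n -> 'I_N -> 'I_N -> F :=
  if m == 3%N then Pi1_m12_3 G else Pi1_m12_gen G.

(** Pi_i^j (G) = 0, where j is 0 ([false]) or 1 ([true]). *)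
Definition Pi_zero (i : weight) (j : bool) (G : tensor) : Prop :=
  match i, j with
  | wt_m32, false => forall A B C, Pi0_m32 G A B C = 0
  | wt_m32, true  => forall A B C, Pi1_m32 G A B C = 0
  | wt_m12, false => forall A' B, Pi0_m12 G A' B = 0
  | wt_m12, true  => forall a B C, Pi1_m12 G a B C = 0
  end.

End Spinors.

(** There is an arrow from W_{-1/2}^j to W_{-3/2}^k. *)
Definition arrow (m : nat) (j k : bool) : bool :=
  match j, k with
  | true, false => (3 < m)%N
  | _, _ => true
  end.

(* Main.v *)
Require Import Defs.
From HB Require Import structures.
From mathcomp Require Import all_boot all_order all_algebra.
From mathcomp Require Import reals complex.
From mathcomp Require Import ring lra zify.
Set Implicit Arguments.
Unset Strict Implicit.
Unset Printing Implicit Defensive.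
Import Order.TTheory GRing.Theory Num.Theory.
Local Open Scope ring_scope.

(* A null complement of V12 provides a basis e_i of V12 and a dual basis f_i of the complement.
   In this frame gr(W) becomes the gl_m-module of the arrays G(e_i, e_j, e_k) and G(f_i, e_j, e_k),
   skew in the last two indices. The weight -3/2 array splits into its totally skew part and the
   arrays with zero cyclic sum, the weight -1/2 array into pure traces and trace-free arrays.
   The spinors xi f_i are linearly independent, e_i kills xi, and Clifford multiplication by e_p
   of xi, xi f_i and xi f_j f_k lowers the number of factors, so that evaluating the spinorial
   projections on e_p and f_p extracts exactly these components. The nilradical g_1 acts by
   x_ijk |-> sum_l B_il x_ljk with B skew, so an arrow is the question whether the span of these
   images meets an irreducible component; for m = 3 a totally skew array is a multiple of the
   Levi-Civita symbol, whose images are pure traces. *)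

(** * Linear algebra and modules *)

(** The quotients never appear as spaces of their own. [kap] maps W^i onto the arrays skew in the
    last two indices, with kernel W^{i+1}, compatibly with the surjection of p onto gl(m);
    irreducibility, isomorphisms and dimensions are pulled back from arrays. Three obstacles shape
    the rest. The arrows compare kernels on all of W^{-3/2}, so the projections of weight -1/2 must
    be computed there, not only on W^{-1/2}, where they are simple contractions. The spinor formulas
    contain the trace of the p-part of Gamma, which a class modulo V tensor p does not see; it must
    be isolated and cancelled before components can be read off. Finally, one family of components
    must serve every null complement and every irreducible representative: the projections
    characterise the components without mentioning a frame, and the two components of one weight
    have different dimensions. The extra term for m = 3 vanishes on W^{-1/2}; its effect is to let
    totally skew arrays of weight -3/2 into the kernel, which removes an arrow. *)

Section LinearAlgebra.
Import VectorInternalTheory.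
Variables (F : fieldType).

Lemma linfun_linear (U V : vectType F) (f : U -> V) :
  linear f -> linfun f =1 f.
Proof.
move=> lf; pose fl : {linear U -> V} := HB.pack f (GRing.isLinear.Build _ _ _ _ f lf).
exact: (lfunE fl).
Qed.

(** In a rank factorisation P = c r, idempotence forces r c to be the identity of size rank P, and
    the trace is cyclic. *)
Lemma tr_idem n (P : 'M[F]_n) : P *m P = P -> \tr P = (\rank P)%:R.
Proof.
move=> PP; have /row_freeP[Y] := row_base_free P.
have /row_fullP[Z] := col_base_full P.
move: (row_base P) (col_base P) (mulmx_base P) => r c crP ZP YP.
have e : r *m c = 1%:M.
  have : Z *m (c *m r *m (c *m r)) *m Y = Z *m (c *m r) *m Y by rewrite crP PP.
  by rewrite !mulmxA ZP mul1mx -!mulmxA YP mulmx1.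
by rewrite -{1}crP mxtrace_mulC e mxtrace1.
Qed.

(** The family [b] need not be free: [C] and [B] factor the identity through the index set, so the
    trace of P equals that of B P C. This allows a trace to be taken in any convenient
    coordinates. *)
Lemma dim_idem (V : vectType F) (I : finType) (b : I -> V) (c : I -> V -> F)
    (P : 'End(V)) :
  (forall v, v = \sum_i c i v *: b i) ->
  (forall i k u v, c i (k *: u + v) = k * c i u + c i v) ->
  (forall v, P (P v) = P v) ->
  (\dim (limg P))%:R = \sum_i c i (P (b i)).
Proof.
move=> bc clin PP.
have PE v : v2r (P v) = v2r v *m f2mx P by rewrite unlock /= r2vK.
have c0 i : c i 0 = 0.
  by have := clin i 1 0 0; rewrite scaler0 addr0 mul1r => /eqP; rewrite -subr_eq subrr eq_sym => /eqP.
have csum i (J : finType) (k : J -> F) (u : J -> V) :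
    c i (\sum_j k j *: u j) = \sum_j k j * c i (u j).
  elim/big_rec2: _ => [|j y1 y2 _ <-]; [exact: c0|exact: clin].
have -> : \dim (limg P) = \rank (f2mx P).
  by rewrite unlock /dimv /= mxrank_gen (eqmxMr _ (genmxE _)) mul1mx.
have MM : f2mx P *m f2mx P = f2mx P.
  by apply/row_matrixP=> p; rewrite row_mul; have := PE (P (r2v (delta_mx 0 p)));
    rewrite PP PE r2vK !rowE.
rewrite -tr_idem //.
pose C := \matrix_(p < dim V, i < #|I|) c (enum_val i) (r2v (delta_mx 0 p)).
pose B := \matrix_(i < #|I|) v2r (b (enum_val i)).
have CB : C *m B = 1%:M.
  apply/row_matrixP=> p; rewrite row1 -[RHS]r2vK [in RHS](bc (r2v _)) linear_sum /=.
  rewrite row_mul mulmx_sum_row [RHS](reindex (fun i : 'I_#|I| => enum_val i)) /=; last first.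
    by exists enum_rank => i _; rewrite ?enum_valK ?enum_rankK.
  by apply: eq_bigr => i _; rewrite linearZ /= rowK !mxE.
rewrite -[f2mx P]mul1mx -CB -mulmxA mxtrace_mulC /mxtrace.
rewrite [RHS](reindex (fun i : 'I_#|I| => enum_val i)) /=; last first.
  by exists enum_rank => i _; rewrite ?enum_valK ?enum_rankK.
apply: eq_bigr => i _.
have -> : P (b (enum_val i)) = r2v (row i B *m f2mx P).
  by rewrite /B rowK -PE v2rK.
rewrite -row_mul [row i _]row_sum_delta linear_sum /= mxE.
under eq_bigr do rewrite linearZ /=.
by rewrite csum; apply: eq_bigr => p _; rewrite !mxE.
Qed.
End LinearAlgebra.

Section BilinearSpan.
Variables (F : fieldType) (L M K : vectType F) (op : L -> M -> K).

Lemma bilin_span_sub (U : {vspace L}) (H : {vspace M}) (T : {vspace K}) :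
  (forall u v, u \in U -> v \in H -> op u v \in T) ->
  (<<[seq op u v | u <- vbasis U, v <- vbasis H]>> <= T)%VS.
Proof.
move=> h; apply/span_subvP=> _ /allpairsP[[u v] [/= uU vH ->]].
exact: h (vbasis_mem uU) (vbasis_mem vH).
Qed.

(** The spans in the definitions run over chosen bases only. Bilinearity recovers all pairs, one
    argument at a time, through preimages of linear maps. *)
Lemma mem_bilin_span (U : {vspace L}) (H : {vspace M}) u v :
  (forall v, linear (op^~ v)) -> (forall u, linear (op u)) ->
  u \in U -> v \in H -> op u v \in <<[seq op u v | u <- vbasis U, v <- vbasis H]>>%VS.
Proof.
set T := <<_>>%VS => hl hr uU vH.
have T1 a : a \in vbasis U -> op a v \in T.
  move=> aU; rewrite -(linfun_linear (hr a)) memv_preim; move: v vH; apply/subvP.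
  rewrite -{1}(span_basis (vbasisP H)); apply/span_subvP=> b bH.
  rewrite -memv_preim linfun_linear //; apply: memv_span.
  by apply/allpairsP; exists (a, b).
rewrite -(linfun_linear (hl v)) memv_preim; move: u uU; apply/subvP.
rewrite -{1}(span_basis (vbasisP U)); apply/span_subvP=> a aU.
by rewrite -memv_preim linfun_linear // T1.
Qed.
End BilinearSpan.

Lemma limg_preim (F : fieldType) (M A : vectType F) (k : 'Hom(M, A)) (U0 : {vspace M}) (N : {vspace A}) :
  (N <= k @: U0)%VS -> (k @: (U0 :&: k @^-1: N))%VS = N.
Proof.
move=> NU; apply: subv_anti; apply/andP; split; apply/subvP.
  by move=> _ /memv_imgP[u uU ->]; move: uU; rewrite memv_cap -memv_preim => /andP[].
move=> a aN; have /memv_imgP[u uU e] := subvP NU a aN.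
by rewrite e memv_img // memv_cap uU -memv_preim -e.
Qed.

(** * Subquotients as preimages of submodules *)

Section Modules.
Variables (F : fieldType) (L M A : vectType F) (h : {vspace L}).
Variables (act : L -> M -> M) (rho : L -> A -> A).

Lemma dim_preim (k : 'Hom(M, A)) (U0 : {vspace M}) (N : {vspace A}) :
  (N <= k @: U0)%VS ->
  quotient_dim (U0 :&: k @^-1: N) (U0 :&: lker k) = \dim N.
Proof.
move=> NU; rewrite /quotient_dim -[in RHS](limg_preim NU).
rewrite -(limg_ker_dim k (U0 :&: k @^-1: N)).
have -> : (U0 :&: k @^-1: N :&: lker k = U0 :&: lker k)%VS.
  rewrite -capvA; congr (_ :&: _)%VS; apply/capv_idPr.
  by rewrite -lpreim0; apply/subvP=> u; rewrite -!memv_preim memv0 => /eqP->; exact: mem0v.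
by rewrite addKn.
Qed.

(** The correspondence theorem: submodules between the kernel and a preimage are the preimages of
    their images, so irreducibility is decided in the target. *)
Lemma irreducible_preim (k : 'Hom(M, A)) (U0 : {vspace M}) (N : {vspace A}) :
  stable h act U0 ->
  (forall x u, x \in h -> u \in U0 -> k (act x u) = rho x (k u)) ->
  (N <= k @: U0)%VS ->
  irreducible h rho N 0%VS ->
  irreducible h act (U0 :&: k @^-1: N) (U0 :&: lker k).
Proof.
move=> stU eq NU [stN st0 _ N0 irN].
have lkN : (U0 :&: lker k <= U0 :&: k @^-1: N)%VS.
  rewrite capvS // -lpreim0; apply/subvP=> u; rewrite -!memv_preim memv0 => /eqP->.
  exact: mem0v.
split=> //.
- move=> x u xh; rewrite !memv_cap -!memv_preim => /andP[uU kN].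
  by rewrite stU // eq // stN.
- move=> x u xh; rewrite !memv_cap !memv_ker => /andP[uU k0].
  by rewrite stU // eq // -memv0 st0 // memv0.
- by move=> e; apply: N0; apply/eqP; rewrite -dimv_eq0 -(dim_preim NU) e /quotient_dim subnn.
move=> X stX BX XU.
have XU0 : (X <= U0)%VS by apply: subv_trans XU (capvSl _ _).
have XE : X = (U0 :&: k @^-1: (k @: X))%VS.
  apply: subv_anti; apply/andP; split; apply/subvP=> u.
    by move=> uX; rewrite memv_cap (subvP XU0) // -memv_preim memv_img.
  rewrite memv_cap -memv_preim => /andP[uU /memv_imgP[v vX e]].
  rewrite -(subrK v u); apply: rpredD => //; apply: (subvP BX).
  rewrite memv_cap memv_ker linearB /= e subrr eqxx andbT.
  by apply: memvB => //; apply: (subvP XU0).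
have [] := irN (k @: X)%VS.
- move=> x w xh /memv_imgP[u uX ->]; rewrite -eq ?(subvP XU0) //.
  by rewrite memv_img // stX.
- exact: sub0v.
- by rewrite -(limg_preim NU) limgS.
- by move=> e; left; rewrite XE e lpreim0.
- by move=> e; right; rewrite XE e.
Qed.

(** Another irreducible submodule meets [N] in zero or lies inside [N]. In the first case it embeds
    in the quotient by [N], whose dimension is that of [K]; in the second it equals [N]. *)
Lemma top_component_sum (N K : {vspace M}) :
  irreducible h act N 0%VS -> (N :&: K = 0)%VS -> (\dim K < \dim N)%N ->
  top_component h act (N + K) N.
Proof.
move=> irN NK dK; split=> //; first exact: addvSl.
move=> N' [stN' st0 _ N'0 irN'] N'T N'N.
have stI : stable h act (N' :&: N)%VS.
  by case: irN => stN _ _ _ _ x u xh; rewrite !memv_cap => /andP[? ?]; rewrite stN' // stN.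
have [] := irN' (N' :&: N)%VS stI (sub0v _) (capvSl _ _).
- move=> I0; apply: leq_ltn_trans dK.
  have := dimv_disjoint_sum I0; have := dimv_disjoint_sum NK.
  have : (\dim (N' + N) <= \dim (N + K))%N by apply: dimvS; rewrite subv_add N'T addvSl.
  by lia.
- move/capv_idPl=> N'sN; case: irN => _ _ _ _ irN.
  by have [] := irN N' stN' (sub0v _) N'sN.
Qed.

(** Serves to identify a submodule by its dimension alone. If [X] met [N] trivially, then [X + N]
    would either meet [K] trivially, which is too large for [N + K], or contain [K], which forces
    equal dimensions of [N] and [K]. Stability of [X + N] is assumed because the action is a bare
    function, not known to be additive. *)
Lemma stable_dim_uniq (N K X : {vspace M}) :
  irreducible h act N 0%VS -> irreducible h act K 0%VS -> (N :&: K = 0)%VS ->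
  \dim N <> \dim K -> stable h act (X + N)%VS -> stable h act X ->
  (X <= N + K)%VS -> \dim X = \dim N -> X = N.
Proof.
move=> [stN _ _ N0 irN] [stK _ _ K0 irK] NK dNK stXN stX XT dX.
have stI Y Z : stable h act Y -> stable h act Z -> stable h act (Y :&: Z)%VS.
  by move=> sY sZ x u xh; rewrite !memv_cap => /andP[? ?]; rewrite sY // sZ.
have [XN|] := irN (X :&: N)%VS (stI _ _ stX stN) (sub0v _) (capvSr _ _); last first.
  move/capv_idPr=> NX; apply/eqP; rewrite eq_sym -(dimv_leqif_eq NX).
  by rewrite dX.
exfalso; have dN : (0 < \dim N)%N by rewrite lt0n dimv_eq0; apply/eqP.
have d2 := dimv_disjoint_sum XN; have d1 := dimv_disjoint_sum NK.
have XNT : (X + N <= N + K)%VS by rewrite subv_add XT addvSl.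
have [Y0|] := irK ((X + N) :&: K)%VS (stI _ _ stXN stK) (sub0v _) (capvSr _ _).
  have := dimv_disjoint_sum Y0; have : (\dim (X + N + K) <= \dim (N + K))%N.
    by apply: dimvS; rewrite subv_add XNT addvSr.
  lia.
move/capv_idPr=> KX; have : (\dim (N + K) <= \dim (X + N))%N.
  by apply: dimvS; rewrite subv_add KX addvSr.
have := dimvS XNT; lia.
Qed.

(** The kernel of [f] on [U] lies in [B], and [f @: U] meets [B'] exactly in [f @: B]; the rank
    formulas for [U] and [B] then differ by the two quotient dimensions. *)
Lemma isomorphic_dim (M' : vectType F) (act' : L -> M' -> M')
    (U B : {vspace M}) (U' B' : {vspace M'}) :
  isomorphic h act act' U B U' B' -> quotient_dim U B = quotient_dim U' B'.
Proof.
move=> [f [fU fB _]]; rewrite /quotient_dim.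
have BU : (B <= U)%VS by rewrite -fB capvSl.
have e : (f @: U :&: B' = f @: B)%VS.
  apply: subv_anti; apply/andP; split; apply/subvP.
    move=> _ /memv_capP[/memv_imgP[u uU ->] fu].
    by rewrite memv_img // -fB memv_cap uU -memv_preim.
  move=> _ /memv_imgP[u uB ->]; rewrite memv_cap memv_img ?(subvP BU) //=.
  by move: uB; rewrite -fB memv_cap -memv_preim => /andP[].
have := dimv_sum_cap (f @: U) B'; rewrite fU e.
have := limg_ker_dim f U; have := limg_ker_dim f B.
have -> : (B :&: lker f = U :&: lker f)%VS.
  apply: subv_anti; rewrite capvS //=; apply/subvP=> u.
  rewrite -fB !memv_cap !memv_ker -memv_preim => /andP[-> /eqP->].
  by rewrite mem0v eqxx.
have := dimvS BU; have : (B' <= U')%VS by rewrite -fU addvSr.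
move/dimvS; lia.
Qed.

Variables (M' : vectType F) (act' : L -> M' -> M').
Variables (i : 'Hom(A, M')) (N : {vspace A}).
Hypotheses (stN : stable h rho N) (iN : (N :&: lker i = 0)%VS).
Hypothesis eqi : forall x a, x \in h -> a \in N -> i (rho x a) = act' x (i a).

Lemma irreducible_img :
  irreducible h rho N 0%VS -> irreducible h act' (i @: N) 0%VS.
Proof.
move=> [_ st0 _ N0 irN].
have injN a b : a \in N -> b \in N -> i a = i b -> a = b.
  move=> aN bN e; apply/eqP; rewrite -subr_eq0 -memv0 -iN memv_cap memvB //=.
  by rewrite memv_ker linearB /= e subrr eqxx.
split.
- move=> x w xh /memv_imgP[a aN ->]; rewrite -eqi // memv_img //; exact: stN.
- move=> x u xh; rewrite memv0 => /eqP->; have := eqi xh (mem0v N).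
  rewrite linear0 => <-; have : rho x 0 \in 0%VS by apply: st0; rewrite ?mem0v.
  by rewrite memv0 => /eqP->; rewrite linear0 mem0v.
- exact: sub0v.
- by move=> e; apply: N0; apply/eqP; rewrite -dimv_eq0 -(limg_dim_eq iN) e dimv0.
move=> X stX _ XN.
have XE : X = (i @: (N :&: i @^-1: X))%VS by rewrite limg_preim.
have [] := irN (N :&: i @^-1: X)%VS.
- move=> x a xh; rewrite !memv_cap -!memv_preim => /andP[aN aX].
  by rewrite stN //= eqi // stX.
- exact: sub0v.
- exact: capvSl.
- by move=> e; left; rewrite XE e limg0.
- by move=> e; right; rewrite XE e.
Qed.

(** Composing [k] with [i] realises the quotient as a concrete submodule of [M']; injectivity and
    equivariance of [i] are only required on [N]. *)
Lemma isomorphic_preim (k : 'Hom(M, A)) (U0 : {vspace M}) :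
  (forall x u, x \in h -> u \in U0 -> k (act x u) = rho x (k u)) ->
  (N <= k @: U0)%VS ->
  isomorphic h act act' (U0 :&: k @^-1: N) (U0 :&: lker k) (i @: N) 0%VS.
Proof.
move=> eq NU; exists (i \o k)%VF; split.
- by rewrite addv0 limg_comp limg_preim.
- rewrite lpreim0; apply/vspaceP=> u; rewrite !memv_cap !memv_ker lfunE /= -memv_preim.
  case: (u \in U0) => //=; apply/andP/eqP=> [[kN /eqP i0]|->]; last by rewrite linear0 mem0v.
  by apply/eqP; rewrite -memv0 -iN memv_cap kN memv_ker i0 /=.
- move=> x u xh; rewrite memv_cap -memv_preim => /andP[uU kN].
  by rewrite !lfunE /= eq // eqi // subrr mem0v.
Qed.
End Modules.

(** * Three-index arrays under gl_m *)

Section Arrays.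
Variables (F : numFieldType) (m : nat).
Local Notation I := 'I_m.
Local Notation arr := {ffun 'I_m -> 'M[F]_m}.
Implicit Types (x y : arr) (s : weight) (A : 'M[F]_m).

Definition arr3 (f : I -> I -> I -> F) : arr := [ffun i => \matrix_(j, k) f i j k].

Lemma arr3E f i j k : arr3 f i j k = f i j k.
Proof. by rewrite ffunE mxE. Qed.

Lemma arrP x y : (forall i j k, x i j k = y i j k) -> x = y.
Proof. by move=> h; apply/ffunP=> i; apply/matrixP=> j k. Qed.

Lemma arrDE x y i j k : (x + y) i j k = x i j k + y i j k.
Proof. by rewrite ffunE mxE. Qed.
Lemma arrNE x i j k : (- x) i j k = - x i j k.
Proof. by rewrite ffunE mxE. Qed.
Lemma arrZE a x i j k : (a *: x) i j k = a * x i j k.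
Proof. by rewrite ffunE mxE. Qed.
Lemma arr0E i j k : (0 : arr) i j k = 0.
Proof. by rewrite ffunE mxE. Qed.
Definition arrE := (arr3E, arrDE, arrNE, arrZE, arr0E).

Lemma sum_delta (T : finType) (G : T -> F) p : \sum_l (l == p)%:R * G l = G p.
Proof.
rewrite (bigD1 p) //= eqxx mul1r big1 ?addr0 // => l /negbTE->.
by rewrite mul0r.
Qed.

Lemma sum_delta_sym (T : finType) (G : T -> F) p : \sum_l (p == l)%:R * G l = G p.
Proof. by rewrite -[RHS](sum_delta G); apply: eq_bigr => l _; rewrite eq_sym. Qed.

(* The index [i] of an array is contragredient to [j] and [k] for the weight -1/2. *)
Definition slot s A : 'M[F]_m := if s is wt_m32 then A else - A^T.

Definition rho s A x : arr := arr3 (fun i j k =>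
  \sum_l (slot s A i l * x l j k + A j l * x i l k + A k l * x i j l)).

Lemma rho_linear s A : linear (rho s A).
Proof.
move=> a x y; apply: arrP => i j k; rewrite !arrE mulr_sumr -big_split.
by apply: eq_bigr => l _ /=; rewrite !arrE; ring.
Qed.


(** Matrix units replace one index by another. The submodule arguments below use no other
    operators. *)
Lemma rho_delta s a b x i j k :
  rho s (delta_mx a b) x i j k =
    (if s is wt_m32 then (i == a)%:R * x b j k else - ((i == b)%:R * x a j k))
    + (j == a)%:R * x i b k + (k == a)%:R * x i j b.
Proof.
rewrite arr3E !big_split /=; congr (_ + _ + _).
- case: s.
    rewrite -[in RHS](sum_delta (fun l => x l j k) b) mulr_sumr; apply: eq_bigr => l _.
    by rewrite mxE -mulnb natrM -mulrA.
  rewrite -[in RHS](sum_delta (fun l => x l j k) a) mulr_sumr -sumrN; apply: eq_bigr => l _.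
  by rewrite !mxE -mulnb natrM; ring.
- rewrite -[in RHS](sum_delta (fun l => x i l k) b) mulr_sumr; apply: eq_bigr => l _.
  by rewrite mxE -mulnb natrM -mulrA.
- rewrite -[in RHS](sum_delta (fun l => x i j l) b) mulr_sumr; apply: eq_bigr => l _.
  by rewrite mxE -mulnb natrM -mulrA.
Qed.

Lemma lin3 (f : arr -> I -> I -> I -> F) :
  (forall a x y i j k, f (a *: x + y) i j k = a * f x i j k + f y i j k) ->
  linear (fun x => arr3 (f x)).
Proof. by move=> h a x y; apply: arrP => i j k; rewrite !arrE h. Qed.

Lemma mem_lker3 (f : arr -> I -> I -> I -> F) x :
  (forall a x y i j k, f (a *: x + y) i j k = a * f x i j k + f y i j k) ->
  reflect (forall i j k, f x i j k = 0) (x \in lker (linfun (fun x => arr3 (f x)))).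
Proof.
move=> h; rewrite memv_ker linfun_linear; last exact: lin3.
apply: (iffP eqP) => [e i j k|e]; first by rewrite -(arr3E (f x)) e arr0E.
by apply: arrP => i j k; rewrite arr3E e arr0E.
Qed.

Definition ctrace x k : F := \sum_i x i i k.

Lemma ctrace_lin a x y k : ctrace (a *: x + y) k = a * ctrace x k + ctrace y k.
Proof. by rewrite /ctrace mulr_sumr -big_split; apply: eq_bigr => i _; rewrite !arrE. Qed.

Definition eskew x i j k := x i j k + x i k j.
Definition ealt x i j k := x i j k + x j i k.
Definition ecyc x i j k := x i j k + x j k i + x k i j.
(** The factor [m - 1] avoids a division: the contraction of [puret t] is [m - 1] times [t], so the
    equation says that [x] is the pure trace array built from its own contraction. *)
Definition epure x i j k : F :=
  (m%:R - 1) * x i j k - ((i == j)%:R * ctrace x k - (i == k)%:R * ctrace x j).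
Definition etr x (i j k : I) := ctrace x k.

(** The boolean is the upper index j of W_i^j. Equation [false] defines the smaller component,
    totally skew or pure trace, and [true] the larger one, of zero cyclic sum or trace-free. *)
Definition comp_eq s (b : bool) :=
  match s, b with
  | wt_m32, false => ealt | wt_m32, true => ecyc
  | wt_m12, false => epure | wt_m12, true => etr
  end.

Definition sk2 : {vspace arr} := lker (linfun (fun x => arr3 (eskew x))).
Definition arr_comp s b : {vspace arr} :=
  (sk2 :&: lker (linfun (fun x => arr3 (comp_eq s b x))))%VS.

Lemma mem_sk2 x : reflect (forall i j k, x i j k = - x i k j) (x \in sk2).
Proof.
apply: (iffP (mem_lker3 _ _)) => [a u v i j k|h i j k|h i j k].
- by rewrite /eskew !arrE; ring.
- by apply/eqP; rewrite -addr_eq0; apply/eqP/h.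
- by rewrite /eskew h addNr.
Qed.

Lemma comp_eq_lin s b a x y i j k :
  comp_eq s b (a *: x + y) i j k = a * comp_eq s b x i j k + comp_eq s b y i j k.
Proof.
case: s; case: b; rewrite /= /ealt /ecyc /epure /etr ?ctrace_lin ?arrE; ring.
Qed.

Lemma mem_arr_comp s b x :
  reflect (x \in sk2 /\ forall i j k, comp_eq s b x i j k = 0) (x \in arr_comp s b).
Proof.
have E := @mem_lker3 _ x (@comp_eq_lin s b).
by rewrite memv_cap; apply: (iffP andP) => -[sk] /E.
Qed.

Lemma comp_sub s b : (arr_comp s b <= sk2)%VS. Proof. exact: capvSl. Qed.

Definition puret (t : I -> F) : arr :=
  arr3 (fun i j k => (i == j)%:R * t k - (i == k)%:R * t j).

Lemma puret_sk2 t : puret t \in sk2.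
Proof. by apply/mem_sk2=> i j k; rewrite !arrE opprB. Qed.

Lemma ctrace_puret t k : ctrace (puret t) k = (m%:R - 1) * t k.
Proof.
rewrite /ctrace; under eq_bigr do rewrite arr3E eqxx mul1r.
by rewrite sumrB sum_delta sumr_const card_ord mulrBl mul1r mulr_natl.
Qed.

Lemma stable_sk2 s : stable fullv (rho s) sk2.
Proof.
move=> A x _ /mem_sk2 sk; apply/mem_sk2=> i j k; rewrite !arr3E -sumrN.
apply: eq_bigr => l _; rewrite (sk l j k) (sk i l k) (sk i j l); ring.
Qed.

Hypothesis m2 : (2 < m)%N.

Lemma m1_neq0 : m%:R - 1 != 0 :> F.
Proof. by rewrite subr_eq0 -[1]/(1%:R) eqr_nat; lia. Qed.

Lemma mem_pureP x : reflect (exists t, x = puret t) (x \in arr_comp wt_m12 false).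
Proof.
apply: (iffP (mem_arr_comp _ _ _)) => [[sk h]|[t ->]].
  exists (fun k => (m%:R - 1)^-1 * ctrace x k); apply: arrP => i j k; rewrite arr3E.
  apply: (mulfI m1_neq0); have /eqP := h i j k; rewrite subr_eq0 => /eqP->.
  by field; exact: m1_neq0.
split; first exact: puret_sk2.
by move=> i j k; rewrite /= /epure !ctrace_puret arr3E; ring.
Qed.

(** The first index is dual to the other two, so the Kronecker delta is invariant and only [t]
    transforms: pure traces are a copy of the standard module. *)
Lemma rho_puret A t : rho wt_m12 A (puret t) = puret (fun k => \sum_l A k l * t l).
Proof.
apply: arrP => i j k; rewrite !arr3E.
transitivity (\sum_l ((l == j)%:R * (- A l i * t k) - (l == k)%:R * (- A l i * t j)
  + (i == l)%:R * (A j l * t k) - (i == k)%:R * (A j l * t l)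
  + (i == j)%:R * (A k l * t l) - (i == l)%:R * (A k l * t j))).
  by apply: eq_bigr => l _; rewrite !arr3E !mxE; ring.
rewrite !(sumrB, big_split) /= !sum_delta !sum_delta_sym -!mulr_sumr; ring.
Qed.

Lemma stable_arr_comp s b : stable fullv (rho s) (arr_comp s b).
Proof.
case: s; case: b => A x _ H; move/mem_arr_comp: (H) => [sk h]; apply/mem_arr_comp;
  (split; first by apply: stable_sk2 (memvf _) sk) => i j k; rewrite /= in h.
- have e p q r : x p q r = - x q r p - x r p q.
    by have /eqP := h p q r; rewrite /ecyc -addrA addr_eq0 => /eqP->; ring.
  rewrite /= /ecyc !arr3E -!big_split big1 //= => l _.
  rewrite (e l j k) (e i l k) (e i j l); ring.
- have e p q r : x p q r = - x q p r.
    by apply/eqP; rewrite -addr_eq0; apply/eqP/h.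
  rewrite /= /ealt !arr3E -!big_split big1 //= => l _.
  rewrite (e l j k) (e i l k) (e i j l); ring.
(* In the contraction the dual first index and the second index contribute opposite terms; the third
   index only combines contractions that vanish already. *)
- rewrite /= /etr /ctrace; under eq_bigr do rewrite arr3E !big_split.
  rewrite /= !big_split /= exchange_big /= -big_split big1 /= ?add0r; last first.
    by move=> p _; rewrite -big_split big1 //= => q _; rewrite !mxE mulNr addNr.
  rewrite exchange_big big1 //= => l _; rewrite -mulr_sumr.
  by rewrite -[\sum_i _]/(ctrace x l) (h l l l : ctrace x l = 0) mulr0.
- have /mem_pureP[t ->] := H; rewrite rho_puret.
  have /mem_arr_comp[_] : puret (fun k => \sum_l A k l * t l) \in arr_comp wt_m12 false.
    by apply/mem_pureP; exists (fun k => \sum_l A k l * t l).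
  exact.
Qed.

(** On totally skew arrays the cyclic sum is three times the array; on trace-free arrays [epure] is
    [m - 1] times the array. *)
Lemma comp_cap s : (arr_comp s false :&: arr_comp s true = 0)%VS.
Proof.
apply/eqP; rewrite -subv0; apply/subvP=> x; rewrite memv_cap memv0.
case/andP=> /mem_arr_comp[/mem_sk2 sk h1] /mem_arr_comp[_ h2]; apply/eqP/arrP => i j k.
rewrite arr0E; case: s h1 h2 => /= h1 h2.
- have e p q r : x p q r = - x q p r.
    by apply/eqP; rewrite -addr_eq0; apply/eqP/h1.
  have := h2 i j k; rewrite /ecyc (e k i j) (sk j k i) (e j i k) (sk i k j) !opprK => /eqP.
  have -> : x i j k + x i j k + x i j k = x i j k * 3%:R by ring.
  by rewrite mulf_eq0 pnatr_eq0 orbF => /eqP.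
- have := h1 i j k; rewrite /epure (h2 k k k : ctrace x k = 0) (h2 j j j : ctrace x j = 0).
  by rewrite !mulr0 !subr0 => /eqP; rewrite mulf_eq0 (negbTE m1_neq0) => /eqP.
Qed.

(** For arrays already skew in the last two indices, a third of the cyclic sum is the full
    antisymmetrisation. The other component is reached by subtracting this projection. *)
Definition proj0 s x : arr :=
  if s is wt_m32 then arr3 (fun i j k => 3^-1 * ecyc x i j k)
  else puret (fun k => (m%:R - 1)^-1 * ctrace x k).

Lemma proj0_lin s : linear (proj0 s).
Proof.
move=> a x y; apply: arrP => i j k; case: s => /=; rewrite ?arrE /ecyc ?arrE;
 rewrite ?ctrace_lin; ring.
Qed.

Lemma proj0P s x : x \in sk2 -> proj0 s x \in arr_comp s false.
Proof.
case: s => h; last by apply/mem_pureP; eexists.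
move/mem_sk2: h => h.
apply/mem_arr_comp; split; first by apply/mem_sk2=> i j k; rewrite !arr3E /ecyc (h i k j) (h k j i) (h j i k); ring.
by move=> i j k; rewrite /= /ealt !arr3E /ecyc (h i k j) (h k j i) (h j i k); ring.
Qed.

Lemma proj0C s x : x \in sk2 -> x - proj0 s x \in arr_comp s true.
Proof.
move=> h; apply/mem_arr_comp; split; first by rewrite memvB ?(subvP (comp_sub _ _) _ (proj0P _ h)).
case: s => i j k /=.
  rewrite /ecyc !arrE /ecyc; field.
  by [].
rewrite /etr addrC -scaleN1r ctrace_lin ctrace_puret; field; exact: m1_neq0.
Qed.

Lemma comp_add s : (arr_comp s false + arr_comp s true = sk2)%VS.
Proof.
apply: subv_anti; rewrite subv_add !comp_sub /=; apply/subvP=> x h.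
by rewrite -(subrK (proj0 s x) x) addrC memv_add ?proj0P ?proj0C.
Qed.

Lemma proj0_id s x : x \in arr_comp s false -> proj0 s x = x.
Proof.
move=> h; have /mem_arr_comp[sk _] := h; apply/eqP; rewrite eq_sym -subr_eq0 -memv0 -(comp_cap s).
by rewrite memv_cap proj0C // memvB ?proj0P.
Qed.
End Arrays.

(** * A contravariant form, the irreducibility criterion and the dimensions of the components *)

Section Irreducibility.
Variables (F : numFieldType) (m : nat).
Local Notation I := 'I_m.
Local Notation arr := {ffun 'I_m -> 'M[F]_m}.
Implicit Types (x y : arr) (s : weight) (A : 'M[F]_m).

Lemma sum_prod3 (f : I -> I -> I -> F) :
  \sum_(t : I * I * I) f t.1.1 t.1.2 t.2 = \sum_i \sum_j \sum_k f i j k.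
Proof. by rewrite pair_bigA pair_bigA. Qed.

Definition dot x y : F := \sum_i \sum_j \sum_k x i j k * y i j k.

Lemma dot_lin a x y z : dot x (a *: y + z) = a * dot x y + dot x z.
Proof.
rewrite /dot mulr_sumr -big_split; apply: eq_bigr => i _ /=.
rewrite mulr_sumr -big_split; apply: eq_bigr => j _ /=.
by rewrite mulr_sumr -big_split; apply: eq_bigr => k _ /=; rewrite !arrE; ring.
Qed.

Lemma dot0 x : dot x 0 = 0.
Proof. by rewrite /dot big1 // => i _; rewrite big1 // => j _; rewrite big1 // => k _; rewrite arrE mulr0. Qed.

Lemma dot_sum x (J : finType) (a : J -> F) (u : J -> arr) :
  dot x (\sum_j a j *: u j) = \sum_j a j * dot x (u j).
Proof. by elim/big_rec2: _ => [|j v w _ <-]; rewrite ?dot0 ?dot_lin. Qed.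

Lemma dotC x y : dot x y = dot y x.
Proof. by apply: eq_bigr => i _; apply: eq_bigr => j _; apply: eq_bigr => k _; exact: mulrC. Qed.

Lemma slot_tr s A : slot s A^T = (slot s A)^T.
Proof. by case: s => //=; rewrite linearN. Qed.

(** Transposition is the adjoint for [dot], also in the contragredient slot, so orthogonals of
    submodules are submodules. *)
Lemma dot_rho s A x y : dot (rho s A x) y = dot x (rho s A^T y).
Proof.
rewrite /dot.
have E u v B : \sum_i \sum_j \sum_k rho s B u i j k * v i j k =
  \sum_i \sum_j \sum_k \sum_l slot s B i l * u l j k * v i j k +
  \sum_i \sum_j \sum_k \sum_l B j l * u i l k * v i j k +
  \sum_i \sum_j \sum_k \sum_l B k l * u i j l * v i j k.
  rewrite -!big_split; apply: eq_bigr => i _ /=; rewrite -!big_split; apply: eq_bigr => j _ /=.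
  rewrite -!big_split; apply: eq_bigr => k _ /=; rewrite arr3E mulr_suml -!big_split.
  by apply: eq_bigr => l _ /=; ring.
under [RHS]eq_bigr do under eq_bigr do under eq_bigr do rewrite mulrC.
rewrite !E; congr (_ + _ + _).
- under [LHS]eq_bigr do (under eq_bigr do rewrite exchange_big; rewrite exchange_big).
  rewrite exchange_big; apply: eq_bigr => i _ /=.
  under [RHS]eq_bigr do rewrite exchange_big; rewrite [RHS]exchange_big.
  apply: eq_bigr => l _; apply: eq_bigr => j _; apply: eq_bigr => k _.
  by rewrite slot_tr !mxE; ring.
- apply: eq_bigr => i _ /=.
  under [LHS]eq_bigr do rewrite exchange_big; rewrite exchange_big; apply: eq_bigr => l _ /=.
  under [RHS]eq_bigr do idtac; rewrite [RHS]exchange_big; apply: eq_bigr => j _.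
  by apply: eq_bigr => k _; rewrite !mxE; ring.
- apply: eq_bigr => i _; apply: eq_bigr => j _ /=; rewrite exchange_big.
  apply: eq_bigr => l _; apply: eq_bigr => k _; by rewrite !mxE; ring.
Qed.

Definition orth (X : {vspace arr}) : {vspace arr} :=
  lker (linfun (fun y => \row_(i < \dim X) dot (vbasis X)`_i y)).

Lemma orth_linear (X : {vspace arr}) : linear (fun y => \row_(i < \dim X) dot (vbasis X)`_i y).
Proof. by move=> a y z; apply/rowP=> i; rewrite !mxE dot_lin. Qed.

Lemma memorthP (X : {vspace arr}) y : reflect (forall x, x \in X -> dot x y = 0) (y \in orth X).
Proof.
rewrite memv_ker linfun_linear; last exact: orth_linear.
apply: (iffP eqP) => [e x xX|h].
  rewrite (coord_vbasis xX) dotC dot_sum big1 // => i _.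
  by have /rowP/(_ i) := e; rewrite !mxE dotC => ->; rewrite mulr0.
by apply/rowP=> i; rewrite !mxE h // vbasis_mem // mem_nth // size_tuple.
Qed.

Lemma dim_orth (X : {vspace arr}) : (dim arr <= \dim X + \dim (orth X))%N.
Proof.
rewrite -dimvf -(limg_ker_dim (linfun (fun y => \row_(i < \dim X) dot (vbasis X)`_i y)) fullv).
rewrite capfv addnC leq_add2r; apply: leq_trans (dimvS (subvf _)) _.
by rewrite dimvf dim_matrix mul1r.
Qed.

(* The orthogonal of a nonzero proper submodule X is a nonzero submodule too, so both contain
   an array whose (p, q, r) entry is nonzero; the weight operator H, which preserves X, reduces
   the dot product of the two to the product of these entries. *)
Lemma dot_irreducible s (N : {vspace arr}) (p q r : I) (H : arr -> arr) (c : F) :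
  stable fullv (rho s) N -> N <> 0%VS -> c != 0 ->
  (forall X : {vspace arr}, stable fullv (rho s) X -> (X <= N)%VS ->
     (forall x, x \in X -> x p q r = 0) -> X = 0%VS) ->
  (forall X : {vspace arr}, stable fullv (rho s) X -> forall x, x \in X -> H x \in X) ->
  (forall x y, x \in N -> y \in N -> dot (H x) y = c * x p q r * y p q r) ->
  irreducible fullv (rho s) N 0%VS.
Proof.
move=> stN N0 c0 Hz HH Hc.
have st0 : stable fullv (rho s) (0%VS : {vspace arr}).
  move=> A x _; rewrite !memv0 => /eqP->; apply/eqP/arrP => i j k.
  by rewrite arr3E big1 ?arrE // => l _; rewrite !arrE !mulr0 !addr0.
split=> //; first exact: sub0v.
move=> X stX _ XN.
pose ev := linfun (fun x : arr => arr3 (fun _ _ _ => x p q r) : arr).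
have evP x : reflect (x p q r = 0) (x \in lker ev).
  have E := @mem_lker3 F m (fun x _ _ _ => x p q r) x.
  by apply: (iffP (E _)) => [a u v i j k|h|h i j k]; rewrite ?arrE //; exact: h p q r.
have nz (Y : {vspace arr}) : stable fullv (rho s) Y -> (Y <= N)%VS -> Y <> 0%VS ->
    exists2 y, y \in Y & y p q r != 0.
  move=> stY YN Y0; have /subvPn[y yY yk] : ~~ (Y <= lker ev)%VS.
    by apply/negP => /subvP h; apply: Y0; apply: Hz => // y /h/evP.
  by exists y => //; apply/eqP => /evP; apply/negP.
have [->|/eqP X0] := eqVneq X 0%VS; [by left|right].
have [x xX xn] := nz X stX XN X0.
pose Y := (N :&: orth X)%VS.
have stY : stable fullv (rho s) Y.
  move=> A y _; rewrite !memv_cap => /andP[yN /memorthP yX]; apply/andP; split.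
    by apply: stN => //; exact: memvf.
  apply/memorthP => z zX; rewrite -[A]trmxK -dot_rho; apply: yX.
  by apply: stX => //; exact: memvf.
have Y0 : Y = 0%VS.
  apply/eqP; have [//|/eqP Yn] := eqVneq Y 0%VS.
  have [y yY yn] := nz Y stY (capvSl _ _) Yn.
  move: yY; rewrite memv_cap => /andP[yN /memorthP yX].
  have := yX _ (HH X stX x xX); rewrite (Hc _ _ (subvP XN _ xX) yN) => /eqP.
  by rewrite !mulf_eq0 (negbTE c0) (negbTE xn) (negbTE yn).
(* As [Y = 0], the dimensions of [N] and [orth X] add up to at most that of the whole space, which
   is at most that of [X] plus that of [orth X]. *)
apply/eqP; rewrite -(dimv_leqif_eq XN) eqn_leq dimvS //=.
rewrite -(leq_add2r (\dim (orth X))) -(dimv_disjoint_sum Y0).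
by apply: leq_trans (dim_orth X); rewrite -dimvf dimvS ?subvf.
Qed.

(** Dimensions become traces of projections in the basis of elementary arrays, that is, sums of
    Kronecker deltas. *)
Lemma trace3 (P : 'End(arr)) :
  (forall x, P (P x) = P x) ->
  (\dim (limg P))%:R = \sum_i \sum_j \sum_k
     P (arr3 (fun i' j' k' => (i' == i)%:R * (j' == j)%:R * (k' == k)%:R)) i j k.
Proof.
move=> PP; pose b (t : I * I * I) : arr :=
  arr3 (fun i' j' k' => (i' == t.1.1)%:R * (j' == t.1.2)%:R * (k' == t.2)%:R).
rewrite (@dim_idem _ _ _ b (fun t x => x t.1.1 t.1.2 t.2)) //.
- by rewrite -sum_prod3.
- move=> x; apply: arrP => i j k; rewrite sum_ffunE summxE.
  under eq_bigr do rewrite !arrE.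
  rewrite (sum_prod3 (fun i' j' k' => x i' j' k' * ((i == i')%:R * (j == j')%:R * (k == k')%:R))).
  transitivity (\sum_i' (i == i')%:R * (\sum_j' (j == j')%:R * (\sum_k' (k == k')%:R * x i' j' k'))).
    by rewrite !sum_delta_sym.
  apply: eq_bigr => i' _; rewrite mulr_sumr; apply: eq_bigr => j' _.
  by rewrite !mulr_sumr; apply: eq_bigr => k' _; ring.
- by move=> [[i j] k] a u v; rewrite !arrE.
Qed.

Definition skp x : arr := arr3 (fun i j k => 2^-1 * (x i j k - x i k j)).
Definition altp x : arr := proj0 wt_m32 (skp x).

Lemma skp_lin : linear skp.
Proof. by move=> a x y; apply: arrP => i j k; rewrite !arrE; ring. Qed.

Lemma altp_lin : linear altp.
Proof. by move=> a x y; rewrite /altp skp_lin proj0_lin. Qed.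

Lemma skp_id x : x \in sk2 F m -> skp x = x.
Proof. by move/mem_sk2 => h; apply: arrP => i j k; rewrite arr3E (h i k j); field. Qed.

Lemma skp_sk2 x : skp x \in sk2 F m.
Proof. by apply/mem_sk2=> i j k; rewrite !arr3E; ring. Qed.

Hypothesis m2 : (2 < m)%N.

Lemma sum_delta1 (p : I) : \sum_l (p == l)%:R = 1 :> F.
Proof. by rewrite -[RHS](sum_delta_sym (fun=> 1) p); apply: eq_bigr => l _; rewrite mulr1. Qed.

(** The trace of [skp] is half the number of triples with distinct last two indices. The equation is
    arranged without truncated subtraction. *)
Lemma dim_sk2 : (2 * \dim (sk2 F m) + m ^ 2 = m ^ 3)%N.
Proof.
have e : limg (linfun skp) = sk2 F m.
  apply: subv_anti; apply/andP; split; apply/subvP=> x.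
    by case/memv_imgP=> u _ ->; rewrite linfun_linear ?skp_sk2 //; exact: skp_lin.
  move=> h; rewrite -(skp_id h) -(linfun_linear skp_lin) memv_img ?memvf //.
have := @trace3 (linfun skp); rewrite e => t.
have {t} : (\dim (sk2 F m))%:R = \sum_(i < m) \sum_(j < m) \sum_(k < m) 2^-1 * (1 - (j == k)%:R) :> F.
  rewrite t; last by move=> x; rewrite !(linfun_linear skp_lin) skp_id ?skp_sk2.
  apply: eq_bigr => i _; apply: eq_bigr => j _; apply: eq_bigr => k _.
  rewrite (linfun_linear skp_lin) !arr3E !eqxx (eq_sym k).
  by case: (j == k) => /=; ring.
under eq_bigr do under eq_bigr do rewrite -mulr_sumr sumrB sum_delta1 sumr_const card_ord.
rewrite !sumr_const card_ord -mulrnA -[RHS]mulr_natl => E; apply/eqP; rewrite -(eqr_nat F).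
by rewrite natrD natrM E !natrX ?natrM; apply/eqP; field.
Qed.

(** The trace of the antisymmetriser is a signed count, divided by six, of permutations fixing an
    index triple: the identity always, the two three-cycles when all indices agree, each
    transposition when its two indices agree. *)
Lemma dim_alt : (6 * \dim (arr_comp F m wt_m32 false) + 3 * m ^ 2 = m ^ 3 + 2 * m)%N.
Proof.
have e : limg (linfun altp) = arr_comp F m wt_m32 false.
  apply: subv_anti; apply/andP; split; apply/subvP=> x.
    by case/memv_imgP=> u _ ->; rewrite (linfun_linear altp_lin) proj0P ?skp_sk2.
  move=> h; have /mem_arr_comp[sk _] := h.
  have -> : x = linfun altp x by rewrite (linfun_linear altp_lin) /altp skp_id // (proj0_id m2).
  by rewrite memv_img ?memvf.
have := @trace3 (linfun altp); rewrite e => t.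
have {t} : (\dim (arr_comp F m wt_m32 false))%:R = \sum_(i < m) \sum_(j < m) \sum_(k < m)
    6^-1 * (1 + 2 * ((i == j)%:R * (i == k)%:R) - (j == k)%:R - (i == j)%:R - (i == k)%:R) :> F.
  rewrite t; last first.
    move=> x; rewrite !(linfun_linear altp_lin) /altp.
    have a := proj0P m2 wt_m32 (skp_sk2 x); have /mem_arr_comp[sk _] := a.
    by rewrite (skp_id sk) (proj0_id m2).
  apply: eq_bigr => i _; apply: eq_bigr => j _; apply: eq_bigr => k _.
  rewrite (linfun_linear altp_lin) /altp /= arr3E /ecyc !arr3E !eqxx.
  rewrite (eq_sym k) (eq_sym j i) (eq_sym k i).
  case: (i =P j) => ij; case: (j =P k) => jk; case: (i =P k) => ik;
    first [by exfalso; congruence | by rewrite /=; field].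
have E1 (i : I) : \sum_j \sum_k 6^-1 * (1 + 2 * ((i == j)%:R * (i == k)%:R) - (j == k)%:R - (i == j)%:R - (i == k)%:R)
    = 6^-1 * (m%:R ^+ 2 + 2 - 3 * m%:R) :> F.
  have E2 j : \sum_k 6^-1 * (1 + 2 * ((i == j)%:R * (i == k)%:R) - (j == k)%:R - (i == j)%:R - (i == k)%:R)
    = 6^-1 * (m%:R - 2 + (i == j)%:R * (2 - m%:R)) :> F.
    rewrite -mulr_sumr !(sumrB, big_split) /= -!mulr_sumr !sum_delta1 !sumr_const card_ord.
    by rewrite -[X in _ - X - _]mulr_natl; ring.
  under eq_bigr do rewrite E2.
  rewrite -mulr_sumr !big_split /= sum_delta_sym !sumr_const card_ord -[m%:R *+ m]mulr_natl -[_ *+ m]mulr_natl; ring.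
rewrite (eq_bigr _ (fun i _ => E1 i)) sumr_const card_ord -[RHS]mulr_natl => E.
apply/eqP; rewrite -(eqr_nat F) !natrD !natrM E ?natrX ?natrM; apply/eqP; by field.
Qed.

Lemma dim_pure : \dim (arr_comp F m wt_m12 false) = m.
Proof.
pose f (v : 'rV[F]_m) : arr := puret (fun k => v 0 k).
have fl : linear f by move=> a u v; apply: arrP => i j k; rewrite !arrE !mxE; ring.
have -> : arr_comp F m wt_m12 false = limg (linfun f).
  apply: subv_anti; apply/andP; split; apply/subvP=> x.
    move/(mem_pureP m2) => [t ->]; have -> : puret t = linfun f (\row_k t k).
      by rewrite linfun_linear //; apply: arrP => i j k; rewrite !arrE !mxE.
    by rewrite memv_img ?memvf.
  by case/memv_imgP=> v _ ->; rewrite linfun_linear //; apply/(mem_pureP m2); eexists.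
rewrite limg_dim_eq ?dimvf ?dim_matrix ?mul1r //; apply/eqP; rewrite -subv0.
apply/subvP=> v; rewrite memv_cap memv_ker linfun_linear // memv0 => /andP[_ /eqP f0].
apply/eqP/rowP => k; have := ctrace_puret (fun k => v 0 k) k; rewrite -/(f v) f0 mxE.
rewrite /ctrace big1 => [/esym/eqP|i _]; last by rewrite arrE.
by rewrite mulf_eq0 (negbTE (m1_neq0 F m2)) => /eqP.
Qed.

Lemma dim_add s : (\dim (arr_comp F m s false) + \dim (arr_comp F m s true) = \dim (sk2 F m))%N.
Proof. by rewrite -(dimv_disjoint_sum (comp_cap F m2 s)) comp_add. Qed.
End Irreducibility.

(** * Irreducibility of the four components *)

Section Irr.
Variables (F : numFieldType) (m : nat).
Hypothesis m2 : (2 < m)%N.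
Local Notation I := 'I_m.
Local Notation arr := {ffun 'I_m -> 'M[F]_m}.
Implicit Types (x y : arr) (s : weight) (A : 'M[F]_m) (X : {vspace arr}).

(** A Cartan element. It scales each entry by the number of indices equal to [a], the first one
    counted negatively in weight -1/2, so polynomials in these operators select entries by their
    weight. *)
Definition wgt s a x := rho s (delta_mx a a) x.

Lemma wgtE s a x i j k : wgt s a x i j k =
  ((if s is wt_m32 then 1 else -1) * (i == a)%:R + (j == a)%:R + (k == a)%:R) * x i j k.
Proof.
rewrite /wgt rho_delta; case: s;
  case: (i =P a) => [->|_]; case: (j =P a) => [->|_]; case: (k =P a) => [->|_];
  rewrite /=; ring.
Qed.

Lemma stable_wgt s X x a : stable fullv (rho s) X -> x \in X -> wgt s a x \in X.
Proof. by move=> st xX; apply: st (memvf _) xX. Qed.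

Lemma stable_delta s X x a b : stable fullv (rho s) X -> x \in X -> rho s (delta_mx a b) x \in X.
Proof. by move=> st xX; apply: st (memvf _) xX. Qed.

Lemma sum_point z p q r :
  \sum_(i < m) \sum_(j < m) \sum_(k < m) (i == p)%:R * (j == q)%:R * (k == r)%:R * z = z :> F.
Proof.
under eq_bigr do under eq_bigr do under eq_bigr do rewrite -!mulrA.
under eq_bigr do under eq_bigr do rewrite -!mulr_sumr sum_delta.
by under eq_bigr do rewrite -mulr_sumr sum_delta; rewrite sum_delta.
Qed.

Lemma sum_split3 (f g : I -> I -> I -> F) :
  \sum_i \sum_j \sum_k (f i j k + g i j k) =
  \sum_i \sum_j \sum_k f i j k + \sum_i \sum_j \sum_k g i j k.
Proof.
rewrite -big_split; apply: eq_bigr => i _ /=; rewrite -big_split; apply: eq_bigr => j _ /=.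
by rewrite -big_split.
Qed.

Lemma three_indices : exists p q r : I, [/\ (p == q) = false, (p == r) = false & (q == r) = false].
Proof.
by exists (Ordinal (ltnW (ltnW m2))), (Ordinal (ltnW m2)), (Ordinal m2).
Qed.

Lemma arr_comp_neq0 s b : arr_comp F m s b <> 0%VS.
Proof.
move=> /eqP; rewrite -dimv_eq0.
have d1 := dim_sk2 F m; have d2 := dim_alt F m2; have d3 := dim_pure F m2.
have d4 := dim_add F m2 wt_m32; have d5 := dim_add F m2 wt_m12.
by case: s; case: b; apply/negP/eqP; nia.
Qed.

Ltac cases3 i p q r :=
  case: (i =P p) => [->|?]; [|case: (i =P q) => [->|?]; [|case: (i =P r) => [->|?]]].

Lemma irr_alt : irreducible fullv (rho wt_m32) (arr_comp F m wt_m32 false) 0%VS.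
Proof.
have [p [q [r [pq pr qr]]]] := three_indices.
have altE x : x \in arr_comp F m wt_m32 false ->
   (forall i j k, x i j k = - x j i k) /\ (forall i j k, x i j k = - x i k j).
  move/mem_arr_comp => [/mem_sk2 sk h]; split=> // i j k.
  by apply/eqP; rewrite -addr_eq0; apply/eqP/h.
(* The operator multiplies an entry by the product of the multiplicities of p, q and r. Only the six
   permutations of these indices survive, and they contribute equally, whence the 6. *)
apply: (@dot_irreducible _ _ _ _ p q r (fun x => wgt wt_m32 p (wgt wt_m32 q (wgt wt_m32 r x))) 6).
- exact: stable_arr_comp.
- exact: arr_comp_neq0.
- by rewrite pnatr_eq0.
- move=> X st XN h; apply/eqP; rewrite -subv0; apply/subvP=> x xX.
  have alt y : y \in X -> _ := fun yX => altE y (subvP XN _ yX).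
  (* The three indices are freed one at a time by matrix units; where the index being freed occurs
     elsewhere in the entry, skewness leads back to a case already settled. *)
  have h1 y b : y \in X -> y b q r = 0.
    move=> yX; have := h _ (stable_delta p b st yX).
    by rewrite rho_delta eqxx (eq_sym q) (eq_sym r) pq pr !mul0r !addr0 mul1r.
  have h2 y b c : y \in X -> y b c r = 0.
    move=> yX; case: (b =P q) => [->|/eqP/negbTE bq].
      by rewrite (alt y yX).1 h1 ?oppr0.
    have := h1 _ b (stable_delta q c st yX).
    by rewrite rho_delta eqxx (eq_sym r) qr bq !mul0r !addr0 add0r mul1r.
  have h3 y b c d : y \in X -> y b c d = 0.
    move=> yX; case: (b =P r) => [->|/eqP/negbTE br].
      by rewrite (alt y yX).1 (alt y yX).2 h2 ?oppr0.
    case: (c =P r) => [->|/eqP/negbTE cr]; first by rewrite (alt y yX).2 h2 ?oppr0.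
    have := h2 _ b c (stable_delta r d st yX).
    by rewrite rho_delta eqxx br cr !mul0r !add0r mul1r.
  by rewrite memv0; apply/eqP/arrP => i j k; rewrite h3 // arr0E.
- by move=> X st x xX; do 3!apply: stable_wgt => //.
move=> x y /altE[x1 x2] /altE[y1 y2].
pose d (a b c : I) i j k : F := (i == a)%:R * (j == b)%:R * (k == c)%:R * (x p q r * y p q r).
transitivity (\sum_i \sum_j \sum_k (d p q r i j k + d p r q i j k + d q p r i j k
   + d q r p i j k + d r p q i j k + d r q p i j k)).
  apply: eq_bigr => i _; apply: eq_bigr => j _; apply: eq_bigr => k _.
  rewrite !wgtE /d; cases3 i p q r; cases3 j p q r; cases3 k p q r;
   rewrite ?eqxx ?pq ?pr ?qr ?(eq_sym q p) ?(eq_sym r p) ?(eq_sym r q) ?pq ?pr ?qr;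
   rewrite ?(x1 r q p) ?(y1 r q p) ?(x2 q r p) ?(y2 q r p) ?(x1 r p q) ?(y1 r p q)
     ?(x2 p r q) ?(y2 p r q) ?(x1 q p r) ?(y1 q p r) /=; ring.
do !rewrite sum_split3.
rewrite /d !sum_point; ring.
Qed.

Lemma irr_cyc : irreducible fullv (rho wt_m32) (arr_comp F m wt_m32 true) 0%VS.
Proof.
have [p [r [_ [pr _ _]]]] := three_indices.
have cycE x : x \in arr_comp F m wt_m32 true ->
   (forall i j k, x i j k + x j k i + x k i j = 0) /\ (forall i j k, x i j k = - x i k j).
  by move/mem_arr_comp => [/mem_sk2 sk h].
(* The factor n_r n_p (n_p - 1) keeps the entries with two p and one r, with value 2. Of the three
   positions of r, the first gives zero by skewness and the other two agree: 4 in all. *)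
apply: (@dot_irreducible _ _ _ _ p p r
  (fun x => wgt wt_m32 r (wgt wt_m32 p (wgt wt_m32 p x) - wgt wt_m32 p x)) 4).
- exact: stable_arr_comp.
- exact: arr_comp_neq0.
- by rewrite pnatr_eq0.
- move=> X st XN h; apply/eqP; rewrite -subv0; apply/subvP=> x xX.
  have cyc y : y \in X -> _ := fun yX => cycE y (subvP XN _ yX).
  have h1 y b : y \in X -> y p p b = 0.
    move=> yX; have := h _ (stable_delta r b st yX).
    by rewrite rho_delta eqxx pr !mul0r !add0r mul1r.
  (* Acting with [delta_mx p b] polarises [y p p c = 0]. A second polarisation makes the array skew
     in its first two indices, hence totally skew, and then its cyclic sum is three times itself. *)
  have h2 y b c : y \in X -> y b p c + y p b c = 0.
    move=> yX; have := h1 _ c (stable_delta p b st yX).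
    by rewrite rho_delta eqxx h1 // mulr0 addr0 !mul1r.
  have h3 y a b c : y \in X -> y a b c + y b a c = 0.
    move=> yX; case: (a =P p) => [->|/eqP/negbTE ap]; first by rewrite addrC h2.
    case: (b =P p) => [->|/eqP/negbTE bp]; first by rewrite h2.
    have := h2 _ a c (stable_delta p b st yX).
    rewrite !rho_delta !eqxx ap => H; have E := h2 _ a b yX.
    by rewrite -[RHS]H -[LHS]addr0 -(mulr0 (c == p)%:R) -E /=; ring.
  rewrite memv0; apply/eqP/arrP => i j k; rewrite arr0E.
  have e a b c : x a b c = - x b a c by apply/eqP; rewrite -addr_eq0 h3.
  have := (cyc x xX).1 i j k; have s2 := (cyc x xX).2.
  rewrite (e k i j) (s2 i k j) (s2 j k i) (e j i k) !opprK => /eqP.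
  have -> : x i j k + x i j k + x i j k = x i j k * 3%:R by ring.
  by rewrite mulf_eq0 pnatr_eq0 orbF => /eqP.
- move=> X st x xX; apply: stable_wgt => //; apply: memvB; last exact: stable_wgt.
  by do 2!apply: stable_wgt => //.
move=> x y /cycE[x1 x2] /cycE[y1 y2].
have x0 : x r p p = 0.
  by have /eqP := x2 r p p; rewrite -addr_eq0 -mulr2n mulrn_eq0 /= => /eqP.
pose d (a b c : I) i j k : F := (i == a)%:R * (j == b)%:R * (k == c)%:R * (2 * (x p p r * y p p r)).
transitivity (\sum_i \sum_j \sum_k (d p p r i j k + d p r p i j k)).
  apply: eq_bigr => i _; apply: eq_bigr => j _; apply: eq_bigr => k _.
  rewrite !(wgtE, arrE) /d; cases3 i p r r; cases3 j p r r; cases3 k p r r;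
   rewrite ?eqxx ?pr ?(eq_sym r p) ?pr ?x0 ?(x2 p r p) ?(y2 p r p) /=; ring.
do !rewrite sum_split3.
rewrite /d !sum_point; ring.
Qed.

(** Each [t k] occurs in a pure trace array at 2(m - 1) places, [i i k] and [i k i] with [i]
    different from [k]. *)
Lemma dot_puret (a b : I -> F) : dot (puret a) (puret b) = 2 * (m%:R - 1) * \sum_k a k * b k.
Proof.
rewrite /dot.
transitivity (\sum_(i < m) \sum_(j < m) \sum_(k < m)
   ((i == j)%:R * (a k * b k) + (i == k)%:R * (a j * b j)
    - (i == k)%:R * ((i == j)%:R * (a k * b j + a j * b k)))).
  apply: eq_bigr => i _; apply: eq_bigr => j _; apply: eq_bigr => k _; rewrite !arr3E.
  by case: (i == j); case: (i == k) => /=; ring.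
transitivity (\sum_(i < m) (2 * (\sum_k a k * b k) - 2 * (a i * b i))).
  apply: eq_bigr => i _.
  under eq_bigr do rewrite sumrB big_split /= -mulr_sumr !sum_delta_sym.
  rewrite sumrB big_split /= !sum_delta_sym; ring.
rewrite sumrB -!mulr_sumr sumr_const card_ord -[(\sum_k _) *+ m]mulr_natl; ring.
Qed.

Lemma irr_pure : irreducible fullv (rho wt_m12) (arr_comp F m wt_m12 false) 0%VS.
Proof.
have [p [r [_ [pr _ _]]]] := three_indices.
apply: (@dot_irreducible _ _ _ _ p p r (wgt wt_m12 r) (2 * (m%:R - 1))).
- exact: stable_arr_comp.
- exact: arr_comp_neq0.
- by rewrite mulf_neq0 ?pnatr_eq0 ?(m1_neq0 F m2).
- move=> X st XN h; apply/eqP; rewrite -subv0; apply/subvP=> x xX.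
  have [t e] : exists t, x = puret t by apply/(mem_pureP m2); exact: (subvP XN).
  rewrite memv0; apply/eqP/arrP => i j k.
  suff t0 b : t b = 0 by rewrite e !arrE !t0 !mulr0 subr0.
  have := h _ (stable_delta r b st xX); rewrite e rho_puret arr3E eqxx pr mul0r subr0 mul1r.
  under eq_bigr do rewrite mxE eqxx /=.
  by rewrite sum_delta.
- by move=> X st x xX; exact: stable_wgt.
move=> x y /(mem_pureP m2)[a ->] /(mem_pureP m2)[b ->].
rewrite /wgt rho_puret dot_puret !arr3E eqxx pr !mul0r !subr0 !mul1r.
rewrite -[RHS]mulrA; congr (_ * _); rewrite -(sum_delta (fun k => a r * b k) r).
apply: eq_bigr => k _; rewrite (eq_bigr (fun l => (k == r)%:R * ((l == r)%:R * a l))).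
  by rewrite -mulr_sumr sum_delta mulrA.
by move=> l _; rewrite mxE -mulnb natrM mulrA.
Qed.

(** The term with index [c] drops out of the contraction by skewness, which leaves [m - 1] equal
    terms. *)
Lemma const_trace0 x c a : x \in arr_comp F m wt_m12 true -> a != c ->
  (forall b, b != c -> x b b c = x a a c) -> x a a c = 0.
Proof.
move/mem_arr_comp => [/mem_sk2 sk h] ac e; have := h c c c; rewrite /= /etr /ctrace.
rewrite (eq_bigr (fun i => x a a c - (i == c)%:R * x a a c)) => [|i _]; last first.
  have [->|ic] := eqVneq i c; last by rewrite mul0r subr0 e.
  by rewrite mul1r subrr; have /eqP := sk c c c; rewrite -addr_eq0 -mulr2n mulrn_eq0 /= => /eqP.
rewrite sumrB sumr_const card_ord sum_delta -[X in X - _]mulr_natl -{2}[x a a c]mul1r -mulrBl => /eqP.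
by rewrite mulf_eq0 (negbTE (m1_neq0 F m2)) => /eqP.
Qed.

Lemma irr_traceless : irreducible fullv (rho wt_m12) (arr_comp F m wt_m12 true) 0%VS.
Proof.
have [p [q [r [pq pr qr]]]] := three_indices.
(* [H3] is w(w - 1)(w - 2) in the weight w of p, which ranges over -1, 0, 1, 2. Only w = -1
   survives, with value -6: first index p and no other p. The weights of q and r then leave two
   entries, equal up to sign, whence -12. *)
pose H3 x := wgt wt_m12 p (wgt wt_m12 p (wgt wt_m12 p x))
   - 3 *: wgt wt_m12 p (wgt wt_m12 p x) + 2 *: wgt wt_m12 p x.
apply: (@dot_irreducible _ _ _ _ p q r (fun x => wgt wt_m12 q (wgt wt_m12 r (H3 x))) (-12)).
- exact: stable_arr_comp.
- exact: arr_comp_neq0.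
- by rewrite oppr_eq0 pnatr_eq0.
- move=> X st XN h; apply/eqP; rewrite -subv0; apply/subvP=> x xX.
  have sk y i j k : y \in X -> y i j k = - y i k j.
    by move=> yX; have /mem_arr_comp[/mem_sk2] := subvP XN _ yX.
  have sk0 y i j : y \in X -> y i j j = 0.
    by move=> yX; have /eqP := sk _ i j j yX; rewrite -addr_eq0 -mulr2n mulrn_eq0 /= => /eqP.
  (* An entry known to vanish on all of [X] also vanishes after a matrix unit; every step below is
     an instance of this relation. *)
  have dl y a b i j k : y \in X -> (forall z, z \in X -> z i j k = 0) ->
     - ((i == b)%:R * y a j k) + (j == a)%:R * y i b k + (k == a)%:R * y i j b = 0.
    by move=> yX hz; have := hz _ (stable_delta a b st yX); rewrite rho_delta.
  have h1 b y : (p == b) = false -> y \in X -> y p b r = 0.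
    move=> pb yX; have := dl y q b _ _ _ yX h.
    by rewrite eqxx pb (eq_sym r) qr !mul0r oppr0 add0r addr0 mul1r.
  have h2 b c y : (p == b) = false -> (p == c) = false -> y \in X -> y p b c = 0.
    move=> pb pc yX; have [->|br] := eqVneq b r; first by rewrite sk // h1 // oppr0.
    have := dl y r c _ _ _ yX (h1 b ^~ pb).
    by rewrite eqxx pc (negbTE br) !mul0r oppr0 !add0r mul1r.
  have h3 a b c y : (p == b) = false -> (p == c) = false -> (b == a) = false ->
      (c == a) = false -> y \in X -> y a b c = 0.
    move=> pb pc ba ca yX; have := dl y a p _ _ _ yX (fun z => @h2 b c z pb pc).
    by rewrite eqxx ba ca !mul0r !addr0 mul1r => /eqP; rewrite oppr_eq0 => /eqP.
  (* Entries that enter the contraction cannot be isolated by matrix units. They are shown to be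
     equal to each other, and the vanishing trace kills them. *)
  have h5 b c y : (p == c) = false -> y \in X -> y b b c = 0.
    move=> pc yX; have e d : d != c -> y d d c = y p p c.
      have [->//|dp] := eqVneq d p => dc.
      have pd : (p == d) = false by rewrite eq_sym (negbTE dp).
      have := dl y d p _ _ _ yX (fun z => @h2 d c z pd pc).
      rewrite !eqxx (eq_sym c) (negbTE dc) mul0r addr0 !mul1r addrC => /eqP.
      by rewrite subr_eq0 => /eqP.
    have [->|bc] := eqVneq b c; first by rewrite sk0.
    rewrite e //; apply: const_trace0 => //; [exact: (subvP XN)|by rewrite pc].
  have h6 a c y : (a == p) = false -> (p == c) = false -> (c == a) = false -> y \in X -> y a p c = 0.
    move=> ap pc ca yX; have := dl y a p _ _ _ yX (fun z => @h5 a c z pc).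
    by rewrite !eqxx ap ca !mul0r oppr0 add0r addr0 mul1r.
  have h7 a y : y \in X -> (a == p) = false -> y a a p = 0.
    move=> yX ap; apply: const_trace0; [exact: (subvP XN)|by rewrite ap|].
    move=> b bp; have [->//|ab] := eqVneq b a.
    have z0 z : z \in X -> z b a p = 0.
      by move=> zX; rewrite sk // h6 ?oppr0 // ?(negbTE bp) // 1?eq_sym ?ap // (negbTE ab).
    have := dl y a b _ _ _ yX z0.
    rewrite !eqxx (eq_sym p) ap mul0r addr0 !mul1r addrC => /eqP.
    by rewrite subr_eq0 => /eqP.
  have h8 y i j : y \in X -> y i j p = 0.
    move=> yX; have [->|jp] := eqVneq j p; first by rewrite sk0.
    have pj : (p == j) = false by rewrite eq_sym (negbTE jp).
    have [->|ip] := eqVneq i p; first by rewrite sk // h5 ?oppr0.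
    have [->|ij] := eqVneq i j; first by rewrite h7 // (negbTE jp).
    by rewrite sk // h6 ?oppr0 // ?(negbTE ip) // eq_sym (negbTE ij).
  rewrite memv0; apply/eqP/arrP => i j k; rewrite arr0E.
  have [->|kp] := eqVneq k p; first exact: h8.
  have [->|jp] := eqVneq j p; first by rewrite sk // h8 ?oppr0.
  have pj : (p == j) = false by rewrite eq_sym (negbTE jp).
  have pk : (p == k) = false by rewrite eq_sym (negbTE kp).
  have [->|ij] := eqVneq i j; first exact: h5.
  have [->|ik] := eqVneq i k; first by rewrite sk // h5 ?oppr0.
  by apply: h3 => //; rewrite eq_sym; exact: negbTE.
- move=> X st x xX; do 2!apply: stable_wgt => //.
  by do ?[apply: memvB | apply: memvD | apply: memvZ | apply: stable_wgt | done].
move=> x y /mem_arr_comp[/mem_sk2 xs _] /mem_arr_comp[/mem_sk2 ys _].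
pose d (a b c : I) i j k : F := (i == a)%:R * (j == b)%:R * (k == c)%:R * (- 6 * (x p q r * y p q r)).
transitivity (\sum_i \sum_j \sum_k (d p q r i j k + d p r q i j k)).
  apply: eq_bigr => i _; apply: eq_bigr => j _; apply: eq_bigr => k _.
  rewrite !(wgtE, arrE) /d; cases3 i p q r; cases3 j p q r; cases3 k p q r;
   rewrite ?eqxx ?pq ?pr ?qr ?(eq_sym q p) ?(eq_sym r p) ?(eq_sym r q) ?pq ?pr ?qr;
   rewrite ?(xs p r q) ?(ys p r q) /=; ring.
rewrite sum_split3 /d !sum_point; ring.
Qed.

Lemma irr_arr_comp s b : irreducible fullv (rho s) (arr_comp F m s b) 0%VS.
Proof.
case: s; case: b; [exact: irr_cyc|exact: irr_alt|exact: irr_traceless|exact: irr_pure].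
Qed.
End Irr.

(** * Frames adapted to a pure spinor *)

Section Frames.
Variables (F : numFieldType) (m : nat) (D : clifford F m).
Variable xi : 'rV[F]_(2 ^ (m - 1)).
Hypothesis hxi : pure D xi.
Local Notation n := (2 * m)%N.
Local Notation N := (2 ^ (m - 1))%N.
Local Notation g := (metric D).
Local Notation vec := 'rV[F]_n.

Definition cliffP (v : vec) : 'M[F]_N := \sum_a v 0 a *: gammaP D a.
Definition cliffM (v : vec) : 'M[F]_N := \sum_a v 0 a *: gammaM D a.

Lemma cliffP_lin : linear cliffP.
Proof.
move=> a u v; rewrite /cliffP scaler_sumr -big_split; apply: eq_bigr => i _ /=.
by rewrite !mxE scalerDl scalerA.
Qed.

Lemma bil_sum (u v : vec) : (u *m g *m v^T) 0 0 = \sum_a \sum_b u 0 a * v 0 b * g a b.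
Proof.
rewrite mxE exchange_big; apply: eq_bigr => b _ /=; rewrite !mxE mulr_suml.
by apply: eq_bigr => a _; ring.
Qed.

Lemma cliffPM (u v : vec) : cliffP u *m cliffM v + cliffP v *m cliffM u = (- 2 * (u *m g *m v^T) 0 0)%:M.
Proof.
have E (p q : vec) (H K : 'I_n -> 'M[F]_N) : (\sum_a p 0 a *: H a) *m (\sum_a q 0 a *: K a)
   = \sum_a \sum_b (p 0 a * q 0 b) *: (H a *m K b).
  rewrite mulmx_suml; apply: eq_bigr => a _; rewrite mulmx_sumr; apply: eq_bigr => b _.
  by rewrite -scalemxAl -scalemxAr scalerA.
rewrite /cliffP /cliffM !E [X in _ + X]exchange_big -big_split /= bil_sum -scalemx1 mulr_sumr scaler_suml.
apply: eq_bigr => a _; rewrite mulr_sumr scaler_suml -big_split; apply: eq_bigr => b _ /=.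
have /(congr1 (fun M => 2 *: M)) := gammaPM D a b.
rewrite scalerA divff ?pnatr_eq0 // scale1r (mulrC (v 0 b)) -scalerDr => ->.
by rewrite -[(- g a b)%:M]scalemx1 !scalerA; congr (_ *: _); ring.
Qed.

Lemma cliffMP (u v : vec) : cliffM u *m cliffP v + cliffM v *m cliffP u = (- 2 * (u *m g *m v^T) 0 0)%:M.
Proof.
have E (p q : vec) (H K : 'I_n -> 'M[F]_N) : (\sum_a p 0 a *: H a) *m (\sum_a q 0 a *: K a)
   = \sum_a \sum_b (p 0 a * q 0 b) *: (H a *m K b).
  rewrite mulmx_suml; apply: eq_bigr => a _; rewrite mulmx_sumr; apply: eq_bigr => b _.
  by rewrite -scalemxAl -scalemxAr scalerA.
rewrite /cliffP /cliffM !E [X in _ + X]exchange_big -big_split /= bil_sum -scalemx1 mulr_sumr scaler_suml.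
apply: eq_bigr => a _; rewrite mulr_sumr scaler_suml -big_split; apply: eq_bigr => b _ /=.
have /(congr1 (fun M => 2 *: M)) := gammaMP D a b.
rewrite scalerA divff ?pnatr_eq0 // scale1r (mulrC (v 0 b)) -scalerDr => ->.
by rewrite -[(- g a b)%:M]scalemx1 !scalerA; congr (_ *: _); ring.
Qed.

Lemma xi1E v : v *m xi1 D xi = xi *m cliffP v.
Proof.
rewrite /cliffP mulmx_sumr; apply/rowP => A; rewrite mxE summxE; apply: eq_bigr => a _.
by rewrite mxE -scalemxAr [RHS]mxE.
Qed.

(** Both vectors kill [xi], so the Clifford relation applied to [xi] gives -2 g(u, v) [xi] = 0. *)
Lemma V12_null u v : u \in V12 D xi -> v \in V12 D xi -> u *m g *m v^T = 0.
Proof.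
rewrite !mem_V12 !xi1E => /eqP u0 /eqP v0.
have := congr1 (mulmx xi) (cliffPM u v); rewrite mulmxDr !mulmxA u0 v0 !mul0mx addr0.
rewrite mul_mx_scalar => /esym/eqP; rewrite scaler_eq0 (negbTE hxi.1) orbF.
rewrite mulf_eq0 oppr_eq0 pnatr_eq0 /= => /eqP e.
by apply/matrixP=> i j; rewrite !ord1 e mxE.
Qed.

(* Rows of [eB] and [fB] are dual bases of the complementary null spaces V12 and V'. *)
Definition frame (V' : {vspace vec}) (eB fB : 'M[F]_(m, n)) : Prop :=
  [/\ eB *m g *m eB^T = 0, fB *m g *m fB^T = 0, eB *m g *m fB^T = 1%:M,
      forall v, (v \in V12 D xi) = (v <= eB)%MS &
      forall v, (v \in V') = (v <= fB)%MS].

Lemma vspace_rows (U : {vspace vec}) k : \dim U = k ->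
  exists2 B : 'M[F]_(k, n), row_free B & forall v, (v \in U) = (v <= B)%MS.
Proof.
move=> <-; exists (\matrix_(i < \dim U) (vbasis U)`_i).
  apply: inj_row_free => w; rewrite mulmx_sum_row => e; apply/rowP => i; rewrite mxE.
  have /freeP := basis_free (vbasisP U); apply; rewrite -[RHS]e.
  by apply: eq_bigr => j _; rewrite rowK.
move=> v; apply/idP/idP => [vU|/submxP[w ->]].
  rewrite (coord_vbasis vU); apply/submxP; exists (\row_i coord (vbasis U) i v).
  by rewrite mulmx_sum_row; apply: eq_bigr => j _; rewrite rowK mxE.
rewrite mulmx_sum_row; apply: memv_suml => j _; rewrite rowK memvZ // vbasis_mem //.
by rewrite mem_nth // size_tuple.
Qed.

Lemma null_rows (U : {vspace vec}) k (B : 'M[F]_(k, n)) :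
  (forall v, (v \in U) = (v <= B)%MS) ->
  (forall u v, u \in U -> v \in U -> u *m g *m v^T = 0) -> B *m g *m B^T = 0.
Proof.
move=> BU U0; apply/row_matrixP=> i; apply/matrixP=> z j.
have bU p : row p B \in U by rewrite BU row_sub.
have /matrixP/(_ 0 0) := U0 _ _ (bU i) (bU j).
rewrite ord1 !row_mul; set r := _ *m g; rewrite !mxE => e; rewrite -[RHS]e.
by apply: eq_bigr => q _; rewrite !mxE.
Qed.

Lemma exists_frame V' : null_complement D xi V' -> exists eB fB, frame V' eB fB.
Proof.
move=> [cap add V'0].
have [eB ef eV] := vspace_rows hxi.2.
have dV' : \dim V' = m.
  have := dimv_disjoint_sum cap; rewrite add hxi.2 dimvf dim_matrix mul1r; lia.
have [B Bf BV] := vspace_rows dV'.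
have e0 := null_rows eV V12_null; have B0 := null_rows BV V'0.
pose C := eB *m g *m B^T.
(* If w C = 0, then w eB is orthogonal to V' and, by nullity, to V12, hence to everything;
   nondegeneracy gives w = 0. The inverse of [C] then normalises [B] to the dual basis. *)
have Cu : C \in unitmx.
  rewrite -row_free_unit; apply: inj_row_free => w wC.
  apply: (row_free_inj ef); rewrite mul0mx.
  apply: (can_inj (mulmxK (metric_unit D))); rewrite mul0mx.
  apply/trmx_inj; rewrite trmx0; apply/row_matrixP=> i; rewrite row0 rowE.
  have : delta_mx 0 i \in (V' + V12 D xi)%VS by rewrite add memvf.
  case/memv_addP=> u uV [v vV ->]; rewrite mulmxDl.
  move: uV vV; rewrite BV eV => /submxP[a ->] /submxP[b ->].
  rewrite !trmx_mul metric_sym -!mulmxA.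
  have -> : B *m (g *m (eB^T *m w^T)) = (w *m C)^T.
    by rewrite /C !trmx_mul trmxK metric_sym !mulmxA.
  have -> : eB *m (g *m (eB^T *m w^T)) = 0 by rewrite !mulmxA e0 mul0mx.
  by rewrite wC trmx0 !mulmx0 addr0.
exists eB, ((invmx C)^T *m B); split=> //.
- by rewrite trmx_mul !mulmxA -(mulmxA _ B) -(mulmxA _ (B *m g)) B0 mulmx0 mul0mx.
- by rewrite trmx_mul trmxK mulmxA mulmxV.
- by move=> v; rewrite BV (eqmxMfull B) // row_full_unit unitmx_tr unitmx_inv.
Qed.

(** The components must be exhibited before any complement is given, so one has to be
    constructed. *)
Lemma exists_null_complement : exists V', null_complement D xi V'.
Proof.
have [eB ef eV] := vspace_rows hxi.2; have e0 := null_rows eV V12_null.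
have egf : row_free (eB *m g) by rewrite /row_free mxrankMfree ?row_free_unit ?metric_unit.
have /row_freeP[R eR] := egf.
have [S [St SE]] : exists S, S^T = S /\ R^T *m g *m R = S.
  by eexists; split; last reflexivity; rewrite !trmx_mul trmxK metric_sym mulmxA.
(* The rows of R^T are dual to [eB] but not null; subtracting half of their Gram matrix times [eB]
   keeps the duality and makes them null. *)
pose fB := R^T - 2^-1 *: (S *m eB).
have Re : R^T *m g *m eB^T = 1%:M.
  by apply: trmx_inj; rewrite !trmx_mul !trmxK metric_sym mulmxA eR trmx1.
have fT : fB^T = R - 2^-1 *: (eB^T *m S).
  by rewrite /fB [LHS]linearB [X in _ - X]linearZ /= trmxK trmx_mul St.
have ff : fB *m g *m fB^T = 0.
  rewrite fT /fB !(mulmxBl, mulmxBr).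
  rewrite -!(scalemxAl, scalemxAr) SE.
  have -> : S *m eB *m g *m R = S by rewrite -!mulmxA (mulmxA eB) eR mulmx1.
  have -> : R^T *m g *m (eB^T *m S) = S by rewrite mulmxA Re mul1mx.
  have -> : S *m eB *m g *m (eB^T *m S) = 0.
    by rewrite mulmxA -!(mulmxA S) e0 mul0mx mulmx0.
  rewrite !scaler0 subr0 -addrA -opprD -scalerDl.
  have -> : 2^-1 + 2^-1 = 1 :> F by field.
  by rewrite scale1r subrr.
have ef1 : eB *m g *m fB^T = 1%:M.
  by rewrite fT mulmxBr eR -scalemxAr mulmxA e0 mul0mx scaler0 subr0.
pose h (w : 'rV[F]_m) := w *m fB.
have hl : linear h by move=> a u v; rewrite /h mulmxDl scalemxAl.
exists (limg (linfun h)).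
have inV v : v \in limg (linfun h) -> exists w, v = w *m fB.
  by case/memv_imgP => w _ ->; exists w; rewrite linfun_linear.
have ffv u v : u \in limg (linfun h) -> v \in limg (linfun h) -> u *m g *m v^T = 0.
  move=> /inV[a ->] /inV[b ->]; rewrite trmx_mul mulmxA -!(mulmxA a) ff.
  by rewrite mul0mx mulmx0.
have cap : (limg (linfun h) :&: V12 D xi = 0)%VS.
  apply/eqP; rewrite -subv0; apply/subvP=> v; rewrite memv_cap memv0 => /andP[/inV[a ->]].
  rewrite eV => /submxP[b e]; have := congr1 (fun v => v *m g *m fB^T) e.
  rewrite /= -!mulmxA (mulmxA fB) ff (mulmxA eB) ef1 mulmx0 mulmx1 => b0.
  by rewrite e -b0 mul0mx eqxx.
split=> //; apply/eqP; rewrite -(dimv_leqif_eq (subvf _)) dimvf dim_matrix mul1r.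
rewrite (dimv_disjoint_sum cap) hxi.2 limg_dim_eq.
  by rewrite dimvf dim_matrix mul1r; apply/eqP; rewrite mul2n addnn.
apply/eqP; rewrite -subv0; apply/subvP=> v; rewrite memv_cap memv_ker linfun_linear // memv0.
case/andP=> _ /eqP /(congr1 (fun v => v *m g *m eB^T)); rewrite /= !mul0mx.
have fe1 : fB *m g *m eB^T = 1%:M by apply: trmx_inj; rewrite !trmx_mul !trmxK metric_sym mulmxA ef1 trmx1.
by rewrite -!mulmxA (mulmxA fB) fe1 mulmx1 => ->.
Qed.

Section OneFrame.
Variables (V' : {vspace vec}) (eB fB : 'M[F]_(m, n)).
Hypothesis frm : frame V' eB fB.

Lemma ee0 : eB *m g *m eB^T = 0. Proof. by case: frm. Qed.
Lemma ff0 : fB *m g *m fB^T = 0. Proof. by case: frm. Qed.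
Lemma ef1 : eB *m g *m fB^T = 1%:M. Proof. by case: frm. Qed.
Lemma fe1 : fB *m g *m eB^T = 1%:M.
Proof. by apply: trmx_inj; rewrite !trmx_mul !trmxK metric_sym mulmxA ef1 trmx1. Qed.

(** The completeness relation: [P] and [Q] are square because m + m = n, so their one-sided inverse
    relation is two-sided. *)
Lemma frame_id : g *m fB^T *m eB + g *m eB^T *m fB = 1%:M.
Proof.
pose P := col_mx eB fB; pose Q := row_mx (g *m fB^T) (g *m eB^T).
have PQ : P *m Q = 1%:M.
  by rewrite mul_col_row !mulmxA ee0 ff0 ef1 fe1 -scalar_mx_block.
have /row_fullP[L LP] : row_full P.
  rewrite /row_full eqn_leq rank_leq_col /=.
  have /eqP -> : row_free P by apply/row_freeP; exists Q.
  by rewrite mul2n addnn.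
have -> : g *m fB^T *m eB + g *m eB^T *m fB = Q *m P by rewrite mul_row_col.
by rewrite -[Q *m P]mul1mx -LP -mulmxA (mulmxA P) PQ mul1mx.
Qed.

Lemma frame_dec (v : vec) : v = (v *m g *m fB^T) *m eB + (v *m g *m eB^T) *m fB.
Proof. by rewrite -{1}[v]mulmx1 -frame_id mulmxDr !mulmxA. Qed.

(** A maximal null space is its own orthogonal. *)
Lemma V12E (v : vec) : (v \in V12 D xi) = (v *m g *m eB^T == 0).
Proof.
case: frm => _ _ _ -> _; apply/idP/eqP => [/submxP[w ->]|e].
  by rewrite -!mulmxA (mulmxA eB) ee0 mulmx0.
by rewrite [v]frame_dec e mul0mx addr0 submxMl.
Qed.

Lemma V'E (v : vec) : (v \in V') = (v *m g *m fB^T == 0).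
Proof.
case: frm => _ _ _ _ ->; apply/idP/eqP => [/submxP[w ->]|e].
  by rewrite -!mulmxA (mulmxA fB) ff0 mulmx0.
by rewrite [v]frame_dec e mul0mx add0r submxMl.
Qed.

Lemma row_e i : row i eB \in V12 D xi.
Proof. by case: frm => _ _ _ -> _; exact: row_sub. Qed.
Lemma row_f i : row i fB \in V'.
Proof. by case: frm => _ _ _ _ ->; exact: row_sub. Qed.

Lemma e_xi1 : eB *m xi1 D xi = 0.
Proof. by apply/row_matrixP=> i; rewrite row_mul row0; apply/eqP; rewrite -mem_V12 row_e. Qed.

(* Row [i] is xi f_i. *)
Definition Psi_mx : 'M[F]_(m, N) := fB *m xi1 D xi.

Lemma xi1_Psi : xi1 D xi = g *m eB^T *m Psi_mx.
Proof. by rewrite -[LHS]mul1mx -frame_id mulmxDl -!mulmxA e_xi1 !mulmx0 add0r. Qed.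

Lemma xi1up_Psi : xi1up D xi = eB^T *m Psi_mx.
Proof. by rewrite /xi1up [in LHS]xi1_Psi !mulmxA mulVmx ?metric_unit // mul1mx. Qed.

(** A combination of the f_i killing [xi] lies in V12 as well as in V', hence is zero. *)
Lemma Psi_free : row_free Psi_mx.
Proof.
apply: inj_row_free => w; rewrite mulmxA => /eqP; rewrite -mem_V12 V12E.
by rewrite -!mulmxA (mulmxA fB) fe1 mulmx1 => /eqP.
Qed.

Lemma Psi_inj2 (A B : 'M[F]_m) : Psi_mx^T *m A *m Psi_mx = Psi_mx^T *m B *m Psi_mx -> A = B.
Proof.
move=> /(row_free_inj Psi_free) /(congr1 trmx); rewrite !trmx_mul !trmxK.
by move=> /(row_free_inj Psi_free) /trmx_inj.
Qed.

(** As the xi f_i are independent, the spinorial condition says that the form vanishes on V12 x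
    V12. *)
Lemma parE phi : (phi \in par D xi) = (phi^T == - phi) && (eB *m phi *m eB^T == 0).
Proof.
rewrite mem_par xi1up_Psi trmx_mul trmxK; congr (_ && _).
apply/eqP/eqP => [e|e]; last by rewrite -!mulmxA (mulmxA eB) (mulmxA (eB *m phi)) e mul0mx mulmx0.
by apply: Psi_inj2; rewrite -[RHS]/(_ *m _ *m _) mulmx0 mul0mx -[RHS]e !mulmxA.
Qed.
End OneFrame.
End Frames.

(** * W and its filtration read in a frame *)

Section Tensors.
Variables (F : numFieldType) (m : nat) (D : clifford F m).
Variable xi : 'rV[F]_(2 ^ (m - 1)).
Hypothesis hxi : pure D xi.
Local Notation n := (2 * m)%N.
Local Notation N := (2 ^ (m - 1))%N.
Local Notation g := (metric D).
Local Notation ginv := (invmx (metric D)).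
Local Notation vec := 'rV[F]_n.
Local Notation form2 := 'M[F]_n.
Local Notation tensor := {ffun 'I_n -> 'M[F]_n}.
Local Notation arr := {ffun 'I_m -> 'M[F]_m}.
Implicit Types (u v w y : vec) (phi : form2) (G : tensor) (x : arr) (s t : weight).

Lemma tens_linl phi : linear (tens D ^~ phi).
Proof.
move=> a u v; apply/ffunP=> b; rewrite !ffunE /lower mulmxDl -scalemxAl !mxE.
by rewrite scalerDl scalerA.
Qed.

Lemma tens_linr u : linear (tens D u).
Proof.
by move=> a p q; apply/ffunP=> b; rewrite !ffunE scalerDr !scalerA mulrC.
Qed.

Lemma wedge2_linl v : linear (wedge2 D ^~ v).
Proof.
move=> a u w; rewrite /wedge2 /lower mulmxDl -scalemxAl [(_ + _)^T]linearD /= [(_ *: _)^T]linearZ /=.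
rewrite mulmxDl mulmxDr -scalemxAl -scalemxAr scalerBr opprD addrACA; congr (_ + _).
Qed.

Lemma wedge2C u v : wedge2 D u v = - wedge2 D v u.
Proof. by rewrite /wedge2 opprB. Qed.

Lemma wedge2_linr u : linear (wedge2 D u).
Proof. by move=> a v w; rewrite wedge2C wedge2_linl opprD -scalerN -!wedge2C. Qed.

Definition ctr (y : vec) (G : tensor) : form2 := \sum_a y 0 a *: G a.

Lemma ctr_linr y : linear (ctr y).
Proof.
move=> a G H; rewrite /ctr scaler_sumr -big_split; apply: eq_bigr => b _ /=.
by rewrite !ffunE scalerDr !scalerA mulrC.
Qed.

Lemma ctr_linl G : linear (ctr ^~ G).
Proof.
move=> a u v; rewrite /ctr scaler_sumr -big_split; apply: eq_bigr => b _ /=.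
by rewrite !mxE scalerDl scalerA.
Qed.

Lemma ctr_tens y u phi : ctr y (tens D u phi) = (y *m g *m u^T) 0 0 *: phi.
Proof.
rewrite /ctr; under eq_bigr do rewrite ffunE scalerA.
rewrite -scaler_suml; congr (_ *: _).
rewrite -mulmxA mxE; apply: eq_bigr => b _; congr (_ * _).
by rewrite /lower -[g in RHS]metric_sym -trmx_mul [RHS]mxE.
Qed.

Lemma mem_Wm32 G : reflect (forall a, (G a)^T = - G a) (G \in W_m32 D).
Proof.
pose f (G : tensor) : tensor := [ffun a => G a + (G a)^T].
have fl : linear f.
  move=> a x y; apply/ffunP=> b; rewrite !ffunE [(_ + _)^T]linearD /= [(_ *: _)^T]linearZ /=.
  by rewrite scalerDr addrACA.
apply: (iffP idP) => [h a|h].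
  have : G \in lker (linfun f).
    apply: (subvP (bilin_span_sub _)) h => u phi _; rewrite mem_so => /eqP e.
    rewrite memv_ker linfun_linear //; apply/eqP/ffunP=> b.
    by rewrite !ffunE [(_ *: _)^T]linearZ /= e scalerN subrr.
  rewrite memv_ker linfun_linear // => /eqP/ffunP/(_ a); rewrite !ffunE => /eqP.
  by rewrite addrC addr_eq0 => /eqP.
have -> : G = \sum_a tens D (delta_mx 0 a *m ginv) (G a).
  apply/ffunP=> b; rewrite sum_ffunE (bigD1 b) //= big1 => [|a ab]; rewrite !ffunE /lower mulmxKV ?metric_unit // mxE !eqxx /=.
    by rewrite scale1r addr0.
  by rewrite eq_sym (negbTE ab) scale0r.
apply: memv_suml => a _; apply: mem_bilin_span; rewrite ?memvf //.
- exact: tens_linl.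
- exact: tens_linr.
- by rewrite mem_so h.
Qed.

Lemma tens_W32 u phi : phi^T = - phi -> tens D u phi \in W_m32 D.
Proof. by move=> h; apply/mem_Wm32=> a; rewrite ffunE [(_ *: _)^T]linearZ /= h scalerN. Qed.

Lemma ctr_skew G y : G \in W_m32 D -> (ctr y G)^T = - ctr y G.
Proof.
move/mem_Wm32=> h; rewrite /ctr linear_sum -sumrN; apply: eq_bigr => a _.
by rewrite linearZ /= h scalerN.
Qed.

Section OneFrame.
Variables (V' : {vspace vec}) (eB fB : 'M[F]_(m, n)).
Hypothesis frm : frame D xi V' eB fB.

Definition zB s := if s is wt_m32 then eB else fB.
Definition wB s := if s is wt_m32 then fB else eB.

(* [kap wt_m32 G] is the array G(e_i, e_j, e_k) and [kap wt_m12 G] the array G(f_i, e_j, e_k). *)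
Definition kap s G : arr := [ffun i => eB *m ctr (row i (zB s)) G *m eB^T].

(** A section of [kap s] with values in the graded piece of the splitting; it turns array components
    into concrete tensor modules. *)
Definition iot s x : tensor :=
  [ffun a => \sum_i (wB s *m g) i a *: ((fB *m g)^T *m x i *m (fB *m g))].

Lemma kap_lin s : linear (kap s).
Proof.
move=> a G H; apply/ffunP=> i; rewrite !ffunE ctr_linr mulmxDr mulmxDl.
by rewrite -scalemxAr -scalemxAl.
Qed.

Lemma iot_lin s : linear (iot s).
Proof.
move=> a G H; apply/ffunP=> i; rewrite !ffunE scaler_sumr -big_split; apply: eq_bigr => j _ /=.
by rewrite !ffunE mulmxDr mulmxDl -scalemxAr -scalemxAl scalerDr !scalerA mulrC.
Qed.

Lemma wzB s t : wB s *m g *m (zB t)^T =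
  if s is wt_m32 then (if t is wt_m32 then 1%:M else 0) else (if t is wt_m32 then 0 else 1%:M).
Proof. by case: s; case: t; rewrite /= ?(fe1 frm) ?(ef1 frm) ?(ee0 frm) ?(ff0 frm). Qed.

Lemma fgT : (fB *m g)^T = g *m fB^T.
Proof. by rewrite trmx_mul metric_sym. Qed.

Lemma efx (M : 'M[F]_m) : eB *m ((fB *m g)^T *m M *m (fB *m g)) *m eB^T = M.
Proof. by rewrite fgT !mulmxA (ef1 frm) mul1mx -!mulmxA (mulmxA fB) (fe1 frm) mulmx1. Qed.

Lemma ctr_iot s x y : ctr y (iot s x) =
  \sum_i (wB s *m g *m y^T) i 0 *: ((fB *m g)^T *m x i *m (fB *m g)).
Proof.
rewrite /ctr; under eq_bigr do rewrite ffunE scaler_sumr.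
rewrite exchange_big; apply: eq_bigr => i _; rewrite mxE scaler_suml /=.
by apply: eq_bigr => b _; rewrite scalerA !mxE mulrC.
Qed.

Lemma kap_iot s t x : kap t (iot s x) =
  if s is wt_m32 then (if t is wt_m32 then x else 0) else (if t is wt_m32 then 0 else x).
Proof.
apply/ffunP=> i; rewrite ffunE ctr_iot.
have -> : \sum_p (wB s *m g *m (row i (zB t))^T) p 0 *: ((fB *m g)^T *m x p *m (fB *m g)) =
   \sum_p (wB s *m g *m (zB t)^T) p i *: ((fB *m g)^T *m x p *m (fB *m g)).
  by apply: eq_bigr => p _; congr (_ *: _); rewrite tr_row colE mulmxA -colE mxE.
have E1 : eB *m (\sum_p (1%:M : 'M[F]_m) p i *: ((fB *m g)^T *m x p *m (fB *m g))) *m eB^T = x i.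
  rewrite (bigD1 i) //= big1 => [|p pi]; last by rewrite mxE (negbTE pi) scale0r.
  by rewrite addr0 mxE eqxx scale1r efx.
have E0 : eB *m (\sum_p (0 : 'M[F]_m) p i *: ((fB *m g)^T *m x p *m (fB *m g))) *m eB^T = 0.
  by rewrite big1 => [|p _]; rewrite ?mulmx0 ?mul0mx // mxE scale0r.
by rewrite wzB; case: s; case: t => //; rewrite ?E1 ?E0 ?ffunE.
Qed.

Lemma kap_tens s u phi i : kap s (tens D u phi) i = (zB s *m g *m u^T) i 0 *: (eB *m phi *m eB^T).
Proof.
rewrite ffunE ctr_tens -scalemxAr -scalemxAl; congr (_ *: _).
by rewrite -!row_mul mxE.
Qed.

Lemma tensor_dec G : G = \sum_i (tens D (row i fB) (ctr (row i eB) G) + tens D (row i eB) (ctr (row i fB) G)).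
Proof.
apply/ffunP=> a; rewrite sum_ffunE.
transitivity (\sum_b (g *m fB^T *m eB + g *m eB^T *m fB) a b *: G b).
  rewrite (frame_id frm) (bigD1 a) //= big1 => [|p pi]; rewrite mxE ?eqxx ?scale1r ?addr0 //.
  by rewrite eq_sym (negbTE pi) scale0r.
under [RHS]eq_bigr do rewrite !ffunE /ctr !scaler_sumr -big_split.
rewrite exchange_big; apply: eq_bigr => b _ /=.
under [RHS]eq_bigr do rewrite !scalerA -scalerDl.
rewrite -scaler_suml; congr (_ *: _); rewrite mxE !(mxE _ _ a b) -big_split.
apply: eq_bigr => i _ /=; rewrite /lower -!row_mul.
by rewrite -[g in LHS]metric_sym -!trmx_mul ![(_^T) _ _]mxE ![row _ _ _ _]mxE.
Qed.

Lemma kap_sk2 s G : G \in W_m32 D -> kap s G \in sk2 F m.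
Proof.
move=> h; apply/mem_sk2=> i j k; rewrite ffunE.
set M := eB *m _ *m _; have e : M^T = - M.
  by rewrite /M !trmx_mul trmxK ctr_skew // mulNmx mulmxN mulmxA.
by have /matrixP/(_ k j) := e; rewrite !mxE.
Qed.

Lemma sk2T x i : x \in sk2 F m -> (x i)^T = - x i.
Proof. by move/mem_sk2=> h; apply/matrixP=> j k; rewrite !mxE h. Qed.

Lemma iot_W32 s x : x \in sk2 F m -> iot s x \in W_m32 D.
Proof.
move=> h; apply/mem_Wm32=> a; rewrite ffunE linear_sum -sumrN; apply: eq_bigr => i _.
by rewrite linearZ /= !trmx_mul !trmxK -/(fB *m g) (sk2T _ h) mulNmx mulmxN scalerN !mulmxA.
Qed.

(** Expanding the first index in the frame reduces membership in V tensor p to the vanishing of each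
    coefficient form on V12 x V12, which is what the two arrays record. *)
Lemma mem_Wp12 G : reflect [/\ G \in W_m32 D, kap wt_m32 G = 0 & kap wt_m12 G = 0]
  (G \in W_p12 D xi).
Proof.
apply: (iffP idP) => [h|[h k3 k1]].
  pose T := (W_m32 D :&: lker (linfun (kap wt_m32)) :&: lker (linfun (kap wt_m12)))%VS.
  have : G \in T.
    apply: (subvP (bilin_span_sub _)) h => u phi _; rewrite (parE frm) => /andP[/eqP p1 /eqP p2].
    rewrite !memv_cap !memv_ker !linfun_linear; try exact: kap_lin.
    rewrite tens_W32 //=; apply/andP; split; apply/eqP/ffunP=> i;
    by rewrite kap_tens p2 scaler0 ffunE.
  rewrite !memv_cap !memv_ker !linfun_linear; try exact: kap_lin.
  by case/andP=> /andP[-> /eqP-> /eqP->].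
rewrite [G]tensor_dec; apply: memv_suml => i _.
by apply: memvD; apply: mem_bilin_span; rewrite ?memvf //;
  try (exact: tens_linl); try (exact: tens_linr); rewrite (parE frm) ctr_skew // eqxx /=;
  [move/ffunP/(_ i): k3|move/ffunP/(_ i): k1]; rewrite !ffunE => ->.
Qed.

Lemma mem_Wm12 G : reflect (G \in W_m32 D /\ kap wt_m32 G = 0) (G \in W_m12 D xi).
Proof.
apply: (iffP idP) => [h|[h k3]].
  pose T := (W_m32 D :&: lker (linfun (kap wt_m32)))%VS.
  have : G \in T.
    apply: (subvP _) h; rewrite subv_add; apply/andP; split.
      apply: bilin_span_sub => u phi; rewrite (V12E frm) mem_so => /eqP u0 /eqP p1.
      rewrite !memv_cap !memv_ker !linfun_linear; try exact: kap_lin.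
      rewrite tens_W32 //=; apply/eqP/ffunP=> i; rewrite kap_tens.
      have -> : eB *m g *m u^T = 0.
        by apply: trmx_inj; rewrite !trmx_mul trmxK metric_sym mulmxA u0 trmx0.
      by rewrite mxE scale0r ffunE.
    apply/subvP=> H /mem_Wp12[H1 H2 _].
    rewrite !memv_cap H1 !memv_ker !linfun_linear ?H2 ?eqxx //; exact: kap_lin.
  rewrite !memv_cap !memv_ker !linfun_linear; try exact: kap_lin.
  by case/andP=> -> /eqP->.
rewrite [G]tensor_dec; apply: memv_suml => i _; rewrite addrC; apply: memv_add.
all: apply: mem_bilin_span; rewrite ?memvf //;
  try (exact: tens_linl); try (exact: tens_linr).
- exact: row_e frm _.
- by rewrite mem_so ctr_skew.
by rewrite (parE frm) ctr_skew // eqxx /=; move/ffunP/(_ i): k3; rewrite !ffunE => ->.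
Qed.

Definition Kap s : 'Hom(tensor, arr) := linfun (kap s).
Definition Iot s : 'Hom(arr, tensor) := linfun (iot s).

Lemma KapE s G : Kap s G = kap s G. Proof. exact/linfun_linear/kap_lin. Qed.
Lemma IotE s x : Iot s x = iot s x. Proof. exact/linfun_linear/iot_lin. Qed.

Lemma WfilS s : (Wfil D xi s <= W_m32 D)%VS.
Proof. by case: s => //=; apply/subvP=> G /mem_Wm12[]. Qed.

(** Together with [Kap_Wfil] this identifies each graded piece of W with the arrays skew in their
    last two indices. *)
Lemma WnextE s : Wnext D xi s = (Wfil D xi s :&: lker (Kap s))%VS.
Proof.
apply/vspaceP=> G; rewrite memv_cap memv_ker KapE; case: s => /=.
  by apply/mem_Wm12/andP => -[-> /eqP->].
by apply/mem_Wp12/andP => [[h1 h2 ->]|[/mem_Wm12[h1 h2] /eqP h3]]; split=> //; exact/mem_Wm12.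
Qed.

Lemma iot_Wfil s x : x \in sk2 F m -> iot s x \in Wfil D xi s.
Proof.
by case: s => h /=; [|apply/mem_Wm12; split]; rewrite ?iot_W32 // kap_iot.
Qed.

Lemma Kap_Wfil s : (Kap s @: Wfil D xi s)%VS = sk2 F m.
Proof.
apply: subv_anti; apply/andP; split; apply/subvP=> x.
  by case/memv_imgP=> G h ->; rewrite KapE kap_sk2 // (subvP (WfilS s)).
move=> h; have <- : Kap s (iot s x) = x by rewrite KapE kap_iot; case: (s).
by rewrite memv_img ?iot_Wfil.
Qed.
End OneFrame.
End Tensors.

(** * The action of p in a frame and tensor models of the components *)

Section Actions.
Variables (F : numFieldType) (m : nat) (D : clifford F m).
Variable xi : 'rV[F]_(2 ^ (m - 1)).
Hypothesis hxi : pure D xi.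
Local Notation n := (2 * m)%N.
Local Notation N := (2 ^ (m - 1))%N.
Local Notation g := (metric D).
Local Notation ginv := (invmx (metric D)).
Local Notation vec := 'rV[F]_n.
Local Notation form2 := 'M[F]_n.
Local Notation tensor := {ffun 'I_n -> 'M[F]_n}.
Local Notation arr := {ffun 'I_m -> 'M[F]_m}.
Implicit Types (u v w y : vec) (phi : form2) (G : tensor) (x : arr) (s t : weight).

Lemma rho_mx s (A : 'M[F]_m) x i :
  rho s A x i = \sum_l slot s A i l *: x l + A *m x i + x i *m A^T.
Proof.
apply/matrixP=> j k; rewrite arr3E !big_split !mxE summxE; congr (_ + _ + _).
- by apply: eq_bigr => l _; rewrite mxE.
- by apply: eq_bigr => l _; rewrite mxE mulrC.
Qed.

(* The effect on arrays of an element of g_1: it maps weight -3/2 to weight -1/2 through the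
   first index only. *)
Definition act1 (B : 'M[F]_m) x : arr := [ffun i => \sum_l B i l *: x l].

Lemma act_mx phi G a : act_tensor D phi G a =
  \sum_d (phi *m ginv) a d *: G d + phi *m ginv *m G a + G a *m (phi *m ginv)^T.
Proof.
apply/matrixP=> b c; rewrite ffunE mxE !big_split !mxE summxE; congr (_ + _ + _).
- by apply: eq_bigr => l _; rewrite [RHS]mxE.
- by apply: eq_bigr => l _; rewrite [_^T _ _]mxE mulrC.
Qed.

Lemma ctr_act y phi G : ctr y (act_tensor D phi G) =
  ctr (y *m (phi *m ginv)) G + phi *m ginv *m ctr y G + ctr y G *m (phi *m ginv)^T.
Proof.
rewrite /ctr; under eq_bigr do rewrite act_mx !scalerDr.
rewrite !big_split /= mulmx_sumr mulmx_suml; congr (_ + _ + _).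
- under eq_bigr do rewrite scaler_sumr.
  rewrite exchange_big; apply: eq_bigr => d _ /=; rewrite mxE scaler_suml.
  by apply: eq_bigr => a _; rewrite scalerA.
- by apply: eq_bigr => a _; rewrite scalemxAr.
- by apply: eq_bigr => a _; rewrite scalemxAl.
Qed.

Lemma act_tensorE phi G a b c : act_tensor D phi G a b c = \sum_d
  ((phi *m ginv) a d * G d b c + (phi *m ginv) b d * G a d c + (phi *m ginv) c d * G a b d).
Proof. by rewrite ffunE mxE. Qed.

Lemma act_tensor_linr phi : linear (act_tensor D phi).
Proof.
move=> k G H; apply/ffunP=> a; apply/matrixP=> b c.
rewrite arrDE arrZE !act_tensorE mulr_sumr -big_split.
apply: eq_bigr => d _ /=; rewrite !arrE; ring.
Qed.

Lemma act_tensor_linl G : linear (act_tensor D ^~ G).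
Proof.
move=> k p q; apply/ffunP=> a; apply/matrixP=> b c.
rewrite arrDE arrZE !act_tensorE.
rewrite mulr_sumr -big_split; apply: eq_bigr => d _ /=.
rewrite !mulmxDl -!scalemxAl; move: (p *m ginv) (q *m ginv) => {}p {}q; rewrite !mxE; ring.
Qed.

Lemma mxquad_sum p (P Q : 'M[F]_(p, n)) (M : 'M[F]_p) :
  P^T *m M *m Q = \sum_i \sum_j M i j *: ((row i P)^T *m row j Q).
Proof.
apply/matrixP=> a b; rewrite mxE exchange_big summxE; apply: eq_bigr => j _ /=.
rewrite summxE mxE mulr_suml; apply: eq_bigr => i _.
by rewrite !mxE big_ord1 !mxE; ring.
Qed.

Lemma ctr_rows p q (M : 'M[F]_(p, q)) (B : 'M[F]_(q, n)) G i :
  ctr (row i (M *m B)) G = \sum_l M i l *: ctr (row l B) G.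
Proof.
rewrite /ctr; under [RHS]eq_bigr do rewrite scaler_sumr.
rewrite exchange_big; apply: eq_bigr => a _ /=; rewrite !mxE scaler_suml.
by apply: eq_bigr => l _; rewrite scalerA mxE.
Qed.

Lemma ginv_sym : ginv^T = ginv.
Proof. by rewrite trmx_inv metric_sym. Qed.

Lemma gT u p (P : 'M[F]_(p, n)) : P *m g *m u^T = (u *m g *m P^T)^T.
Proof. by rewrite !trmx_mul trmxK metric_sym mulmxA. Qed.

Lemma wedge2_quad p q (P : 'M[F]_(p, n)) (Q : 'M[F]_(q, n)) u v :
  P *m wedge2 D u v *m Q^T = (u *m g *m P^T)^T *m (v *m g *m Q^T) - (v *m g *m P^T)^T *m (u *m g *m Q^T).
Proof.
by rewrite /wedge2 /lower !trmx_mul !trmxK metric_sym mulmxBr mulmxBl !mulmxA.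
Qed.

Lemma wedge2T u v : (wedge2 D u v)^T = - wedge2 D u v.
Proof. by rewrite /wedge2 linearB /= !trmx_mul !trmxK opprB. Qed.

Lemma mem_wedge2v (U W : {vspace vec}) u v : u \in U -> v \in W -> wedge2 D u v \in wedge2v D U W.
Proof. by apply: mem_bilin_span; [exact: wedge2_linl|exact: wedge2_linr]. Qed.

Lemma mem_tensv (U : {vspace vec}) (H : {vspace form2}) u phi : u \in U -> phi \in H -> tens D u phi \in tensv D U H.
Proof. by apply: mem_bilin_span; [exact: tens_linl|exact: tens_linr]. Qed.

Lemma wedge2_sum p (P : 'M[F]_(p, n)) (S : 'M[F]_p) : S^T = - S ->
  (P *m g)^T *m S *m (P *m g) = 2^-1 *: \sum_i \sum_j S i j *: wedge2 D (row i P) (row j P).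
Proof.
move=> ST; set T := _ *m _ *m _.
have T2 : T = 2^-1 *: (T - T^T).
  have -> : T^T = - T by rewrite /T; move: (P *m g) => Q; rewrite !trmx_mul !trmxK ST mulNmx mulmxN !mulmxA.
  by rewrite opprK -mulr2n -scaler_nat scalerA mulVf ?pnatr_eq0 // scale1r.
rewrite {1}T2 {T2}; congr (_ *: _); rewrite /T mxquad_sum linear_sum -sumrB.
apply: eq_bigr => i _; rewrite linear_sum -sumrB; apply: eq_bigr => j _.
by rewrite linearZ /= -scalerBr /wedge2 /lower -!row_mul trmx_mul trmxK.
Qed.

Lemma skew_wedge2v (U : {vspace vec}) p (P : 'M[F]_(p, n)) (S : 'M[F]_p) :
  (forall i, row i P \in U) -> S^T = - S -> (P *m g)^T *m S *m (P *m g) \in wedge2v D U U.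
Proof.
move=> PU ST; rewrite wedge2_sum // memvZ //.
by do 2!(apply: memv_suml => ? _); rewrite memvZ // mem_wedge2v.
Qed.

Section OneFrame.
Variables (V' : {vspace vec}) (eB fB : 'M[F]_(m, n)).
Hypothesis frm : frame D xi V' eB fB.
Local Notation kap := (kap eB fB).
Local Notation iot := (iot D eB fB).

(** The blocks of a form in the frame: for a form in p the block on V12 x V12 vanishes, [Aof] is its
    gl(m) part and [Bof] its g_1 part. *)
Definition Aof phi : 'M[F]_m := eB *m phi *m fB^T.
Definition Bof phi : 'M[F]_m := fB *m phi *m fB^T.

Lemma e_phi phi : eB *m phi *m eB^T = 0 -> eB *m (phi *m ginv) = Aof phi *m eB.
Proof.
move=> p0; rewrite mulmxA -[LHS]mulmx1 -(frame_id frm) mulmxDr !mulmxA.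
by rewrite -!(mulmxA _ ginv) !mulVmx ?metric_unit // !mulmx1 p0 mul0mx addr0.
Qed.

Lemma f_phi phi : phi^T = - phi ->
  fB *m (phi *m ginv) = Bof phi *m eB - (Aof phi)^T *m fB.
Proof.
move=> ps; rewrite mulmxA -[LHS]mulmx1 -(frame_id frm) mulmxDr !mulmxA.
rewrite -!(mulmxA _ ginv) !mulVmx ?metric_unit // !mulmx1 /Bof; congr (_ + _).
by rewrite /Aof !trmx_mul trmxK ps mulNmx mulmxN mulNmx opprK mulmxA.
Qed.

(** A form in p sends e-rows to e-rows by [Aof], and f-rows to f-rows by minus its transpose, which
    is the contragredient slot; [Bof] sends f-rows to e-rows and is the only mixing of weights. *)
Lemma kap_act s phi G : phi \in par D xi ->
  kap s (act_tensor D phi G) =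
  rho s (Aof phi) (kap s G) + (if s is wt_m32 then 0 else act1 (Bof phi) (kap wt_m32 G)).
Proof.
rewrite (parE frm) => /andP[/eqP ps /eqP p0]; apply/ffunP=> i.
rewrite [RHS]ffunE rho_mx ffunE ctr_act !mulmxDr !mulmxDl.
have E2 : eB *m (phi *m ginv *m ctr (row i (zB eB fB s)) G) *m eB^T = Aof phi *m kap s G i.
  by rewrite ffunE !mulmxA -[eB *m phi *m ginv]mulmxA (e_phi p0).
have E3 : eB *m (ctr (row i (zB eB fB s)) G *m (phi *m ginv)^T) *m eB^T = kap s G i *m (Aof phi)^T.
  by rewrite ffunE -!mulmxA -trmx_mul (e_phi p0) trmx_mul.
rewrite E2 E3; set X := Aof phi *m _; set Y := _ *m (Aof phi)^T.
suff -> : eB *m ctr (row i (zB eB fB s) *m (phi *m ginv)) G *m eB^T =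
    \sum_l slot s (Aof phi) i l *: kap s G l +
    (if s is wt_m32 then 0 else act1 (Bof phi) (kap wt_m32 G)) i.
  by rewrite -!addrA; congr (_ + _); rewrite addrC -addrA.
rewrite -row_mul; case: s {E2 E3 X Y} => /=.
  rewrite (e_phi p0) ctr_rows mulmx_sumr mulmx_suml ffunE addr0.
  by apply: eq_bigr => l _; rewrite ffunE -scalemxAr -scalemxAl.
rewrite (f_phi ps) linearB /= -[X in _ + X]scaleN1r addrC ctr_linl scaleN1r !ctr_rows.
rewrite mulmxDr mulmxDl mulmxN mulNmx !mulmx_sumr !mulmx_suml ffunE -sumrN.
congr (_ + _); apply: eq_bigr => l _; rewrite ffunE -scalemxAr -scalemxAl //.
by rewrite [(- _^T) _ _]mxE scaleNr.
Qed.

Lemma so_W32 phi G : phi^T = - phi -> G \in W_m32 D -> act_tensor D phi G \in W_m32 D.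
Proof.
move=> ps /mem_Wm32 h; apply/mem_Wm32=> a; rewrite act_mx.
set X := \sum_d _; move: (phi *m ginv) @X => p X.
have XT : X^T = - X.
  by rewrite /X linear_sum -sumrN; apply: eq_bigr => d _; rewrite linearZ /= h scalerN.
have tD (M1 M2 : form2) : (M1 + M2)^T = M1^T + M2^T by rewrite linearD.
by rewrite !tD XT !trmx_mul trmxK h !opprD mulNmx mulmxN addrAC.
Qed.

Lemma rho0 s A : rho s A (0 : arr) = 0.
Proof. by apply/arrP=> i j k; rewrite arr3E big1 ?arrE // => l _; rewrite !arrE !mulr0 !addr0. Qed.

Lemma act10 B : act1 B 0 = 0.
Proof. by apply/ffunP=> i; rewrite ffunE big1 ?ffunE // => l _; rewrite ffunE scaler0. Qed.

Lemma stable_W s : stable (par D xi) (act_tensor D) (Wfil D xi s).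
Proof.
move=> phi G pp; have := pp; rewrite (parE frm) => /andP[/eqP ps _].
case: s => /=; first exact: so_W32.
move/(mem_Wm12 frm) => [h1 h2]; apply/(mem_Wm12 frm).
by rewrite so_W32 // kap_act // h2 rho0 addr0.
Qed.

Lemma stable_Wp12 : stable (par D xi) (act_tensor D) (W_p12 D xi).
Proof.
move=> phi G pp; have := pp; rewrite (parE frm) => /andP[/eqP ps _].
move/(mem_Wp12 frm) => [h1 h2 h3]; apply/(mem_Wp12 frm).
by rewrite so_W32 // !kap_act // h2 h3 !rho0 act10 !addr0.
Qed.

Lemma kap_act_Wfil s phi G : phi \in par D xi -> G \in Wfil D xi s ->
  kap s (act_tensor D phi G) = rho s (Aof phi) (kap s G).
Proof.
move=> pp; case: s => [_|/(mem_Wm12 frm)[h1 h2]]; rewrite kap_act ?addr0 //.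
by rewrite h2 act10 addr0.
Qed.

Lemma g0E phi : phi \in g_0 D xi V' ->
  [/\ phi^T = - phi, eB *m phi *m eB^T = 0 & Bof phi = 0].
Proof.
pose T := (so F m :&: lker (linfun (fun phi : form2 => eB *m phi *m eB^T)) :&:
  lker (linfun (fun phi : form2 => fB *m phi *m fB^T)))%VS.
have lE p q (P : 'M[F]_(p, n)) (Q : 'M[F]_(n, q)) : linear (fun phi : form2 => P *m phi *m Q).
  by move=> a u v; rewrite mulmxDr mulmxDl -scalemxAr -scalemxAl.
move=> h; have : phi \in T.
  apply: (subvP (bilin_span_sub _)) h => u v uV vV.
  rewrite !memv_cap mem_so wedge2T eqxx !memv_ker (linfun_linear (lE _ _ eB eB^T)) (linfun_linear (lE _ _ fB fB^T)) /= !wedge2_quad.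
  move: uV vV; rewrite (V'E frm) (V12E frm) => /eqP-> /eqP->.
  by rewrite trmx0 !mul0mx !mulmx0 subrr eqxx.
rewrite !memv_cap mem_so !memv_ker (linfun_linear (lE _ _ eB eB^T)) (linfun_linear (lE _ _ fB fB^T)) /=.
by case/andP=> /andP[/eqP p1 /eqP p2] /eqP p3; split.
Qed.

Lemma g0_par : (g_0 D xi V' <= par D xi)%VS.
Proof. by apply/subvP=> phi /g0E[p1 p2 _]; rewrite (parE frm) p1 p2 !eqxx. Qed.

Lemma g0_exists (A : 'M[F]_m) : exists2 phi, phi \in g_0 D xi V' & Aof phi = A.
Proof.
exists (\sum_i \sum_j A i j *: wedge2 D (row i fB) (row j eB)).
  apply: memv_suml => i _; apply: memv_suml => j _.
  by rewrite memvZ // mem_wedge2v ?(row_e frm) ?(row_f frm).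
have -> : \sum_i \sum_j A i j *: wedge2 D (row i fB) (row j eB) =
    (fB *m g)^T *m A *m (eB *m g) - ((fB *m g)^T *m A *m (eB *m g))^T.
  rewrite mxquad_sum linear_sum -sumrB; apply: eq_bigr => i _.
  rewrite linear_sum -sumrB; apply: eq_bigr => j _.
  by rewrite linearZ /= -scalerBr /wedge2 /lower -!row_mul trmx_mul trmxK.
rewrite /Aof mulmxBr mulmxBl !trmx_mul !trmxK metric_sym !mulmxA.
rewrite (ef1 frm) (ee0 frm) !mul0mx subr0 mul1mx.
by rewrite -!mulmxA (mulmxA eB) (ef1 frm) mulmx1.
Qed.

Lemma g1E phi : phi \in g_1 D xi ->
  [/\ phi^T = - phi, eB *m phi *m eB^T = 0 & Aof phi = 0].
Proof.
pose T := (so F m :&: lker (linfun (fun phi : form2 => eB *m phi *m eB^T)) :&: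
  lker (linfun (fun phi : form2 => eB *m phi *m fB^T)))%VS.
have lE p q (P : 'M[F]_(p, n)) (Q : 'M[F]_(n, q)) : linear (fun phi : form2 => P *m phi *m Q).
  by move=> a u v; rewrite mulmxDr mulmxDl -scalemxAr -scalemxAl.
move=> h; have : phi \in T.
  apply: (subvP (bilin_span_sub _)) h => u v uV vV.
  rewrite !memv_cap mem_so wedge2T eqxx !memv_ker (linfun_linear (lE _ _ eB eB^T)) (linfun_linear (lE _ _ eB fB^T)) /= !wedge2_quad.
  move: uV vV; rewrite !(V12E frm) => /eqP-> /eqP->.
  by rewrite trmx0 !mul0mx subrr eqxx.
rewrite !memv_cap mem_so !memv_ker (linfun_linear (lE _ _ eB eB^T)) (linfun_linear (lE _ _ eB fB^T)) /=.
by case/andP=> /andP[/eqP p1 /eqP p2] /eqP p3; split.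
Qed.

Lemma g1_par : (g_1 D xi <= par D xi)%VS.
Proof. by apply/subvP=> phi /g1E[p1 p2 _]; rewrite (parE frm) p1 p2 !eqxx. Qed.

Lemma g1_exists (B : 'M[F]_m) : B^T = - B -> exists2 phi, phi \in g_1 D xi & Bof phi = B.
Proof.
move=> BT; exists ((eB *m g)^T *m B *m (eB *m g)).
  by apply: skew_wedge2v => // i; exact: row_e frm i.
rewrite /Bof trmx_mul metric_sym !mulmxA (fe1 frm) mul1mx.
by rewrite -!mulmxA (mulmxA eB) (ef1 frm) mulmx1.
Qed.

(** Equivariance is limited to g_0, for g_1 does not preserve the splitting: a vanishing [Bof] is
    used. *)
Lemma iot_act s phi x : phi \in g_0 D xi V' ->
  act_tensor D phi (iot s x) = iot s (rho s (Aof phi) x).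
Proof.
move=> /g0E[ps p0 b0].
have gi (P : 'M[F]_(m, n)) : P *m g *m (phi *m ginv)^T = - (P *m (phi *m ginv) *m g).
  rewrite trmx_mul ginv_sym ps !mulmxN -!mulmxA (mulmxA g ginv) mulmxV ?metric_unit //.
  by rewrite mul1mx mulVmx ?metric_unit // mulmx1.
have fgp : fB *m g *m (phi *m ginv)^T = (Aof phi)^T *m (fB *m g).
  by rewrite gi (f_phi ps) b0 mul0mx sub0r mulNmx opprK mulmxA.
have egp : eB *m g *m (phi *m ginv)^T = - (Aof phi *m (eB *m g)).
  by rewrite gi (e_phi p0) mulmxA.
have pfg : phi *m ginv *m (fB *m g)^T = (fB *m g)^T *m Aof phi.
  move: (fB *m g) (phi *m ginv) (Aof phi) fgp => Q p A fgp.
  by apply: trmx_inj; rewrite 2!trmx_mul !trmxK fgp.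
have wgp i a : \sum_d (phi *m ginv) a d * (wB eB fB s *m g) i d = \sum_l slot s (Aof phi) l i * (wB eB fB s *m g) l a.
  transitivity ((wB eB fB s *m g *m (phi *m ginv)^T) i a).
    by rewrite mxE; apply: eq_bigr => d _; rewrite mulrC [_^T _ _]mxE.
  case: s => /=.
    by rewrite fgp mxE; apply: eq_bigr => l _; rewrite [_^T _ _]mxE.
  by rewrite egp mxE mxE -sumrN; apply: eq_bigr => l _; rewrite [X in _ = X * _]mxE [X in _ = - X * _]mxE mulNr.
apply/ffunP=> a; rewrite act_mx !ffunE mulmx_sumr mulmx_suml.
under [RHS]eq_bigr do rewrite rho_mx !mulmxDr !mulmxDl !scalerDr.
rewrite !big_split; congr (_ + _ + _).
- under [LHS]eq_bigr do rewrite ffunE scaler_sumr.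
  under [RHS]eq_bigr do rewrite mulmx_sumr mulmx_suml scaler_sumr.
  rewrite exchange_big [RHS]exchange_big; apply: eq_bigr => i _ /=.
  under eq_bigr do rewrite scalerA.
  rewrite -scaler_suml wgp scaler_suml; apply: eq_bigr => l _.
  by rewrite -scalemxAr -scalemxAl scalerA mulrC.
- apply: eq_bigr => i _; rewrite -scalemxAr !mulmxA; congr (_ *: _).
  by rewrite pfg /Aof !mulmxA.
- apply: eq_bigr => i _; rewrite -scalemxAl; congr (_ *: _).
  by rewrite -[LHS]mulmxA fgp !mulmxA.
Qed.

Lemma frame_quad phi : phi^T = - phi -> fB *m phi = 0 ->
  phi = (fB *m g)^T *m (eB *m phi *m eB^T) *m (fB *m g).
Proof.
move=> ps f0; have fT : phi *m fB^T = 0.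
  by apply: trmx_inj; rewrite trmx_mul trmxK ps mulmxN f0 oppr0 trmx0.
have id2 : eB^T *m (fB *m g) + fB^T *m (eB *m g) = 1%:M.
  apply: trmx_inj; rewrite linearD /= !trmx_mul !trmxK metric_sym trmx1.
  by rewrite (frame_id frm).
rewrite -[LHS]mulmx1 -id2 mulmxDr mulmxA [X in _ + X]mulmxA fT mul0mx addr0.
rewrite (fgT D) -[in LHS](mul1mx phi) -(frame_id frm) mulmxDl.
by rewrite -[g *m eB^T *m fB *m phi]mulmxA f0 mulmx0 addr0 !mulmxA.
Qed.

Definition Ugr s : {vspace vec} := if s is wt_m32 then V' else V12 D xi.

Lemma Ugr_dec s u : u \in Ugr s -> u = u *m g *m (zB eB fB s)^T *m wB eB fB s.
Proof.
case: s => /=; rewrite ?(V'E frm) ?(V12E frm) => /eqP u0.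
  by rewrite {1}[u](frame_dec frm) u0 mul0mx add0r.
by rewrite {1}[u](frame_dec frm) u0 mul0mx addr0.
Qed.

Lemma row_w s i : row i (wB eB fB s) \in Ugr s.
Proof. by case: s => /=; rewrite ?(row_e frm) ?(row_f frm). Qed.

Lemma wedge2v_quad phi : phi \in wedge2v D V' V' ->
  phi^T = - phi /\ phi = (fB *m g)^T *m (eB *m phi *m eB^T) *m (fB *m g).
Proof.
pose T := (so F m :&: lker (linfun (fun phi : form2 => fB *m phi)))%VS.
have lT : linear (fun phi : form2 => fB *m phi) by move=> a u v; rewrite mulmxDr -scalemxAr.
move=> h; have : phi \in T.
  apply: (subvP (bilin_span_sub _)) h => u v uV vV.
  rewrite memv_cap mem_so wedge2T eqxx memv_ker (linfun_linear lT) /=.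
  rewrite -[wedge2 _ _ _]mulmx1 -trmx1 mulmxA wedge2_quad.
  by move: uV vV; rewrite !(V'E frm) => /eqP-> /eqP->; rewrite trmx0 !mul0mx subrr.
rewrite memv_cap mem_so memv_ker (linfun_linear lT) => /andP[/eqP p1 /eqP p2].
by split=> //; exact: frame_quad.
Qed.

Lemma iot_tens s x : iot s x =
  \sum_i tens D (row i (wB eB fB s)) ((fB *m g)^T *m x i *m (fB *m g)).
Proof.
apply/ffunP=> a; rewrite sum_ffunE ffunE; apply: eq_bigr => i _.
by rewrite ffunE /lower -row_mul [row _ _ _ _]mxE.
Qed.

Lemma tensv_iot s : tensv D (Ugr s) (wedge2v D V' V') = (Iot D eB fB s @: sk2 F m)%VS.
Proof.
apply: subv_anti; apply/andP; split.
  apply: bilin_span_sub => u phi uU /wedge2v_quad[ps pq].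
  set c := u *m g *m (zB eB fB s)^T.
  have -> : tens D u phi = Iot D eB fB s [ffun i => c 0 i *: (eB *m phi *m eB^T)].
    rewrite IotE; apply/ffunP=> a; rewrite !ffunE /lower.
    rewrite {1}(Ugr_dec uU) -/c -[c *m _ *m g]mulmxA mxE scaler_suml; apply: eq_bigr => i _.
    by rewrite ffunE -scalemxAr -scalemxAl -pq scalerA mulrC.
  rewrite memv_img //; apply/mem_sk2=> i j k; rewrite !ffunE.
  have e : (eB *m phi *m eB^T)^T = - (eB *m phi *m eB^T).
    by rewrite !trmx_mul trmxK ps mulNmx mulmxN mulmxA.
  by have /matrixP/(_ k j) := e; rewrite !mxE => ->; rewrite mulrN.
apply/subvP=> _ /memv_imgP[x xs ->]; rewrite IotE iot_tens; apply: memv_suml => i _.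
apply: mem_tensv; first exact: row_w.
by apply: skew_wedge2v; [move=> j; exact: row_f frm j|exact: sk2T].
Qed.

(** Linearity in the first argument and cyclic invariance of [wedge3] give linearity in all
    three. *)
Lemma mem_wedge3v (U : {vspace vec}) u v w : u \in U -> v \in U -> w \in U ->
  wedge3 D u v w \in wedge3v D U.
Proof.
have l1 v1 w1 : linear (fun u => wedge3 D u v1 w1).
  move=> a u1 u2; rewrite /wedge3 tens_linl [wedge2 D w1 _]wedge2_linr [wedge2 D _ v1]wedge2_linl.
  by rewrite !tens_linr !scalerDr [X in X + _ = _]addrACA [LHS]addrACA.
have rot u1 v1 w1 : wedge3 D u1 v1 w1 = wedge3 D v1 w1 u1.
  by rewrite /wedge3 -addrA addrC.
have l2 u1 w1 : linear (fun v => wedge3 D u1 v w1).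
  by move=> a v1 v2; rewrite !(rot u1) l1.
have l3 u1 v1 : linear (fun w => wedge3 D u1 v1 w).
  by move=> a w1 w2; rewrite -!(rot _ u1) l1.
have step (f : vec -> tensor) (T : {vspace tensor}) : linear f ->
    (forall u, u \in vbasis U -> f u \in T) -> forall u, u \in U -> f u \in T.
  move=> fl fT u1 uU; rewrite -(linfun_linear fl) memv_preim; move: u1 uU; apply/subvP.
  rewrite -{1}(span_basis (vbasisP U)); apply/span_subvP=> b bU.
  by rewrite -memv_preim (linfun_linear fl) fT.
move=> uU vU wU.
apply: (step (fun u => wedge3 D u v w) _ (l1 v w)) uU => u1 u1U.
apply: (step (fun v => wedge3 D u1 v w) _ (l2 u1 w)) vU => v1 v1U.
apply: (step (fun w => wedge3 D u1 v1 w) _ (l3 u1 v1)) wU => w1 w1U.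
apply: memv_span; apply/allpairsP; exists (u1, (v1, w1)); split=> //=.
by apply/allpairsP; exists (v1, w1).
Qed.

Lemma wedge3v_iot : wedge3v D V' = (Iot D eB fB wt_m32 @: arr_comp F m wt_m32 false)%VS.
Proof.
apply: subv_anti; apply/andP; split.
  apply/span_subvP=> _ /allpairsP[[u uw] [/= uU /allpairsP[[v w] [/= vU wU ->]] ->]] /=.
  have {}uU := vbasis_mem uU; have {}vU := vbasis_mem vU; have {}wU := vbasis_mem wU.
  have T : wedge3 D u v w \in (Iot D eB fB wt_m32 @: sk2 F m)%VS.
    rewrite -tensv_iot; apply: memvD; first apply: memvD; apply: mem_tensv => //; exact: mem_wedge2v.
  have wW : wedge3 D u v w \in W_m32 D.
    by rewrite /wedge3; do 2?apply: memvD; apply: tens_W32; exact: wedge2T.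
  case/memv_imgP: T => x xs e; rewrite e memv_img //.
  have -> : x = kap wt_m32 (wedge3 D u v w) by rewrite e IotE (kap_iot frm).
  have kl := kap_lin eB fB wt_m32.
  have kD G H : kap wt_m32 (G + H) = kap wt_m32 G + kap wt_m32 H.
    by rewrite -[G]scale1r kl !scale1r.
  have wE (a b : vec) : eB *m wedge2 D a b *m eB^T = (eB *m g *m a^T) *m (eB *m g *m b^T)^T - (eB *m g *m b^T) *m (eB *m g *m a^T)^T.
    by rewrite wedge2_quad !gT !trmxK.
  pose c (a : vec) : 'cV[F]_m := eB *m g *m a^T.
  have kw a1 a2 a3 i j k : kap wt_m32 (tens D a1 (wedge2 D a2 a3)) i j k
      = c a1 i 0 * (c a2 j 0 * c a3 k 0 - c a3 j 0 * c a2 k 0).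
    by rewrite kap_tens wE -!/(c _) !mxE !big_ord1 !mxE.
  have k3 i j k : kap wt_m32 (wedge3 D u v w) i j k
      = c u i 0 * (c v j 0 * c w k 0 - c w j 0 * c v k 0)
        + c v i 0 * (c w j 0 * c u k 0 - c u j 0 * c w k 0)
        + c w i 0 * (c u j 0 * c v k 0 - c v j 0 * c u k 0).
    by rewrite /wedge3 !kD !arrE; congr (_ + _ + _); exact: kw.
  apply/mem_arr_comp; split; first exact: kap_sk2 wW.
  move=> i j k; rewrite /= /ealt (k3 i j k) (k3 j i k); move: (c u) (c v) (c w) => cu cv cw.
  ring.
apply/subvP=> _ /memv_imgP[x xs ->]; rewrite IotE.
(* [wedge3] is a sum of three cyclic rotations. For a cyclically invariant array each rotation sums
   to twice [iot], since unordered pairs are counted twice, whence the 1/6. *)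
have -> : iot wt_m32 x = 6^-1 *: \sum_i \sum_j \sum_k x i j k *: wedge3 D (row i fB) (row j fB) (row k fB).
  have xs_skew i := sk2T i (proj1 (elimT (mem_arr_comp _ _ _) xs)).
  have [_ alt] := elimT (mem_arr_comp _ _ _) xs; have sk := elimT (mem_sk2 _) (proj1 (elimT (mem_arr_comp _ _ _) xs)).
  have cyc i j k : x i j k = x j k i.
    have e a b c : x a b c = - x b a c by apply/eqP; rewrite -addr_eq0; apply/eqP/alt.
    by rewrite e sk opprK.
  pose h i j k := x i j k *: tens D (row i fB) (wedge2 D (row j fB) (row k fB)).
  have E : \sum_i \sum_j \sum_k h i j k = 2 *: iot wt_m32 x.
    rewrite iot_tens scaler_sumr; apply: eq_bigr => i _ /=.
    rewrite wedge2_sum //.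
    rewrite -[tens D _ _](linfun_linear (tens_linr D _)) linearZ scalerA divff ?pnatr_eq0 // scale1r.
    rewrite linear_sum; apply: eq_bigr => j _; rewrite linear_sum; apply: eq_bigr => k _.
    by rewrite linearZ /= (linfun_linear (tens_linr D _)).
  have -> : \sum_i \sum_j \sum_k x i j k *: wedge3 D (row i fB) (row j fB) (row k fB) =
     \sum_i \sum_j \sum_k (h i j k + h j k i + h k i j).
    apply: eq_bigr => i _; apply: eq_bigr => j _; apply: eq_bigr => k _.
    by rewrite /wedge3 !scalerDr /h -(cyc i j k) (cyc k i j).
  have E2 : \sum_i \sum_j \sum_k h j k i = 2 *: iot wt_m32 x.
    rewrite -E exchange_big; apply: eq_bigr => j _ /=; rewrite exchange_big //.
  have E3 : \sum_i \sum_j \sum_k h k i j = 2 *: iot wt_m32 x.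
    rewrite -E2 exchange_big; apply: eq_bigr => j _ /=; rewrite exchange_big //.
  have S3 (f1 f2 : 'I_m -> 'I_m -> 'I_m -> tensor) : \sum_i \sum_j \sum_k (f1 i j k + f2 i j k)
      = \sum_i \sum_j \sum_k f1 i j k + \sum_i \sum_j \sum_k f2 i j k.
    by rewrite -big_split; apply: eq_bigr => i _; rewrite -big_split; apply: eq_bigr => j _; rewrite -big_split.
  rewrite S3 (S3 h) E E2 E3 -!scalerDl scalerA.
  have -> : 6^-1 * (2 + 2 + 2) = 1 :> F by field.
  by rewrite scale1r.
rewrite memvZ //; do 3!(apply: memv_suml => ? _); rewrite memvZ //.
by apply: mem_wedge3v; exact: row_f frm _.
Qed.
End OneFrame.
End Actions.

(** * Spinor formulas for the projections *)

Section Spin.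
Variables (F : numFieldType) (m : nat) (D : clifford F m).
Variable xi : 'rV[F]_(2 ^ (m - 1)).
Hypothesis hxi : pure D xi.
Local Notation n := (2 * m)%N.
Local Notation N := (2 ^ (m - 1))%N.
Local Notation g := (metric D).
Local Notation ginv := (invmx (metric D)).
Local Notation vec := 'rV[F]_n.
Local Notation form2 := 'M[F]_n.
Local Notation tensor := {ffun 'I_n -> 'M[F]_n}.
Local Notation arr := {ffun 'I_m -> 'M[F]_m}.
Implicit Types (u v w y : vec) (phi : form2) (G : tensor) (x : arr) (s t : weight).
Variables (V' : {vspace vec}) (eB fB : 'M[F]_(m, n)).
Hypothesis frm : frame D xi V' eB fB.
Local Notation kap := (kap eB fB).
Local Notation Psi := (Psi_mx D xi fB).
Local Notation cP := (cliffP D).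
Local Notation cM := (cliffM D).
Local Notation e i := (row i eB).
Local Notation f i := (row i fB).
Local Notation del i j := ((i == j)%:R : F).

Lemma row_quad p (P Q : 'M[F]_(p, n)) i j : (row i P *m g *m (row j Q)^T) 0 0 = (P *m g *m Q^T) i j.
Proof.
rewrite -row_mul mxE [RHS]mxE; apply: eq_bigr => k _.
by rewrite [row _ _ _ _]mxE [_^T _ _]mxE [row _ _ _ _]mxE [_^T _ _]mxE.
Qed.

Lemma g_fe i j : (f i *m g *m (e j)^T) 0 0 = del i j.
Proof. by rewrite row_quad (fe1 frm) mxE. Qed.
Lemma g_ff i j : (f i *m g *m (f j)^T) 0 0 = 0.
Proof. by rewrite row_quad (ff0 frm) mxE. Qed.

Lemma xi_e i : xi *m cP (e i) = 0.
Proof. by rewrite -xi1E; apply/eqP; rewrite -mem_V12; exact: row_e frm i. Qed.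

Lemma xi_f i : xi *m cP (f i) = row i Psi.
Proof. by rewrite -xi1E row_mul. Qed.

Lemma cliffPM_swap (p : 'rV[F]_N) u v :
  p *m cP u *m cM v = (- 2 * (u *m g *m v^T) 0 0) *: p - p *m cP v *m cM u.
Proof. by have := congr1 (mulmx p) (cliffPM D u v); rewrite mulmxDr !mulmxA mul_mx_scalar => <-; rewrite addrK. Qed.

Lemma cliffMP_swap (p : 'rV[F]_N) u v :
  p *m cM u *m cP v = (- 2 * (u *m g *m v^T) 0 0) *: p - p *m cM v *m cP u.
Proof. by have := congr1 (mulmx p) (cliffMP D u v); rewrite mulmxDr !mulmxA mul_mx_scalar => <-; rewrite addrK. Qed.

Lemma psi_e k l : row k Psi *m cM (e l) = (- 2 * del k l) *: xi.
Proof. by rewrite -xi_f cliffPM_swap xi_e mul0mx subr0 g_fe. Qed.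

Definition xff_mx j k : 'rV[F]_N := xi *m cP (f j) *m cM (f k).

Lemma xff_e j k p : xff_mx j k *m cP (e p) = (2 * del j p) *: row k Psi - (2 * del k p) *: row j Psi.
Proof.
rewrite /xff_mx cliffMP_swap g_fe xi_f psi_e -scalemxAl xi_f.
by rewrite !mulNr !scaleNr opprK addrC.
Qed.

(** The image in S^+ of a bivector of V', acting on [xi]. *)
Definition tau_map (S : 'M[F]_m) : 'rV[F]_N := \sum_j \sum_k S j k *: xff_mx j k.

Lemma tau_lin : linear tau_map.
Proof.
move=> a S T; rewrite /tau_map scaler_sumr -big_split; apply: eq_bigr => j _ /=.
rewrite scaler_sumr -big_split; apply: eq_bigr => k _ /=.
by rewrite !mxE scalerDl scalerA.
Qed.

Lemma tau_sum (J : finType) (a : J -> F) (S : J -> 'M[F]_m) :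
  tau_map (\sum_i a i *: S i) = \sum_i a i *: tau_map (S i).
Proof.
rewrite -(linfun_linear tau_lin) linear_sum; apply: eq_bigr => i _.
by rewrite linearZ /= (linfun_linear tau_lin).
Qed.

Lemma ginv_frame : ginv = fB^T *m eB + eB^T *m fB.
Proof.
rewrite -[LHS]mulmx1 -(frame_id frm) mulmxDr !mulmxA mulVmx ?metric_unit //.
by rewrite !mul1mx.
Qed.

Definition contrR G b : 'rV[F]_N := \row_A contr D xi G b A.

(** Antisymmetrisation is dropped here, so that the contraction can be expanded in any frame by
    linearity. *)
Definition quadc (M : form2) : 'rV[F]_N :=
  \sum_c \sum_d M c d *: (xi *m gammaP D c *m gammaM D d).

Lemma quadc_lin : linear quadc.
Proof.
move=> a S T; rewrite /quadc scaler_sumr -big_split; apply: eq_bigr => j _ /=.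
rewrite scaler_sumr -big_split; apply: eq_bigr => k _ /=.
by rewrite !mxE scalerDl scalerA.
Qed.

Lemma quadc_uv u v : quadc (u^T *m v) = xi *m cP u *m cM v.
Proof.
rewrite /cliffP /cliffM [xi *m _]mulmx_sumr mulmx_suml /quadc; apply: eq_bigr => c _.
rewrite mulmx_sumr; apply: eq_bigr => d _.
by rewrite mxE big_ord1 mxE -!scalemxAr -scalemxAl scalerA mulrC.
Qed.

Lemma quadc_quad (P Q : 'M[F]_(m, n)) (S : 'M[F]_m) :
  quadc (P^T *m S *m Q) = \sum_i \sum_j S i j *: (xi *m cP (row i P) *m cM (row j Q)).
Proof.
rewrite mxquad_sum -(linfun_linear quadc_lin) linear_sum; apply: eq_bigr => i _.
rewrite linear_sum; apply: eq_bigr => j _.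
by rewrite linearZ /= (linfun_linear quadc_lin) quadc_uv.
Qed.

Lemma contrR_quadc G b : (G b)^T = - G b -> contrR G b = quadc (ginv *m G b *m ginv).
Proof.
move=> sk; set H := ginv *m G b *m ginv.
have HT : H^T = - H by rewrite /H !trmx_mul !(ginv_sym D) sk mulNmx mulmxN mulmxA.
have Hs c d : H d c = - H c d by have /matrixP/(_ c d) := HT; rewrite !mxE.
have -> : quadc H = \sum_c \sum_d H c d *: xi2 D xi c d.
  have E1 : quadc H = - \sum_c \sum_d H c d *: (xi *m gammaP D d *m gammaM D c).
    rewrite /quadc exchange_big -sumrN; apply: eq_bigr => c _; rewrite -sumrN.
    by apply: eq_bigr => d _; rewrite (Hs c d) scaleNr ?opprK.
  have -> : quadc H = 2^-1 *: (quadc H + quadc H).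
    by rewrite -mulr2n -scaler_nat scalerA mulVf ?pnatr_eq0 // scale1r.
  rewrite {2}E1 -sumrN -big_split scaler_sumr; apply: eq_bigr => c _ /=.
  rewrite -sumrN -big_split scaler_sumr; apply: eq_bigr => d _ /=.
  rewrite /xi2 -scalemxAr scalerA mulrC -scalerA mulmxBr !mulmxA.
  by rewrite -scalerBr scalerA mulrC -scalerA.
apply/rowP=> A; rewrite mxE /contr.
under eq_bigr do under eq_bigr do rewrite /xi2up summxE mulr_sumr.
transitivity (\sum_c \sum_d \sum_c' \sum_d' (ginv c' c * G b c d * ginv d d') * xi2 D xi c' d' 0 A).
  apply: eq_bigr => c _; apply: eq_bigr => d _; apply: eq_bigr => c' _.
  rewrite summxE mulr_sumr; apply: eq_bigr => d' _.
  rewrite mxE; have -> : ginv c c' = ginv c' c by rewrite -[in LHS](ginv_sym D) mxE.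
  ring.
rewrite summxE; under [RHS]eq_bigr do rewrite summxE.
transitivity (\sum_c' \sum_d' \sum_c \sum_d (ginv c' c * G b c d * ginv d d') * xi2 D xi c' d' 0 A).
  under eq_bigr do rewrite exchange_big.
  rewrite exchange_big; apply: eq_bigr => c' _ /=.
  under eq_bigr do rewrite exchange_big.
  by rewrite exchange_big.
apply: eq_bigr => c' _; apply: eq_bigr => d' _; rewrite [RHS]mxE /H [(ginv *m _ *m _) _ _]mxE mulr_suml.
rewrite exchange_big; apply: eq_bigr => d _ /=.
by rewrite [(_ *m G b) _ _]mxE !mulr_suml; apply: eq_bigr => c _; ring.
Qed.

(** A multiple of the trace of the gl(m) block of Gamma, which lies in p and is therefore invisible
    in V tensor g/p. The projections cannot depend on it; its total contribution is collected in
    [Lam]. *)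
Definition lamb G b : F := - 2 * \tr (eB *m G b *m fB^T).

(** Of the four frame blocks, those whose first factor is some e_i die because e_i kills [xi]; the
    block f f gives [tau_map] and the block f e gives a multiple of [xi]. *)
Lemma contrE G b : (G b)^T = - G b -> contrR G b = tau_map (eB *m G b *m eB^T) + lamb G b *: xi.
Proof.
move=> sk; rewrite contrR_quadc // {1}ginv_frame.
have -> : ginv = eB^T *m fB + fB^T *m eB by rewrite ginv_frame addrC.
rewrite mulmxDl !mulmxDr.
have qD S T : quadc (S + T) = quadc S + quadc T by rewrite -[S]scale1r quadc_lin !scale1r.
have as_ (P Q P' Q' : 'M[F]_(m, n)) : P^T *m Q *m G b *m (P'^T *m Q') = P^T *m (Q *m G b *m P'^T) *m Q'.
  by rewrite !mulmxA.
rewrite !mulmxDl !as_ !qD !quadc_quad.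
have z0 (Q : 'M[F]_(m, n)) (S : 'M[F]_m) : \sum_i \sum_j S i j *: (xi *m cP (e i) *m cM (row j Q)) = 0.
  by rewrite big1 // => i _; rewrite big1 // => j _; rewrite xi_e mul0mx scaler0.
rewrite !z0 !addr0; congr (_ + _).
rewrite /lamb /mxtrace mulr_sumr scaler_suml; apply: eq_bigr => i _.
under eq_bigr do rewrite xi_f psi_e scalerA.
rewrite (bigD1 i) //= big1 => [|j ij]; last by rewrite eq_sym (negbTE ij) !mulr0 scale0r.
by rewrite eqxx mulr1 addr0 mulrC.
Qed.

Lemma kap_sum s G i : kap s G i = \sum_b zB eB fB s i b *: (eB *m G b *m eB^T).
Proof.
rewrite ffunE /ctr mulmx_sumr mulmx_suml; apply: eq_bigr => b _.
by rewrite -scalemxAr -scalemxAl mxE.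
Qed.

Lemma xi_gammaPup b : xi *m gammaPup D b = row b (xi1up D xi).
Proof.
apply/rowP=> A; rewrite /gammaPup mulmx_sumr summxE /xi1up [RHS]mxE [RHS]mxE.
by apply: eq_bigr => a _; rewrite -scalemxAr [LHS]mxE [in RHS]mxE.
Qed.

Lemma cP_delta a : cP (delta_mx 0 a) = gammaP D a.
Proof.
rewrite /cliffP (bigD1 a) //= big1 => [|b ab]; rewrite mxE ?eqxx ?(negbTE ab) ?scale1r ?addr0 //.
by rewrite andbF scale0r.
Qed.

Lemma sum_gammaPup (T : 'I_n -> 'rV[F]_N) : \sum_b T b *m gammaPup D b =
  \sum_i ((\sum_b eB i b *: T b) *m cP (f i) + (\sum_b fB i b *: T b) *m cP (e i)).
Proof.
have E1 (P Q : 'M[F]_(m, n)) i : (\sum_b P i b *: T b) *m cP (row i Q) =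
    \sum_b \sum_a (P i b * Q i a) *: (T b *m gammaP D a).
  rewrite mulmx_suml; apply: eq_bigr => b _; rewrite /cliffP mulmx_sumr; apply: eq_bigr => a _.
  by rewrite mxE -scalemxAr -scalemxAl scalerA mulrC.
under [RHS]eq_bigr do rewrite !E1 -big_split.
rewrite exchange_big; apply: eq_bigr => b _ /=; rewrite /gammaPup mulmx_sumr.
under [RHS]eq_bigr do rewrite -big_split.
rewrite exchange_big; apply: eq_bigr => a _ /=; rewrite -scalemxAr.
under [RHS]eq_bigr do rewrite -scalerDl.
rewrite -scaler_suml ginv_frame; congr (_ *: _); rewrite mxE [X in X + _]mxE [X in _ + X]mxE -big_split.
by apply: eq_bigr => i _ /=; rewrite ![_^T _ _]mxE addrC.
Qed.

Lemma row_xi1up b : row b (xi1up D xi) = \sum_i eB i b *: row i Psi.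
Proof.
rewrite (xi1up_Psi frm) row_mul mulmx_sum_row; apply: eq_bigr => i _.
by rewrite !mxE.
Qed.

Definition eta0_map G : 'rV[F]_N :=
  \sum_i (tau_map (kap wt_m32 G i) *m cP (f i) + tau_map (kap wt_m12 G i) *m cP (e i)).

Definition Lam G : 'rV[F]_N := \sum_b lamb G b *: row b (xi1up D xi).

Lemma etaE G : G \in W_m32 D -> \sum_b contrR G b *m gammaPup D b = eta0_map G + Lam G.
Proof.
move/mem_Wm32=> sk; under eq_bigr do rewrite (contrE (sk _)) mulmxDl -scalemxAl xi_gammaPup.
rewrite big_split /=; congr (_ + _); rewrite sum_gammaPup; apply: eq_bigr => i _.
by rewrite !kap_sum !tau_sum.
Qed.

Lemma eta_entry G B : G \in W_m32 D ->
  \sum_b \sum_A contr D xi G b A * gammaPup D b A B = (eta0_map G + Lam G) 0 B.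
Proof.
move=> h; rewrite -etaE // summxE; apply: eq_bigr => b _; rewrite mxE.
by apply: eq_bigr => A _; rewrite [contrR _ _ _ _]mxE.
Qed.

Lemma rvZ p a (v : 'rV[F]_p) i : (a *: v) 0 i = a * v 0 i.
Proof. by rewrite mxE. Qed.

Lemma rvD p (u v : 'rV[F]_p) i : (u + v) 0 i = u 0 i + v 0 i.
Proof. by rewrite mxE. Qed.

Definition P0_map G : 'M[F]_N := xi^T *m eta0_map G - \sum_i (tau_map (kap wt_m32 G i))^T *m row i Psi.

Lemma mul_cr p q (u : 'rV[F]_p) (v : 'rV[F]_q) i j : (u^T *m v) i j = u 0 i * v 0 j.
Proof. by rewrite mxE big_ord1 mxE. Qed.

Lemma mxB p q (M1 M2 : 'M[F]_(p, q)) i j : (M1 - M2) i j = M1 i j - M2 i j.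
Proof. by rewrite !mxE. Qed.

(** The [Lam] terms of the two summands of the projection are equal and cancel. *)
Lemma Pi0E G A B : G \in W_m32 D -> Pi0_m12 D xi G A B = P0_map G A B.
Proof.
move=> h; rewrite /Pi0_m12 eta_entry // /P0_map mxB mul_cr [X in _ = _ - X]summxE.
have -> : \sum_b xi1up D xi b B * contr D xi G b A =
   \sum_i ((tau_map (kap wt_m32 G i))^T *m row i Psi) A B + xi 0 A * Lam G 0 B.
  move/mem_Wm32: (h) => sk.
  transitivity (\sum_b ((contrR G b)^T *m row b (xi1up D xi)) A B).
    by apply: eq_bigr => b _; rewrite mul_cr mulrC ![row _ _ _ _]mxE [contrR _ _ _ _]mxE.
  under eq_bigr do rewrite (contrE (sk _)) mul_cr mxE mulrDl.
  rewrite big_split /=; congr (_ + _).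
    under eq_bigr do rewrite row_xi1up [X in _ * X]summxE mulr_sumr.
    rewrite exchange_big; apply: eq_bigr => i _ /=.
    rewrite mul_cr kap_sum tau_sum summxE mulr_suml; apply: eq_bigr => b _.
    by rewrite !rvZ; ring.
  rewrite /Lam summxE mulr_sumr; apply: eq_bigr => b _.
  by rewrite !rvZ; ring.
by rewrite rvD; ring.
Qed.

Definition skm (M : 'M[F]_N) : 'M[F]_N := 2^-1 *: (M - M^T).

(** The free vector index is contracted with an arbitrary [y], so that the projection can be
    evaluated on frame vectors. *)
Definition P1_map k G y : 'M[F]_N := Psi^T *m (eB *m ctr y G *m eB^T) *m Psi
  - k *: skm ((xi *m cP y)^T *m eta0_map G
              + \sum_i (row i Psi)^T *m (tau_map (kap wt_m32 G i) *m cP y)).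

Lemma xiG2E G a B C : xiG2 D xi G a B C = (Psi^T *m (eB *m G a *m eB^T) *m Psi) B C.
Proof.
have -> : Psi^T *m (eB *m G a *m eB^T) *m Psi = (xi1up D xi)^T *m G a *m xi1up D xi.
  by rewrite (xi1up_Psi frm) [(eB^T *m _)^T]trmx_mul trmxK !mulmxA.
rewrite [RHS]mxE /xiG2 exchange_big; apply: eq_bigr => c _ /=.
rewrite [((xi1up D xi)^T *m _) _ _]mxE mulr_suml; apply: eq_bigr => b _; rewrite [_^T _ _]mxE; ring.
Qed.

Lemma ctr_delta a G : ctr (delta_mx 0 a) G = G a.
Proof.
rewrite /ctr (bigD1 a) //= big1 => [|b ab]; rewrite mxE ?eqxx ?(negbTE ab) ?scale1r ?addr0 //.
by rewrite andbF scale0r.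
Qed.

(** The two [Lam] terms are transposes of each other, so their sum is symmetric and disappears under
    skew-symmetrisation. *)
Lemma Pi1_genE G a B C : G \in W_m32 D ->
  Pi1_m12_gen D xi G a B C = P1_map (2 * (m%:R - 1))^-1 G (delta_mx 0 a) B C.
Proof.
move=> h; rewrite /Pi1_m12_gen /P1_map xiG2E ctr_delta [RHS]mxE; congr (_ + _).
rewrite [RHS]mxE [in RHS]mxE; congr (- (_ * _)).
pose X := (xi *m cP (delta_mx 0 a))^T *m (eta0_map G + Lam G).
pose Y := \sum_b (row b (xi1up D xi))^T *m (contrR G b *m cP (delta_mx 0 a)).
have XE B1 C1 : xi1 D xi a B1 * (\sum_b \sum_A contr D xi G b A * gammaPup D b A C1) = X B1 C1.
  by rewrite eta_entry // mul_cr cP_delta [xi1 _ _ _ _]mxE.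
have YE B1 C1 : \sum_b \sum_A xi1up D xi b B1 * contr D xi G b A * gammaP D a A C1 = Y B1 C1.
  rewrite summxE; apply: eq_bigr => b _; rewrite mul_cr cP_delta [row _ _ _ _]mxE [(contrR G b *m _) _ _]mxE mulr_sumr.
  by apply: eq_bigr => A _; rewrite [contrR _ _ _ _]mxE mulrA.
rewrite /skew2 !XE !YE.
have YX : Y = \sum_i (row i Psi)^T *m (tau_map (kap wt_m32 G i) *m cP (delta_mx 0 a))
     + (Lam G)^T *m (xi *m cP (delta_mx 0 a)).
  move/mem_Wm32: (h) => sk.
  rewrite /Y; under eq_bigr do rewrite (contrE (sk _)) mulmxDl mulmxDr.
  rewrite big_split /=; congr (_ + _).
    under eq_bigr do rewrite row_xi1up linear_sum mulmx_suml.
    rewrite exchange_big; apply: eq_bigr => i _ /=.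
    rewrite kap_sum tau_sum mulmx_suml mulmx_sumr; apply: eq_bigr => b _.
    by rewrite linearZ /= -!scalemxAl -scalemxAr.
  rewrite /Lam linear_sum mulmx_suml; apply: eq_bigr => b _.
  by rewrite linearZ /= -!scalemxAl -scalemxAr.
have e M B1 C1 : (skm M) B1 C1 = 2^-1 * (M B1 C1 - M C1 B1) by rewrite !mxE.
rewrite e !mulrDr YX /X mulmxDr.
have d (M1 M2 : 'M[F]_N) B1 C1 : (M1 + M2) B1 C1 = M1 B1 C1 + M2 B1 C1 by rewrite mxE.
rewrite !d !mul_cr; ring.
Qed.
End Spin.

(** * Kernels in weight -3/2 and the kernel of Pi^0 in weight -1/2 *)

Section Spin2.
Variables (F : numFieldType) (m : nat) (D : clifford F m).
Variable xi : 'rV[F]_(2 ^ (m - 1)).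
Hypothesis hxi : pure D xi.
Local Notation n := (2 * m)%N.
Local Notation N := (2 ^ (m - 1))%N.
Local Notation vec := 'rV[F]_n.
Local Notation form2 := 'M[F]_n.
Local Notation tensor := {ffun 'I_n -> 'M[F]_n}.
Local Notation arr := {ffun 'I_m -> 'M[F]_m}.
Implicit Types (u v w y : vec) (phi : form2) (G : tensor) (x : arr) (s t : weight).
Variables (V' : {vspace vec}) (eB fB : 'M[F]_(m, n)).
Hypothesis frm : frame D xi V' eB fB.
Hypothesis m2 : (2 < m)%N.
Local Notation kap := (kap eB fB).
Local Notation Psi := (Psi_mx D xi fB).
Local Notation cP := (cliffP D).
Local Notation cM := (cliffM D).
Local Notation e i := (row i eB).
Local Notation f i := (row i fB).
Local Notation del i j := ((i == j)%:R : F).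
Local Notation tau := (tau_map D xi fB).
Local Notation eta0 := (eta0_map D xi eB fB).
Local Notation P0 := (P0_map D xi eB fB).
Local Notation P1 := (P1_map D xi eB fB).

Lemma outer0 p q (u : 'rV[F]_p) (v : 'rV[F]_q) : u^T *m v = 0 -> v != 0 -> u = 0.
Proof.
move=> uv v0; apply/rowP=> i; rewrite mxE; apply/eqP; apply: contraNT v0 => ui.
apply/eqP/rowP=> j; have /matrixP/(_ i j) := uv; rewrite mul_cr !mxE => /eqP.
by rewrite mulf_eq0 (negbTE ui) => /eqP.
Qed.

Lemma Psi_free0 p (u : 'M[F]_(p, m)) : u *m Psi = 0 -> u = 0.
Proof. by move=> h; apply: (row_free_inj (Psi_free frm)); rewrite h mul0mx. Qed.

(** Clifford multiplication by e_p removes either factor f, with coefficients 2 and -2; skewness of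
    [S] merges both into 4. *)
Lemma tau_e (S : 'M[F]_m) p : S^T = - S -> tau S *m cP (e p) = 4 *: (row p S *m Psi).
Proof.
move=> sk; have Sk j k : S k j = - S j k by have /matrixP/(_ j k) := sk; rewrite !mxE.
rewrite mulmx_suml.
transitivity (\sum_j \sum_k (del j p *: ((2 * S j k) *: row k Psi) - del k p *: ((2 * S j k) *: row j Psi))).
  apply: eq_bigr => j _; rewrite mulmx_suml; apply: eq_bigr => k _.
  rewrite -scalemxAl (xff_e frm) scalerBr !scalerA.
  by congr (_ *: _ - _ *: _); ring.
have sd (T : 'I_m -> 'rV[F]_N) : \sum_j del j p *: T j = T p.
  by rewrite (bigD1 p) //= eqxx scale1r big1 ?addr0 // => j /negbTE->; rewrite scale0r.
under eq_bigr do rewrite sumrB sd.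
rewrite sumrB exchange_big /=; under eq_bigr do rewrite sd.
rewrite -sumrB mulmx_sum_row scaler_sumr; apply: eq_bigr => k _.
by rewrite (Sk p k) mxE scalerA -scalerBl; congr (_ *: _); ring.
Qed.

Lemma kap_skew s G i : G \in W_m32 D -> (kap s G i)^T = - kap s G i.
Proof. by move=> h; apply: sk2T; exact: kap_sk2 h. Qed.

Lemma tau0 : tau 0 = 0.
Proof. by rewrite /tau_map big1 // => j _; rewrite big1 // => k _; rewrite mxE scale0r. Qed.

Lemma P1_e k G p : G \in W_m32 D -> P1 k G (e p) =
  Psi^T *m (\matrix_(j, l) (kap wt_m32 G p j l - 2 * k * (kap wt_m32 G j p l - kap wt_m32 G l p j))) *m Psi.
Proof.
move=> h; rewrite /P1_map (xi_e frm) trmx0 mul0mx add0r.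
have -> : eB *m ctr (e p) G *m eB^T = kap wt_m32 G p by rewrite ffunE.
pose Mp : 'M[F]_m := \matrix_(i, l) kap wt_m32 G i p l.
have -> : \sum_i (row i Psi)^T *m (tau (kap wt_m32 G i) *m cP (e p)) = 4 *: (Psi^T *m Mp *m Psi).
  transitivity (\sum_i 4 *: ((row i Psi)^T *m (row i Mp *m Psi))).
    apply: eq_bigr => i _; rewrite tau_e ?kap_skew // -scalemxAr; congr (_ *: (_ *m (_ *m _))).
    by apply/rowP=> l; rewrite !mxE.
  rewrite -scaler_sumr -mulmxA; congr (_ *: _); apply/matrixP=> a b; rewrite summxE mxE.
  by apply: eq_bigr => i _; rewrite mul_cr -row_mul [row _ _ _ _]mxE [row _ _ _ _]mxE [_^T _ _]mxE.
have tA (M : 'M[F]_m) : (Psi^T *m M *m Psi)^T = Psi^T *m M^T *m Psi.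
  by move: Psi => Q; rewrite !trmx_mul trmxK mulmxA.
rewrite /skm [(4 *: _)^T]linearZ /= tA -scalerBr !scalerA -mulmxBl -mulmxBr.
rewrite scalemxAl scalemxAr -mulmxBl -mulmxBr; congr (_ *m _ *m _).
by apply/matrixP=> j l; rewrite !mxE; field.
Qed.

Lemma eta0_q0 G : G \in W_m32 D -> kap wt_m32 G = 0 ->
  eta0 G = 4 *: ((\row_k ctrace (kap wt_m12 G) k) *m Psi).
Proof.
move=> h q0; rewrite /eta0_map q0.
transitivity (\sum_i 4 *: (row i (kap wt_m12 G i) *m Psi)).
  by apply: eq_bigr => i _; rewrite ffunE tau0 mul0mx add0r tau_e ?kap_skew.
rewrite -scaler_sumr -mulmx_suml; congr (_ *: (_ *m _)).
apply/rowP=> k; rewrite summxE !mxE; apply: eq_bigr => i _; by rewrite mxE.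
Qed.

Lemma P1_f k G p : G \in W_m32 D -> kap wt_m32 G = 0 -> P1 k G (f p) =
  Psi^T *m (\matrix_(j, l) (kap wt_m12 G p j l
     - 2 * k * (del p j * ctrace (kap wt_m12 G) l - del p l * ctrace (kap wt_m12 G) j))) *m Psi.
Proof.
move=> h q0; rewrite /P1_map (eta0_q0 h q0) q0 xi_f.
have -> : eB *m ctr (f p) G *m eB^T = kap wt_m12 G p by rewrite ffunE.
rewrite big1 ?addr0 => [|i _]; last by rewrite ffunE tau0 mul0mx mulmx0.
set t := \row_k0 _.
have tA (M : 'M[F]_m) : (Psi^T *m M *m Psi)^T = Psi^T *m M^T *m Psi.
  by move: Psi => Q; rewrite !trmx_mul trmxK mulmxA.
have -> : (row p Psi)^T *m (4 *: (t *m Psi)) = 4 *: (Psi^T *m ((delta_mx 0 p : 'rV_m)^T *m t) *m Psi).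
  by rewrite -scalemxAr rowE; move: Psi => Q; rewrite trmx_mul !mulmxA.
rewrite /skm [(4 *: _)^T]linearZ /= tA -scalerBr !scalerA -mulmxBl -mulmxBr.
rewrite scalemxAl scalemxAr -mulmxBl -mulmxBr; congr (_ *m _ *m _).
apply/matrixP=> j l; rewrite [LHS]mxE [RHS]mxE [X in _ + X]mxE [X in _ - X]mxE mxB [(_ *m _)^T _ _]mxE !mul_cr.
by rewrite ![delta_mx _ _ _ _]mxE ![t _ _]mxE eqxx /= (eq_sym j) (eq_sym l); field.
Qed.

(** Sandwiching between e_p and e_r kills the first term, as e_p kills [xi], and leaves only the
    summand [r] of the second, from which row [p] of the array is read off. The kernel of Pi^0 thus
    lies in W^{-1/2}, the source of both arrows from W^0. *)
Lemma P0_q G : G \in W_m32 D -> P0 G = 0 -> kap wt_m32 G = 0.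
Proof.
move=> h M0; apply/ffunP=> r; apply/row_matrixP=> p; rewrite [(0 : arr) r]ffunE row0.
apply: Psi_free0; have := congr1 (fun M => (cP (e p))^T *m M *m cM (e r)) M0.
rewrite /= mulmx0 mul0mx /P0_map mulmxBr mulmxA -trmx_mul (xi_e frm) trmx0 mul0mx sub0r.
rewrite mulNmx [(cP _)^T *m _]mulmx_sumr mulmx_suml (bigD1 r) //= big1 => [|i ir].
  rewrite addr0 -!mulmxA (psi_e frm) eqxx !mulmxA -trmx_mul tau_e ?kap_skew //.
  rewrite mulr1 -scalemxAr => /eqP; rewrite oppr_eq0 scaler_eq0 oppr_eq0 pnatr_eq0 /= => /eqP.
  move/outer0/(_ hxi.1)/eqP; rewrite scaler_eq0 pnatr_eq0 /= => /eqP.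
  by rewrite /Psi_mx !mulmxA.
by rewrite -!mulmxA (psi_e frm) (negbTE ir) mulr0 scale0r !mulmx0.
Qed.

(** The array with its indices converted to spinor indices; [trip_inj] makes this conversion
    faithful, so symmetrisations of spinor indices become those of the array. *)
Definition trip x (A B C : 'I_N) : F :=
  \sum_i \sum_j \sum_k Psi i A * Psi j B * Psi k C * x i j k.

Lemma tripE x A B C : trip x A B C = \sum_i Psi i A * (Psi^T *m x i *m Psi) B C.
Proof.
apply: eq_bigr => i _; rewrite [(_ *m _) B C]mxE exchange_big mulr_sumr; apply: eq_bigr => k _ /=.
rewrite [(Psi^T *m _) _ _]mxE mulr_suml mulr_sumr; apply: eq_bigr => j _.
rewrite [Psi^T _ _]mxE; ring.
Qed.

Lemma trip_inj x : (forall A B C, trip x A B C = 0) -> x = 0.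
Proof.
move=> h; apply/ffunP=> i; rewrite [(0 : arr) i]ffunE; apply: (Psi_inj2 frm).
rewrite mulmx0 mul0mx; apply/matrixP=> B C; rewrite [RHS]mxE.
have : (\row_i (Psi^T *m x i *m Psi) B C) *m Psi = 0.
  apply/rowP=> A; rewrite [RHS]mxE -[RHS](h A B C) tripE mxE.
  by apply: eq_bigr => k _; rewrite [X in X * _]mxE mulrC.
by move/Psi_free0/rowP/(_ i); rewrite !(mxE _ _ 0 i).
Qed.

Lemma trip_lin a x x' A B C : trip (a *: x + x') A B C = a * trip x A B C + trip x' A B C.
Proof.
rewrite /trip mulr_sumr -big_split; apply: eq_bigr => i _ /=.
rewrite mulr_sumr -big_split; apply: eq_bigr => j _ /=.
rewrite mulr_sumr -big_split; apply: eq_bigr => k _ /=; rewrite !arrE; ring.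
Qed.

Lemma trip_swap12 x A B C : trip x B A C = trip (arr3 (fun i j k => x j i k)) A B C.
Proof.
rewrite /trip exchange_big; apply: eq_bigr => i _; apply: eq_bigr => j _; apply: eq_bigr => k _.
by rewrite arr3E [X in X * _ * _]mulrC.
Qed.

Lemma trip_swap23 x A B C : trip x A C B = trip (arr3 (fun i j k => x i k j)) A B C.
Proof.
rewrite /trip; apply: eq_bigr => i _; rewrite exchange_big; apply: eq_bigr => j _; apply: eq_bigr => k _.
by rewrite arr3E; ring.
Qed.

Lemma xiG3E G A B C : xiG3 D xi G A B C = trip (kap wt_m32 G) A B C.
Proof.
rewrite tripE /xiG3.
transitivity (\sum_a \sum_i Psi i A * (eB i a * (Psi^T *m (eB *m G a *m eB^T) *m Psi) B C)).
  apply: eq_bigr => a _; rewrite (xiG2E frm).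
  have -> : xi1up D xi a A = \sum_i eB i a * Psi i A.
    rewrite (xi1up_Psi frm) [LHS]mxE; apply: eq_bigr => i _.
    by rewrite [_^T _ _]mxE.
  by rewrite mulr_suml; apply: eq_bigr => i _; ring.
rewrite exchange_big; apply: eq_bigr => i _ /=; rewrite -mulr_sumr; congr (_ * _).
rewrite kap_sum mulmx_sumr mulmx_suml summxE; apply: eq_bigr => a _.
by rewrite -scalemxAr -scalemxAl [RHS]mxE.
Qed.

Lemma Pi1_m32E G A B C : Pi1_m32 D xi G A B C =
  2^-1 * trip (arr3 (ealt (kap wt_m32 G))) A B C.
Proof.
rewrite /Pi1_m32 !xiG3E (trip_swap12 _ A B C); congr (_ * _); rewrite addrC -[trip (arr3 _) A B C]mul1r -trip_lin.
by congr trip; apply: arrP => i j k; rewrite /ealt !arrE mul1r addrC.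
Qed.

(** Skewness in the last two indices pairs the six terms, so they amount to twice the cyclic sum and
    2/6 becomes 1/3. *)
Lemma Pi0_m32E G A B C : G \in W_m32 D -> Pi0_m32 D xi G A B C =
  3^-1 * trip (arr3 (ecyc (kap wt_m32 G))) A B C.
Proof.
move=> h; set q := kap wt_m32 G.
have sk i j k : q i j k = - q i k j by have /mem_sk2 := kap_sk2 eB fB wt_m32 h.
rewrite /Pi0_m32 /skew3 !xiG3E -/q.
have -> : trip q B C A = trip (arr3 (fun i j k => q j k i)) A B C.
  rewrite (trip_swap23 _ B A C) (trip_swap12 _ A B C); congr trip; apply: arrP => i j k; by rewrite !arr3E.
have -> : trip q C A B = trip (arr3 (fun i j k => q k i j)) A B C.
  rewrite (trip_swap12 _ A C B) (trip_swap23 _ A B C); congr trip; apply: arrP => i j k; by rewrite !arr3E.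
have -> : trip q C B A = trip (arr3 (fun i j k => q k j i)) A B C.
  rewrite (trip_swap12 _ B C A) (trip_swap23 _ B A C) (trip_swap12 _ A B C); congr trip; apply: arrP => i j k; by rewrite !arr3E.
rewrite (trip_swap23 q A B C) (trip_swap12 q A B C).
set x1 := arr3 _; set x2 := arr3 _; set x3 := arr3 _; set x4 := arr3 _; set x5 := arr3 _.
have -> : 3^-1 * trip (arr3 (ecyc q)) A B C = 6^-1 * trip (q + x1 + x2 - x3 - x4 - x5) A B C.
  have -> : q + x1 + x2 - x3 - x4 - x5 = 2 *: arr3 (ecyc q) + 0.
    apply: arrP => i j k; rewrite !arrE /ecyc (sk i k j) (sk j i k) (sk k j i); ring.
  rewrite trip_lin.
  have -> : trip 0 A B C = 0.
    by rewrite /trip big1 // => i _; rewrite big1 // => j _; rewrite big1 // => k _; rewrite arrE mulr0.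
  by field.
congr (_ * _).
have tD x x' : trip (x + x') A B C = trip x A B C + trip x' A B C.
  by rewrite -[x]scale1r trip_lin mul1r scale1r.
have tB x x' : trip (x - x') A B C = trip x A B C - trip x' A B C.
  by rewrite addrC -scaleN1r trip_lin mulN1r addrC.
by rewrite !(tB, tD).
Qed.

Lemma trip0P x : (forall A B C, trip x A B C = 0) <-> x = 0.
Proof.
split; first exact: trip_inj.
move=> -> A B C; rewrite /trip.
by rewrite big1 // => i _; rewrite big1 // => j _; rewrite big1 // => k _; rewrite arrE mulr0.
Qed.

Variable eps : 'M[F]_N.

(** The negation of [b] appears because a projection vanishes exactly on the component of the other
    index. *)
Lemma Pi_m32P b G : G \in W_m32 D ->
  (Pi_zero D xi eps wt_m32 b G <-> kap wt_m32 G \in arr_comp F m wt_m32 (~~ b)).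
Proof.
move=> h; have k0 (c t : F) : c != 0 -> c * t = 0 -> t = 0.
  by move=> /negbTE c0 /eqP; rewrite mulf_eq0 c0 /= => /eqP.
have sk := kap_sk2 eB fB wt_m32 h.
case: b => /=; split=> [H|/mem_arr_comp[_ H] A B C].
- apply/mem_arr_comp; split=> // i j k; rewrite /= -arr3E.
  rewrite (_ : arr3 _ = 0) ?arrE //; apply: trip_inj => A B C.
  by apply: (k0 2^-1); [rewrite invr_eq0 pnatr_eq0|rewrite -Pi1_m32E].
- rewrite Pi1_m32E (_ : arr3 _ = 0); last by apply: arrP => i j k; rewrite arr3E [LHS]H arrE.
  by rewrite (proj2 (trip0P 0)) // mulr0.
- apply/mem_arr_comp; split=> // i j k; rewrite /= -arr3E.
  rewrite (_ : arr3 _ = 0) ?arrE //; apply: trip_inj => A B C.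
  by apply: (k0 3^-1); [rewrite invr_eq0 pnatr_eq0|rewrite -Pi0_m32E].
- rewrite Pi0_m32E // (_ : arr3 _ = 0); last by apply: arrP => i j k; rewrite arr3E [LHS]H arrE.
  by rewrite (proj2 (trip0P 0)) // mulr0.
Qed.

Lemma Pi0_m12P G : G \in W_m32 D ->
  (forall A B, Pi0_m12 D xi G A B = 0) <-> P0 G = 0.
Proof.
move=> h; split=> [H|H A B]; last by rewrite (Pi0E frm) // H mxE.
by apply/matrixP=> A B; rewrite -(Pi0E frm) // H mxE.
Qed.

(** Without a weight -3/2 part the map is [xi] tensored with four times the contraction, converted
    by [Psi], so its kernel is the trace-free arrays. *)
Lemma Pi0_W12 G : G \in W_m12 D xi ->
  (Pi_zero D xi eps wt_m12 false G <-> kap wt_m12 G \in arr_comp F m wt_m12 true).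
Proof.
move/(mem_Wm12 frm) => [h q0]; rewrite /= Pi0_m12P // /P0_map (eta0_q0 h q0) q0.
rewrite big1 ?subr0 => [|i _]; last by rewrite ffunE tau0 trmx0 mul0mx.
set t := \row_k _; split=> [|/mem_arr_comp[_ H]].
  move/(congr1 trmx); rewrite trmx0 trmx_mul trmxK => /outer0/(_ hxi.1)/eqP.
  rewrite scaler_eq0 pnatr_eq0 /= => /eqP/Psi_free0/rowP H; apply/mem_arr_comp.
  split=> [|i j k]; first exact: kap_sk2 h.
  by have := H k; rewrite !mxE.
suff -> : t = 0 by rewrite mul0mx scaler0 mulmx0.
by apply/rowP=> k1; rewrite !mxE; exact: (H k1 k1 k1).
Qed.
End Spin2.

(** * The kernel of Pi^1 in weight -1/2, with the cases of m treated together *)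

Section Spin3.
Variables (F : numFieldType) (m : nat) (D : clifford F m).
Variable xi : 'rV[F]_(2 ^ (m - 1)).
Hypothesis hxi : pure D xi.
Local Notation n := (2 * m)%N.
Local Notation N := (2 ^ (m - 1))%N.
Local Notation vec := 'rV[F]_n.
Local Notation form2 := 'M[F]_n.
Local Notation tensor := {ffun 'I_n -> 'M[F]_n}.
Local Notation arr := {ffun 'I_m -> 'M[F]_m}.
Implicit Types (u v w y : vec) (phi : form2) (G : tensor) (x : arr) (s t : weight).
Variables (V' : {vspace vec}) (eB fB : 'M[F]_(m, n)).
Hypothesis frm : frame D xi V' eB fB.
Hypothesis m2 : (2 < m)%N.
Local Notation kap := (kap eB fB).
Local Notation Psi := (Psi_mx D xi fB).
Local Notation cP := (cliffP D).
Local Notation e i := (row i eB).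
Local Notation f i := (row i fB).
Local Notation tau := (tau_map D xi fB).
Local Notation eta0 := (eta0_map D xi eB fB).
Local Notation P1 := (P1_map D xi eB fB).

Local Notation trip := (trip D xi fB).
Variable eps : 'M[F]_N.
Hypothesis heps : m = 3%N -> spinor_duality D eps.

Lemma skew_form0 p (U : 'M[F]_p) (z : 'rV[F]_p) : U^T = - U -> z *m U *m z^T = 0.
Proof.
move=> sk; have e : (z *m U *m z^T)^T = - (z *m U *m z^T).
  by rewrite !trmx_mul trmxK sk mulNmx mulmxN mulmxA.
apply/matrixP=> i j; rewrite !ord1 [RHS]mxE; have /matrixP/(_ 0 0) := e.
rewrite [LHS]mxE [RHS]mxE => /eqP; rewrite -addr_eq0 -mulr2n mulrn_eq0 /= => /eqP.
by [].
Qed.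

Lemma mxZ p q c (M : 'M[F]_(p, q)) i j : (c *: M) i j = c * M i j.
Proof. by rewrite mxE. Qed.

Definition sig G : F := \sum_i (tau (kap wt_m32 G i) *m eps *m (row i Psi)^T) 0 0.

Section Three.
Hypothesis m3 : m = 3%N.

Lemma eps_unit : eps \in unitmx. Proof. by case: (heps m3). Qed.

Lemma gamma_upup_skew b : (gamma_upup D eps b)^T = - gamma_upup D eps b.
Proof.
have [_ up _] := heps m3; rewrite /gamma_upup linear_sum -sumrN; apply: eq_bigr => a _.
by rewrite linearZ /= up scalerN.
Qed.

Lemma gamma_upupE b : gamma_upup D eps b = invmx eps *m gammaPup D b.
Proof. by rewrite /gamma_upup /gammaPup mulmx_sumr; apply: eq_bigr => a _; rewrite -scalemxAr. Qed.

Lemma contr_lowE G b E : contr_low D xi eps G b E = (contrR D xi G b *m eps) 0 E.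
Proof.
have xl a c : xi2_low D xi eps a c = xi2 D xi a c *m eps.
  rewrite /xi2_low /xi2 /gamma_up /gamma_low -!mulmxA; congr (_ *m _).
  rewrite -scalemxAr -scalemxAl; congr (_ *: _).
  by rewrite mulmxBr mulmxBl !mulmxA mulmxV ?eps_unit // !mul1mx.
have xu a c : xi2_lowup D xi eps a c = xi2up D xi a c *m eps.
  rewrite /xi2_lowup /xi2up mulmx_suml; apply: eq_bigr => i _; rewrite mulmx_suml.
  by apply: eq_bigr => j _; rewrite xl scalemxAl.
rewrite /contr_low [RHS]mxE.
under [RHS]eq_bigr do rewrite mxE /contr mulr_suml.
rewrite [RHS]exchange_big; apply: eq_bigr => c _ /=.
under [RHS]eq_bigr do rewrite mulr_suml.
rewrite [RHS]exchange_big; apply: eq_bigr => d _ /=.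
rewrite xu [(_ *m eps) _ _]mxE mulr_sumr; apply: eq_bigr => A _; ring.
Qed.

(** The trace term contributes a multiple of [xi] paired with [xi] times a skew matrix, which is
    zero. *)
Lemma sigE G : G \in W_m32 D ->
  \sum_b \sum_A xi1up D xi b A * contr_low D xi eps G b A = sig G.
Proof.
move/mem_Wm32=> sk.
transitivity (\sum_b (contrR D xi G b *m eps *m (row b (xi1up D xi))^T) 0 0).
  apply: eq_bigr => b _; rewrite [RHS]mxE; apply: eq_bigr => A _.
  by rewrite contr_lowE [_^T _ _]mxE [row _ _ _ _]mxE mulrC.
transitivity (\sum_b (tau (eB *m G b *m eB^T) *m eps *m (row b (xi1up D xi))^T) 0 0).
  apply: eq_bigr => b _; rewrite (contrE frm (sk b)) !mulmxDl -!scalemxAl.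
  have -> : xi *m eps *m (row b (xi1up D xi))^T = 0.
    rewrite -(xi_gammaPup D xi b).
    have -> : xi *m gammaPup D b = xi *m eps *m gamma_upup D eps b.
      by rewrite gamma_upupE !mulmxA mulmxK ?eps_unit.
    move: (xi *m eps) => z; rewrite trmx_mul gamma_upup_skew mulNmx mulmxN mulmxA.
    by rewrite skew_form0 ?oppr0 // gamma_upup_skew.
  by rewrite scaler0 addr0.
rewrite /sig; under [RHS]eq_bigr do rewrite kap_sum tau_sum !mulmx_suml summxE.
rewrite exchange_big; apply: eq_bigr => b _ /=.
rewrite (row_xi1up frm) linear_sum mulmx_sumr summxE; apply: eq_bigr => i _ /=.
by rewrite linearZ /= -!scalemxAl -scalemxAr.
Qed.

(** Lowering with [eps] and raising with its inverse cancel, and 2(m - 1) = 4, so the two formulas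
    differ only by the scalar term. *)
Lemma Pi1_3E G a B C : G \in W_m32 D -> Pi1_m12_3 D xi eps G a B C =
  Pi1_m12_gen D xi G a B C + (6^-1 * sig G) * (invmx eps *m gammaP D a) B C.
Proof.
move=> h; rewrite /Pi1_m12_3 sigE //; congr (_ + _).
rewrite /Pi1_m12_gen; congr (_ - _).
have -> : (2 * (m%:R - 1))^-1 = 4^-1 :> F by rewrite m3; congr (_^-1); ring.
have E1 b C1 (M : 'M[F]_N) : \sum_E contr_low D xi eps G b E * (invmx eps *m M) E C1 =
    \sum_A contr D xi G b A * M A C1.
  transitivity ((contrR D xi G b *m eps *m (invmx eps *m M)) 0 C1).
    by rewrite [RHS]mxE; apply: eq_bigr => E _; rewrite contr_lowE.
  rewrite mulmxA mulmxK ?eps_unit // mxE; apply: eq_bigr => A _.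
  by rewrite [contrR _ _ _ _ _ _]mxE.
congr (_ * (_ + _)).
  rewrite /skew2; congr (_ * (_ * _ - _ * _)); apply: eq_bigr => b _; by rewrite gamma_upupE E1.
rewrite /skew2; congr (_ * (_ - _)); apply: eq_bigr => b _.
  under eq_bigr do rewrite -mulrA; rewrite -mulr_sumr E1 mulr_sumr.
  by apply: eq_bigr => A _; rewrite mulrA.
under eq_bigr do rewrite -mulrA; rewrite -mulr_sumr E1 mulr_sumr.
by apply: eq_bigr => A _; rewrite mulrA.
Qed.
End Three.

(** Zero unless m = 3, so that [R1_map] covers both definitions of Pi^1. *)
Definition kk_coef G : F := if m == 3%N then 6^-1 * sig G else 0.
Definition R1_map G y : 'M[F]_N := P1 (2 * (m%:R - 1))^-1 G y + kk_coef G *: (invmx eps *m cP y).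

Lemma Pi1E G a B C : G \in W_m32 D -> Pi1_m12 D xi eps G a B C = R1_map G (delta_mx 0 a) B C.
Proof.
move=> h; rewrite /Pi1_m12 /R1_map /kk_coef [RHS]mxE -(Pi1_genE frm) // cP_delta.
case: eqP => [m3|_]; last by rewrite scale0r mxE addr0.
by rewrite Pi1_3E // mxZ.
Qed.

Lemma R1_lin G : linear (R1_map G).
Proof.
move=> a u v; rewrite /R1_map /P1_map.
have -> : skm ((xi *m cP (a *: u + v))^T *m eta0 G + \sum_i (row i Psi)^T *m (tau (kap wt_m32 G i) *m cP (a *: u + v)))
  = a *: skm ((xi *m cP u)^T *m eta0 G + \sum_i (row i Psi)^T *m (tau (kap wt_m32 G i) *m cP u)) +
    skm ((xi *m cP v)^T *m eta0 G + \sum_i (row i Psi)^T *m (tau (kap wt_m32 G i) *m cP v)).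
  have sl : linear (@skm F m).
    by move=> c M M'; apply/matrixP=> i j; rewrite !mxE; ring.
  rewrite -sl; congr skm; rewrite cliffP_lin; move: (cP u) (cP v) => pu pv.
  have -> : (xi *m (a *: pu + pv))^T = a *: (xi *m pu)^T + (xi *m pv)^T.
    by rewrite mulmxDr -scalemxAr [LHS]linearD /= [X in X + _]linearZ.
  rewrite mulmxDl -scalemxAl scalerDr addrACA; congr (_ + _).
  rewrite scaler_sumr -big_split; apply: eq_bigr => i _ /=.
  by rewrite !mulmxDr -!scalemxAr.
set s1 := skm _; set s2 := skm _; rewrite ctr_linl cliffP_lin !mulmxDr !mulmxDl -!scalemxAr -!scalemxAl.
have R (V : lmodType F) (k c : F) (x1 x2 y1 y2 z1 z2 : V) :
    a *: x1 + x2 - k *: (a *: y1 + y2) + c *: (a *: z1 + z2) =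
    a *: (x1 - k *: y1 + c *: z1) + (x2 - k *: y2 + c *: z2).
  rewrite !scalerDr !scalerN !scalerA ![_ * a]mulrC opprD [X in X + _ = _]addrACA.
  by rewrite [LHS]addrACA.
rewrite mulmxDr mulmxDl -scalemxAr -scalemxAl; exact: R.
Qed.

Lemma Pi1_W32P G : G \in W_m32 D ->
  (forall a B C, Pi1_m12 D xi eps G a B C = 0) <-> (forall p, R1_map G (e p) = 0 /\ R1_map G (f p) = 0).
Proof.
move=> h; have Rs p (J : 'I_p -> F) (v : 'I_p -> vec) :
    R1_map G (\sum_i J i *: v i) = \sum_i J i *: R1_map G (v i).
  rewrite -(linfun_linear (R1_lin G)) linear_sum; apply: eq_bigr => i _.
  by rewrite linearZ /= (linfun_linear (R1_lin G)).
split=> [H|H a B C].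
  have Ry y : R1_map G y = 0.
    rewrite (row_sum_delta y) Rs big1 // => a _.
    have -> : R1_map G (delta_mx 0 a) = 0 by apply/matrixP=> B C; rewrite -Pi1E // H mxE.
    by rewrite scaler0.
  by move=> p; split.
rewrite Pi1E // [delta_mx 0 a](frame_dec frm) [_ *m eB]mulmx_sum_row [_ *m fB]mulmx_sum_row -[X in X + _]scale1r R1_lin !Rs scale1r.
rewrite !big1 ?addr0 ?mxE // => i _; [by rewrite (proj2 (H i)) scaler0|by rewrite (proj1 (H i)) scaler0].
Qed.

Lemma sig_q0 G : kap wt_m32 G = 0 -> sig G = 0.
Proof.
move=> q0; rewrite /sig q0 big1 // => i _.
by rewrite ffunE (_ : tau 0 = 0) ?mul0mx ?mxE // /tau_map big1 // => j _; rewrite big1 // => k _; rewrite mxE scale0r.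
Qed.

Lemma quad0 (A : 'M[F]_m) : Psi^T *m A *m Psi = 0 -> A = 0.
Proof. by move=> h; apply: (Psi_inj2 frm); rewrite h mulmx0 mul0mx. Qed.

Lemma two_k : 2 * (2 * (m%:R - 1))^-1 = (m%:R - 1)^-1 :> F.
Proof. by field; exact: m1_neq0. Qed.

(** The scalar term vanishes without a weight -3/2 part. On f_p the factor 1/(2(m - 1)), doubled,
    becomes 1/(m - 1), and the equation is that of pure traces. *)
Lemma Pi1_W12 G : G \in W_m12 D xi ->
  (Pi_zero D xi eps wt_m12 true G <-> kap wt_m12 G \in arr_comp F m wt_m12 false).
Proof.
move/(mem_Wm12 frm) => [h q0]; rewrite /= Pi1_W32P //.
have k0 : kk_coef G = 0 by rewrite /kk_coef sig_q0 // mulr0 if_same.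
have m10 := m1_neq0 F m2; set c := kap wt_m12 G.
split=> [H|/mem_arr_comp[_ H] p].
  apply/mem_arr_comp; split=> [|p j l]; first exact: kap_sk2 h.
  have := (H p).2; rewrite /R1_map k0 scale0r addr0 (P1_f frm) // -/c => /quad0/matrixP/(_ j l).
  rewrite two_k !mxE /= /epure => /eqP; rewrite subr_eq0 => /eqP->.
  by field.
split; rewrite /R1_map k0 scale0r addr0.
  rewrite (P1_e frm) // q0 (_ : \matrix_(_, _) _ = 0) ?mulmx0 ?mul0mx //.
  by apply/matrixP=> j l; rewrite !mxE !ffunE !mxE subrr mulr0 subr0.
rewrite (P1_f frm) // (_ : \matrix_(_, _) _ = 0) ?mulmx0 ?mul0mx //.
apply/matrixP=> j l; rewrite !mxE two_k -/c; apply: (mulfI m10); rewrite mulr0 -[RHS](H p j l) /= /epure.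
by field.
Qed.

Lemma PiE s b G : G \in Wfil D xi s ->
  (Pi_zero D xi eps s b G <-> kap s G \in arr_comp F m s (~~ b)).
Proof.
case: s => /= h; first exact: (Pi_m32P frm).
by case: b; [exact: Pi1_W12|exact: (Pi0_W12 hxi frm)].
Qed.

(** With S the cyclic sum, evaluation on e_p gives (m - 2) q = -S; summing cyclically gives (m + 1)
    S = 0, hence q = 0. *)
Lemma Pi1_q_gen G : m <> 3%N -> G \in W_m32 D ->
  (forall a B C, Pi1_m12 D xi eps G a B C = 0) -> kap wt_m32 G = 0.
Proof.
move=> m3 h /(Pi1_W32P h) H; set q := kap wt_m32 G.
have sk i j k : q i j k = - q i k j by have /mem_sk2 := kap_sk2 eB fB wt_m32 h.
have m10 := m1_neq0 F m2.
have E p j l : (m%:R - 1) * q p j l = q j p l - q l p j.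
  have := (H p).1; rewrite /R1_map /kk_coef; case: eqP => // _.
  rewrite scale0r addr0 (P1_e frm) // -/q => /quad0/matrixP/(_ j l).
  rewrite two_k !mxE => /eqP; rewrite subr_eq0 => /eqP->.
  by field.
have S p j l : (m%:R + 1) * (q p j l + q j l p + q l p j) = 0.
  have := E p j l; have := E j l p; have := E l p j.
  rewrite (sk l j p) (sk p l j) (sk j p l) => E1 E2 E3.
  have : (m%:R - 1) * (q p j l + q j l p + q l p j) = - 2 * (q p j l + q j l p + q l p j).
    rewrite !mulrDr E1 E2 E3; ring.
  move/eqP; rewrite -subr_eq0 => /eqP S; rewrite -[RHS]S; ring.
have S0 p j l : q p j l + q j l p + q l p j = 0.
  have /eqP := S p j l; rewrite mulf_eq0 natr1 pnatr_eq0 /= => /eqP; exact.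
apply: arrP => p j l; rewrite arrE.
have := E p j l; rewrite (sk j p l) => E1.
have : (m%:R - 2) * q p j l = 0.
  rewrite -[RHS]oppr0 -(S0 p j l); have -> : (m%:R - 2) * q p j l = (m%:R - 1) * q p j l - q p j l by ring.
  rewrite E1; ring.
move/eqP; rewrite mulf_eq0 subr_eq0 eqr_nat => /orP[|/eqP //].
by move/eqP=> m2'; exfalso; move: m2; rewrite m2'.
Qed.
End Spin3.

(** * The case m = 3: weight -3/2 parts in the kernel of Pi^1 are totally skew *)

Section Spin4.
Variables (F : numFieldType) (m : nat) (D : clifford F m).
Variable xi : 'rV[F]_(2 ^ (m - 1)).
Hypothesis hxi : pure D xi.
Local Notation n := (2 * m)%N.
Local Notation N := (2 ^ (m - 1))%N.
Local Notation vec := 'rV[F]_n.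
Local Notation form2 := 'M[F]_n.
Local Notation tensor := {ffun 'I_n -> 'M[F]_n}.
Local Notation arr := {ffun 'I_m -> 'M[F]_m}.
Implicit Types (u v w y : vec) (phi : form2) (G : tensor) (x : arr) (s t : weight).
Variables (V' : {vspace vec}) (eB fB : 'M[F]_(m, n)).
Hypothesis frm : frame D xi V' eB fB.
Hypothesis m2 : (2 < m)%N.
Local Notation kap := (kap eB fB).
Local Notation Psi := (Psi_mx D xi fB).
Local Notation cP := (cliffP D).
Local Notation cM := (cliffM D).
Local Notation e i := (row i eB).

Local Notation trip := (trip D xi fB).
Variable eps : 'M[F]_N.
Hypothesis heps : m = 3%N -> spinor_duality D eps.

Local Notation kk := (kk_coef D xi eB fB eps).
Hypothesis m3 : m = 3%N.

Lemma cM_tr v : (cM v)^T = - (invmx eps^T *m cM v *m eps).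
Proof.
have [eu _ low] := heps m3.
have : (cM v *m eps)^T = - (cM v *m eps).
  rewrite /cliffM mulmx_suml linear_sum -sumrN; apply: eq_bigr => a _.
  by rewrite -scalemxAl linearZ /= -/(gamma_low D eps a) low scalerN.
rewrite trmx_mul => /(congr1 (mulmx (invmx eps^T))).
by rewrite mulKmx ?unitmx_tr // mulmxN mulmxA.
Qed.

Lemma Psi_cM l : Psi *m cM (e l) = - 2 *: ((delta_mx 0 l : 'rV_m)^T *m xi).
Proof.
apply/row_matrixP=> k; rewrite row_mul (psi_e frm) trmx_delta.
apply/rowP=> A; rewrite mxE [RHS]mxE mxZ [(_ *m _) _ _]mxE big_ord1 [delta_mx _ _ _ _]mxE andbT.
by rewrite mulrA.
Qed.

(** The scalar term is not computed. Sandwiched between e_j and e_l it is skew in j and p, so the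
    remaining expression [X] must be skew as well, and this is skewness of the array in its first
    two indices. *)
Lemma Pi1_q_three G : G \in W_m32 D ->
  (forall a B C, Pi1_m12 D xi eps G a B C = 0) -> kap wt_m32 G \in arr_comp F m wt_m32 false.
Proof.
move=> h /(Pi1_W32P frm heps h) H; have [eu _ _] := heps m3.
have skm_ := kap_sk2 eB fB wt_m32 h; set q := kap wt_m32 G in skm_ *.
have sk i j k : q i j k = - q i k j by have /mem_sk2 := skm_.
pose X p : 'M[F]_m := \matrix_(j, l) (q p j l - 2 * (2 * (m%:R - 1))^-1 * (q j p l - q l p j)).
pose K j p l := (cM (e j))^T *m (invmx eps *m cP (e p)) *m cM (e l).
have XK p j l : (4 * X p j l) *: (xi^T *m xi) = - (kk G *: K j p l).
  have := congr1 (fun M => (cM (e j))^T *m M *m cM (e l)) (H p).1.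
  rewrite /= mulmx0 mul0mx /R1_map (P1_e frm) // -/q -/(X p) mulmxDr mulmxDl -scalemxAr -scalemxAl -/(K j p l).
  move/eqP; rewrite addr_eq0 => /eqP <-.
  have -> : (cM (e j))^T *m (Psi^T *m X p *m Psi) *m cM (e l) = (Psi *m cM (e j))^T *m X p *m (Psi *m cM (e l)).
    by move: Psi => Q; rewrite trmx_mul !mulmxA.
  rewrite !Psi_cM [(_ *: _)^T]linearZ /= trmx_mul trmxK -!scalemxAl -scalemxAr scalerA.
  have -> : xi^T *m delta_mx 0 j *m X p *m ((delta_mx 0 l : 'rV_m)^T *m xi) = X p j l *: (xi^T *m xi).
    rewrite !mulmxA -(mulmxA _ (delta_mx 0 j)) -(mulmxA xi^T) -rowE trmx_delta -colE.
    have -> : col l (row j (X p)) = (X p j l)%:M.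
      by apply/matrixP=> a b; rewrite !ord1 [RHS]mxE eqxx mulr1n [LHS]mxE [LHS]mxE.
    by rewrite mul_mx_scalar -scalemxAl.
  by rewrite scalerA; congr (_ *: _); ring.
(* Transposition moves e_j next to e_p across [eps]; the e's are null, so they anticommute. *)
have KS j p l : K j p l + K p j l = 0.
  rewrite /K !cM_tr !mulNmx -opprD !mulmxA !mulmxK // -!mulmxDl -!(mulmxA (invmx _)) -mulmxDr.
  rewrite cliffMP row_quad (ee0 frm) mxE mulr0.
  have -> : (0 : F)%:M = 0 :> 'M_N by exact: raddf0.
  by rewrite mulmx0 mul0mx oppr0.
have XS p j l : X p j l + X j p l = 0.
  have : (4 * (X p j l + X j p l)) *: (xi^T *m xi) = 0.
    by rewrite mulrDr scalerDl !XK -opprD -scalerDr KS scaler0 oppr0.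
  move/eqP; rewrite scaler_eq0 mulf_eq0 pnatr_eq0 /= => /orP[/eqP//|/eqP /outer0 h0].
  by move: hxi.1; rewrite h0 ?eqxx // hxi.1.
apply/mem_arr_comp; split=> // p j l.
have := XS p j l; rewrite ![X _ _ _]mxE /= /ealt (sk l p j) => E.
have : 2^-1 * (q p j l + q j p l) = 0.
  have mF : m%:R = 3 :> F by rewrite m3.
  rewrite -[RHS]E mF; by field.
by move/eqP; rewrite mulf_eq0 invr_eq0 pnatr_eq0 /= => /eqP.
Qed.
End Spin4.

(** * The case m = 3: a spinor basis and the missing arrow *)

Section Spin5.
Variables (F : numFieldType) (m : nat) (D : clifford F m).
Variable xi : 'rV[F]_(2 ^ (m - 1)).
Hypothesis hxi : pure D xi.
Local Notation n := (2 * m)%N.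
Local Notation N := (2 ^ (m - 1))%N.
Local Notation vec := 'rV[F]_n.
Local Notation form2 := 'M[F]_n.
Local Notation tensor := {ffun 'I_n -> 'M[F]_n}.
Local Notation arr := {ffun 'I_m -> 'M[F]_m}.
Implicit Types (u v w y : vec) (phi : form2) (G : tensor) (x : arr) (s t : weight).
Variables (V' : {vspace vec}) (eB fB : 'M[F]_(m, n)).
Hypothesis frm : frame D xi V' eB fB.
Hypothesis m2 : (2 < m)%N.
Local Notation kap := (kap eB fB).
Local Notation Psi := (Psi_mx D xi fB).
Local Notation cP := (cliffP D).
Local Notation cM := (cliffM D).
Local Notation e i := (row i eB).
Local Notation f i := (row i fB).
Local Notation del i j := ((i == j)%:R : F).
Local Notation tau := (tau_map D xi fB).
Local Notation xff := (xff_mx D xi fB).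
Local Notation eta0 := (eta0_map D xi eB fB).

Local Notation trip := (trip D xi fB).
Variable eps : 'M[F]_N.
Hypothesis heps : m = 3%N -> spinor_duality D eps.

Local Notation R1 := (R1_map D xi eB fB eps).
Local Notation kk := (kk_coef D xi eB fB eps).
Hypothesis m3 : m = 3%N.

(* The Levi-Civita symbol. The tensor with this array of weight -3/2 lies in the kernel of
   Pi^1_{-1/2} but not in that of Pi^0_{-3/2}, which removes the fourth arrow when m = 3. *)
Definition levi : arr := arr3 (fun i j k =>
  2^-1 * ((j%:R - i%:R) * (k%:R - i%:R) * (k%:R - j%:R))).

Lemma levi_s12 i j k : levi i j k = - levi j i k.
Proof. by rewrite !arr3E; ring. Qed.
Lemma levi_s23 i j k : levi i j k = - levi i k j.
Proof. by rewrite !arr3E; ring. Qed.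

Lemma levi_alt : levi \in arr_comp F m wt_m32 false.
Proof.
apply/mem_arr_comp; split; first by apply/mem_sk2; exact: levi_s23.
by move=> i j k; rewrite /= /ealt levi_s12 addNr.
Qed.

Definition o0 : 'I_m := Ordinal (ltnW (ltnW m2)).
Definition o1 : 'I_m := Ordinal (ltnW m2).
Definition o2 : 'I_m := Ordinal m2.

Lemma ord3P (i : 'I_m) : [\/ i = o0, i = o1 | i = o2].
Proof.
have := ltn_ord i; case: i => [[|[|[|i]]] hi] /= h.
- by constructor 1; exact: val_inj.
- by constructor 2; exact: val_inj.
- by constructor 3; exact: val_inj.
- by exfalso; move: h; rewrite m3.
Qed.

Lemma sum3 (V : nmodType) (H : 'I_m -> V) : \sum_i H i = H o0 + H o1 + H o2.
Proof.
rewrite (bigD1 o0) //= (bigD1 o1) //= (bigD1 o2) //= big1 ?addr0 ?addrA // => i.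
by case: (ord3P i) => ->.
Qed.

Lemma levi_012 : levi o0 o1 o2 = 1.
Proof. by rewrite arr3E /=; field. Qed.

(** Repeated indices give zero and transpositions reach all other triples from one. Module values
    let the lemma serve both spinors and scalars. *)
Lemma alt3 (V : lmodType F) (T : 'I_m -> 'I_m -> 'I_m -> V) :
  (forall i j k, T i j k = - T j i k) -> (forall i j k, T i j k = - T i k j) ->
  forall i j k, T i j k = levi i j k *: T o0 o1 o2.
Proof.
move=> s12 s23 i j k; apply/eqP; rewrite -subr_eq0; apply/eqP.
pose Z i j k := T i j k - levi i j k *: T o0 o1 o2; rewrite -/(Z i j k).
have z12 a b c : Z a b c = - Z b a c by rewrite /Z s12 levi_s12 scaleNr opprK opprB addrC.
have z23 a b c : Z a b c = - Z a c b by rewrite /Z s23 levi_s23 scaleNr opprK opprB addrC.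
have n0 (v : V) : v = - v -> v = 0.
  move/eqP; rewrite -addr_eq0 -mulr2n -scaler_nat scaler_eq0 pnatr_eq0 /= => /eqP.
  by [].
have e12 a c : Z a a c = 0 by exact/n0/z12.
have e23 a c : Z a c c = 0 by exact/n0/z23.
have e13 a c : Z a c a = 0 by rewrite z12 e23 oppr0.
have zz : Z o0 o1 o2 = 0 by rewrite /Z levi_012 scale1r subrr.
have z2 : Z o1 o0 o2 = 0 by rewrite z12 zz oppr0.
have z3 : Z o0 o2 o1 = 0 by rewrite z23 zz oppr0.
case: (ord3P i) => ->; case: (ord3P j) => ->; case: (ord3P k) => ->;
 rewrite ?e12 ?e23 ?e13 ?zz ?z2 ?z3 //.
- by rewrite z23 z2 oppr0.
- by rewrite z12 z3 oppr0.
- by rewrite z12 z23 z2 oppr0 oppr0.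
Qed.

Lemma levi_contr a b : \sum_j \sum_k levi a j k * levi b j k = 2 * del a b.
Proof.
rewrite !sum3; case: (ord3P a) => ->; case: (ord3P b) => ->; rewrite !arr3E /=; by field.
Qed.

Lemma cP_ff (p : 'rV[F]_N) k : p *m cP (f k) *m cM (f k) = 0.
Proof.
have := cliffPM_swap D p (f k) (f k); rewrite (g_ff frm) mulr0 scale0r sub0r => /eqP.
by rewrite -addr_eq0 -mulr2n -scaler_nat scaler_eq0 pnatr_eq0 /= => /eqP.
Qed.

Definition Om : 'rV[F]_N := xff o0 o1 *m cP (f o2).

Lemma xff_f i j k : xff i j *m cP (f k) = levi i j k *: Om.
Proof.
apply: (alt3 (T := fun i j k => xff i j *m cP (f k))) => {}i {}j {}k.
  by rewrite /xff_mx cliffPM_swap (g_ff frm) mulr0 scale0r sub0r mulNmx.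
by rewrite /xff_mx cliffMP_swap (g_ff frm) mulr0 scale0r sub0r.
Qed.

Lemma tau_f i p : tau (levi i) *m cP (f p) = (2 * del i p) *: Om.
Proof.
rewrite -levi_contr !scaler_suml mulmx_suml; apply: eq_bigr => j _.
rewrite mulmx_suml scaler_suml; apply: eq_bigr => k _.
have -> : levi p j k = levi j k p by rewrite levi_s12 levi_s23 opprK.
by rewrite -scalemxAl xff_f scalerA.
Qed.

(** [Om] can be written up to sign with f_k as its last factor, and f_k squares to zero. *)
Lemma Om_f k : Om *m cM (f k) = 0.
Proof.
have h i j l : levi i j l != 0 -> Om *m cM (f l) = 0.
  move=> nz; have := cP_ff (xff i j) l; rewrite xff_f -scalemxAl => /eqP.
  by rewrite scaler_eq0 (negbTE nz) => /eqP.
by case: (ord3P k) => ->; [apply: (h o1 o2)|apply: (h o2 o0)|apply: (h o0 o1)];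
  rewrite arr3E /= (_ : _ * _ = 1) ?oner_eq0 //; field.
Qed.

(** For the pairing given by [eps], each Clifford multiplication is minus its own adjoint by
    skewness of the lowered matrices; for two factors the signs cancel and the order is reversed. *)
Lemma pair_swap (psi chi : 'rV[F]_N) v w :
  psi *m cP v *m cM w *m eps *m chi^T = psi *m eps *m (chi *m cM w *m cP v)^T.
Proof.
have [eu up low] := heps m3.
have PT : (cP v)^T = - (invmx eps *m cP v *m eps^T).
  have : (invmx eps *m cP v)^T = - (invmx eps *m cP v).
    rewrite /cliffP mulmx_sumr linear_sum -sumrN; apply: eq_bigr => a _.
    by rewrite -scalemxAr linearZ /= -/(gamma_up D eps a) up scalerN.
  rewrite trmx_mul trmx_inv => /(congr1 (mulmx^~ eps^T)) /=.
  by rewrite mulmxKV ?unitmx_tr // mulNmx.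
rewrite 2!trmx_mul (cM_tr heps m3) PT !mulNmx !mulmxN opprK.
by rewrite !mulmxA !mulmxK ?unitmx_tr.
Qed.

Definition theta : F := (xi *m eps *m Om^T) 0 0.

Lemma xi_psi i : xi *m eps *m (row i Psi)^T = 0.
Proof.
have [eu up _] := heps m3.
have -> : row i Psi = xi *m eps *m (invmx eps *m cP (f i)) by rewrite !mulmxA mulmxK // xi_f.
have sk : (invmx eps *m cP (f i))^T = - (invmx eps *m cP (f i)).
  rewrite /cliffP mulmx_sumr linear_sum -sumrN; apply: eq_bigr => a _.
  by rewrite -scalemxAr linearZ /= -/(gamma_up D eps a) up scalerN.
by rewrite trmx_mul sk mulNmx mulmxN mulmxA skew_form0 ?oppr0.
Qed.

Lemma tau_psi a i : tau (levi a) *m eps *m (row i Psi)^T = (- 2 * del a i * theta)%:M.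
Proof.
have E j k : (levi a j k *: xff j k) *m eps *m (row i Psi)^T = (- (levi a j k * levi i j k) * theta)%:M.
  rewrite -!scalemxAl pair_swap -xi_f -[xi *m cP (f i) *m cM (f k)]/(xff i k) xff_f.
  rewrite (levi_s23 i k) scaleNr [(- _)^T]linearN /= [(_ *: Om)^T]linearZ /= mulmxN -scalemxAr.
  apply/matrixP=> b c; rewrite !ord1 mxZ [RHS]mxE eqxx mulr1n.
  rewrite [X in _ * X]mxE mxZ -/theta; ring.
rewrite mulmx_suml mulmx_suml.
under eq_bigr do (rewrite !mulmx_suml; under eq_bigr do rewrite E).
apply/matrixP=> b c; rewrite !ord1 summxE [RHS]mxE eqxx mulr1n.
rewrite mulNr -[2 * _]levi_contr !mulNr mulr_suml -sumrN; apply: eq_bigr => j _.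
rewrite summxE mulr_suml -sumrN; apply: eq_bigr => k _; rewrite mxE eqxx mulr1n; ring.
Qed.

Lemma tau_Om a : tau (levi a) *m eps *m Om^T = 0.
Proof.
rewrite mulmx_suml mulmx_suml big1 // => j _; rewrite !mulmx_suml big1 // => k _.
by rewrite -!scalemxAl pair_swap Om_f mul0mx trmx0 mulmx0 scaler0.
Qed.

(** S^+ has dimension 4 = 1 + 3, and [xi] with the three [tau (levi a)] is a basis: multiplication
    by e_p kills [xi] and reads off the bivector, after which a multiple of [xi] remains. *)
Lemma spinor_basis_eq0 (M : 'M[F]_N) :
  xi *m M = 0 -> (forall a, tau (levi a) *m M = 0) -> M = 0.
Proof.
move=> M1 M2.
pose T := \matrix_(a < m) tau (levi a); pose B := col_mx xi T.
have uT (u : 'rV[F]_m) : u *m T = tau (\sum_a u 0 a *: levi a).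
  by rewrite mulmx_sum_row tau_sum; apply: eq_bigr => a _; rewrite rowK.
have TM : T *m M = 0 by apply/row_matrixP=> a; rewrite row_mul rowK M2 row0.
have Bf : row_free B.
  apply: inj_row_free => u; rewrite -[u]hsubmxK mul_row_col.
  set a := lsubmx u; set b := rsubmx u => h.
  have b0 : b = 0.
    apply/rowP=> c; rewrite [RHS]mxE.
    pose S := \sum_a b 0 a *: levi a.
    have ST : S^T = - S.
      rewrite /S linear_sum -sumrN; apply: eq_bigr => d _; rewrite linearZ /= sk2T ?scalerN //.
      by apply/mem_sk2; exact: levi_s23.
    have S0 : S = 0.
      apply/row_matrixP=> p; rewrite row0; apply: (Psi_free0 frm).
      have := congr1 (mulmx^~ (cP (e p))) h; rewrite /= mul0mx mulmxDl -mulmxA (xi_e frm) mulmx0 add0r.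
      rewrite uT -/S (tau_e frm p ST) => /eqP; rewrite scaler_eq0 pnatr_eq0 /= => /eqP.
      by [].
    have : \sum_j \sum_k levi c j k * S j k = 2 * b 0 c.
      transitivity (\sum_d b 0 d * (\sum_j \sum_k levi c j k * levi d j k)).
        under [RHS]eq_bigr do rewrite mulr_sumr.
        rewrite [RHS]exchange_big; apply: eq_bigr => j _ /=.
        under [RHS]eq_bigr do rewrite mulr_sumr.
        rewrite [RHS]exchange_big; apply: eq_bigr => k _ /=.
        rewrite /S summxE mulr_sumr; apply: eq_bigr => d _; rewrite mxZ; ring.
      under eq_bigr do rewrite levi_contr mulrCA.
      rewrite -mulr_sumr -(sum_delta_sym (fun d => b 0 d) c); congr (_ * _).
      by apply: eq_bigr => d _; rewrite mulrC.
    rewrite S0 big1 => [|j _]; last by rewrite big1 // => k _; rewrite mxE mulr0.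
    by move/esym/eqP; rewrite mulf_eq0 pnatr_eq0 /= => /eqP.
  move: h; rewrite b0 mul0mx addr0 => h.
  have -> : a = 0.
    apply: trmx_inj; rewrite trmx0; apply: (outer0 _ hxi.1).
    by rewrite trmxK.
  by rewrite row_mx0.
have /row_fullP[L LB] : row_full B.
  by rewrite /row_full eqn_leq rank_leq_col /= (eqP (Bf : \rank B == _)) m3.
by rewrite -[M]mul1mx -LB -mulmxA mul_col_mx M1 TM col_mx0 mulmx0.
Qed.

Lemma exists_Pi1_not_Pi0 : exists G, [/\ G \in W_m32 D,
   forall a B C, Pi1_m12 D xi eps G a B C = 0 & kap wt_m32 G \notin arr_comp F m wt_m32 true].
Proof.
have [eu _ _] := heps m3; have xsk : levi \in sk2 F m by apply/mem_sk2; exact: levi_s23.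
pose G := iot D eB fB wt_m32 levi.
have q3 : kap wt_m32 G = levi by rewrite (kap_iot frm).
have q1 : kap wt_m12 G = 0 by rewrite (kap_iot frm).
have h : G \in W_m32 D by exact: iot_W32.
exists G; split=> //; last first.
  apply/negP; rewrite q3 => x1; have := levi_012.
  have : levi \in (arr_comp F m wt_m32 false :&: arr_comp F m wt_m32 true)%VS.
    by rewrite memv_cap levi_alt.
  by rewrite (comp_cap F m2) memv0 => /eqP->; rewrite arrE => /esym/eqP; rewrite oner_eq0.
have mF : m%:R = 3 :> F by rewrite m3.
(* The three diagonal values -2 [theta] add up to -6 [theta], so the factor 1/6 yields exactly the
   coefficient that cancels the remaining terms. *)
have kkE : kk G = - theta.
  rewrite /kk_coef; case: eqP => // _; rewrite /sig q3; under eq_bigr do rewrite tau_psi eqxx [_%:M _ _]mxE mulr1n.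
  rewrite sumr_const card_ord -[X in 6^-1 * X]mulr_natl mF /=; by field.
have xi_Psi : xi *m eps *m Psi^T = 0.
  apply: trmx_inj; rewrite trmx0 trmx_mul trmxK; apply/row_matrixP=> i; rewrite row_mul row0.
  by apply: trmx_inj; rewrite trmx_mul trmxK trmx0 xi_psi.
have tau_Psi a : tau (levi a) *m eps *m Psi^T = (- 2 * theta) *: delta_mx 0 a.
  apply: trmx_inj; apply/row_matrixP=> i; rewrite trmx_mul trmxK row_mul; apply: trmx_inj.
  rewrite trmx_mul trmxK tau_psi; apply/matrixP=> b c.
  by rewrite !ord1 [LHS]mxE eqxx mulr1n [RHS]mxE [RHS]mxE [RHS]mxE mxZ [delta_mx _ _ _ _]mxE eqxx (eq_sym i) /=; ring.
have R1e p : R1 G (e p) = 2 *: (Psi^T *m levi p *m Psi) - theta *: (invmx eps *m cP (e p)).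
  rewrite /R1_map (P1_e frm) // kkE scaleNr q3; congr (_ - _).
  rewrite (_ : \matrix_(_, _) _ = 2 *: levi p) -?scalemxAr -?scalemxAl //.
  apply/matrixP=> j l; rewrite mxE mxZ mF (levi_s12 j p l) (levi_s12 l p j) (levi_s23 p l j).
  by field.
have eta : eta0 G = 6 *: Om.
  rewrite /eta0_map q3 q1; under eq_bigr do rewrite tau_f eqxx mulr1 ffunE tau0 mul0mx addr0.
  rewrite sumr_const card_ord -scaler_nat scalerA mF; congr (_ *: _); ring.
have R1f p : R1 G (f p) = (Om^T *m row p Psi - (row p Psi)^T *m Om) - theta *: (invmx eps *m cP (f p)).
  rewrite /R1_map /P1_map kkE scaleNr xi_f eta q3; congr (_ - _).
  have -> : eB *m ctr (f p) G *m eB^T = 0.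
    by have /ffunP/(_ p) := q1; rewrite !ffunE.
  rewrite mulmx0 mul0mx sub0r.
  have -> : \sum_i (row i Psi)^T *m (tau (levi i) *m cP (f p)) = 2 *: ((row p Psi)^T *m Om).
    rewrite (bigD1 p) //= big1 ?addr0 => [|i ip]; rewrite tau_f.
      by rewrite eqxx mulr1 -scalemxAr.
    by rewrite (negbTE ip) mulr0 scale0r mulmx0.
  rewrite -scalemxAr -scalerDl /skm [(_ *: _)^T]linearZ /= -scalerBr !scalerA -scaleNr.
  have -> : - ((2 * (m%:R - 1))^-1 * 2^-1 * (6 + 2)) = -1 :> F by rewrite mF; field.
  rewrite scaleN1r opprB; congr (_ - _).
  by move: (row p Psi) => r; rewrite trmx_mul trmxK.
(* Multiplication by [eps] puts the first index into S^+, where each identity is tested on the basis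
   of [spinor_basis_eq0]. *)
apply/(Pi1_W32P frm heps h) => p; split; apply: (can_inj (mulKmx eu)); rewrite mulmx0; apply: spinor_basis_eq0 => [|a].
- rewrite R1e mulmxA mulmxBr -!scalemxAr !mulmxA xi_Psi !mul0mx mulmxK // (xi_e frm).
  by rewrite !scaler0 subr0.
- rewrite R1e mulmxA mulmxBr -!scalemxAr !mulmxA tau_Psi mulmxK // (tau_e frm).
    rewrite -!scalemxAl -rowE !scalerA -scaleNr.
    have -> : row a (levi p) = - row p (levi a).
      by apply/rowP=> l; rewrite [LHS]mxE mxE [X in - X]mxE levi_s12.
    rewrite -[X in _ *: X + _]mulmxA -/Psi mulNmx scalerN -scaleNr -scalerDl; apply/eqP; rewrite scaler_eq0; apply/orP; left; apply/eqP.
    ring.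
  by apply: sk2T; exact: xsk.
- rewrite R1f mulmxA !mulmxBr -!scalemxAr (mulmxA _ Om^T) (mulmxA _ (row p Psi)^T) xi_psi.
  rewrite mul0mx subr0 (mulmxA (_ *m eps)) mulmxK // xi_f.
  have -> : xi *m eps *m Om^T = theta%:M by apply/matrixP=> b c; rewrite !ord1 [RHS]mxE eqxx mulr1n.
  by rewrite mul_scalar_mx subrr.
- rewrite R1f mulmxA !mulmxBr -!scalemxAr (mulmxA _ Om^T) (mulmxA _ (row p Psi)^T) tau_Om tau_psi.
  rewrite mul0mx sub0r mul_scalar_mx (mulmxA (_ *m eps)) mulmxK // tau_f.
  by rewrite -scaleNr scalerA -scalerBl; apply/eqP; rewrite scaler_eq0; apply/orP; left; apply/eqP; ring.
Qed.
End Spin5.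

(** * Arrows *)

Section Arrow.
Variables (F : numFieldType) (m : nat).
Hypothesis m2 : (2 < m)%N.
Local Notation arr := {ffun 'I_m -> 'M[F]_m}.
Implicit Types (x : arr) (A B : 'M[F]_m).
Local Notation del i j := ((i == j)%:R : F).

Lemma act1E B x i j k : act1 B x i j k = \sum_l B i l * x l j k.
Proof. by rewrite ffunE summxE; apply: eq_bigr => l _; rewrite mxE. Qed.

Lemma act1_delta p q x i j k :
  act1 (delta_mx p q - delta_mx q p) x i j k = del i p * x q j k - del i q * x p j k.
Proof.
rewrite act1E.
under eq_bigr do rewrite !mxE -!mulnb !natrM mulrBl -!mulrA.
by rewrite sumrB -!mulr_sumr !sum_delta.
Qed.

Lemma skew_delta (p q : 'I_m) : (delta_mx p q - delta_mx q p : 'M[F]_m)^T = - (delta_mx p q - delta_mx q p).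
Proof. by rewrite linearB /= !trmx_delta opprB. Qed.

(** The action of g_1 on graded pieces is equivariant: the first term is the bracket of the gl(m)
    element with [B], again skew. The span of all images is therefore a submodule. *)
Lemma rho_act1 A B x : rho wt_m12 A (act1 B x) =
  act1 (- (A^T *m B + B *m A)) x + act1 B (rho wt_m32 A x).
Proof.
apply: arrP => i j k; rewrite arrDE [LHS]arr3E !act1E.
under [X in _ = _ + X]eq_bigr do rewrite arr3E !big_split /= !mulrDr.
rewrite !big_split /= addrA addrA.
have E1 : \sum_l slot wt_m12 A i l * act1 B x l j k = - \sum_p (A^T *m B) i p * x p j k.
  rewrite -sumrN; under eq_bigr do rewrite act1E mulr_sumr.
  rewrite exchange_big; apply: eq_bigr => p _ /=; rewrite mxE mulr_suml -sumrN.
  by apply: eq_bigr => l _; rewrite !mxE; ring.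
have E2 : \sum_p (- (A^T *m B + B *m A)) i p * x p j k =
   - \sum_p (A^T *m B) i p * x p j k - \sum_p (B *m A) i p * x p j k.
  rewrite -!sumrN -big_split; apply: eq_bigr => p _ /=.
  by rewrite [X in X * _]mxE [X in - X * _]mxE; ring.
have E3 : \sum_l B i l * (\sum_p slot wt_m32 A l p * x p j k) = \sum_p (B *m A) i p * x p j k.
  under eq_bigr do rewrite mulr_sumr.
  rewrite exchange_big; apply: eq_bigr => p _ /=; rewrite mxE mulr_suml.
  by apply: eq_bigr => l _; ring.
have E4 (H : 'I_m -> 'I_m -> F) (c : 'I_m -> F) :
    \sum_l c l * (\sum_p B i p * H p l) = \sum_p B i p * (\sum_l c l * H p l).
  under eq_bigr do rewrite mulr_sumr.
  rewrite exchange_big; apply: eq_bigr => p _; rewrite mulr_sumr.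
  by apply: eq_bigr => l _; ring.
rewrite E1 E2 E3; under [X in _ + X + _ = _]eq_bigr do rewrite act1E.
under [X in _ + X = _]eq_bigr do rewrite act1E.
rewrite (E4 (fun p l => x p l k)) (E4 (fun p l => x p j l)); ring.
Qed.

Definition monom (a b c : 'I_m) : arr := arr3 (fun i j k =>
  del i a * (del j b * del k c - del j c * del k b)).

(* For both components of weight -3/2 the coefficient of the pure trace in [mix_sum] is nonzero:
   4 - 2m for (al, be) = (1, 1) and - 1 - m for (al, be) = (2, -1). *)
Definition mix (al be : F) p q r : arr :=
  al *: monom p q r + be *: (monom q r p + monom r p q).

Lemma mix_alt p q r : mix 1 1 p q r \in arr_comp F m wt_m32 false.
Proof.
apply/mem_arr_comp; split; first by apply/mem_sk2=> i j k; rewrite !arrE; ring.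
by move=> i j k; rewrite /= /ealt !arrE; ring.
Qed.

Lemma mix_cyc p q r : mix 2 (-1) p q r \in arr_comp F m wt_m32 true.
Proof.
apply/mem_arr_comp; split; first by apply/mem_sk2=> i j k; rewrite !arrE; ring.
by move=> i j k; rewrite /= /ecyc !arrE; ring.
Qed.

(** Summing over p and q contracts the acting bivector against two indices of [mix]; the result
    depends on [r] alone and is a pure trace, with a coefficient to be compared with zero. *)
Lemma mix_sum al be r :
  \sum_p \sum_q act1 (delta_mx p q - delta_mx q p) (mix al be p q r) =
  (al + 3 * be - m%:R * (al + be)) *: puret (fun k => del k r).
Proof.
apply: arrP => i j k; rewrite sum_ffunE summxE.
under eq_bigr do rewrite sum_ffunE summxE; rewrite /=.
under eq_bigr do under eq_bigr do rewrite act1_delta.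
under eq_bigr do rewrite sumrB -mulr_sumr.
rewrite sumrB sum_delta_sym exchange_big /=.
under [X in _ - X]eq_bigr do rewrite -mulr_sumr.
rewrite sum_delta_sym !arrE.
have E1 : \sum_q mix al be i q r q j k =
   \sum_q (del q i * (al * (del j q * del k r - del j r * del k q))
     - be * (del i j * del k r - del i k * del j r)
     + del q r * (be * (del j i * del k q - del j q * del k i))).
  by apply: eq_bigr => q _; rewrite !arrE eqxx (eq_sym i j) (eq_sym i k) /=; ring.
have E2 : \sum_p mix al be p i r p j k =
   \sum_p (al * (del i j * del k r - del i k * del j r)
     + del p i * (be * (del j r * del k p - del j p * del k r))
     + del p r * (be * (del j p * del k i - del j i * del k p))).
  by apply: eq_bigr => q _; rewrite !arrE eqxx (eq_sym i j) (eq_sym i k) /=; ring.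
rewrite E1 E2 !(big_split, sumrB) /= !sum_delta ?sumrN !sumr_const card_ord.
rewrite -[(be * _) *+ m]mulr_natl -[(al * _) *+ m]mulr_natl (eq_sym i j) (eq_sym i k).
ring.
Qed.

(** [S] is characterised as the least subspace containing all images rather than defined, so that it
    can later be the image under [Kap] of an action span. *)
Variables (j k : bool) (S : {vspace arr}).
Hypothesis memS : forall B x, B^T = - B -> x \in arr_comp F m wt_m32 k -> act1 B x \in S.
Hypothesis S_min : forall T : {vspace arr},
  (forall B x, B^T = - B -> x \in arr_comp F m wt_m32 k -> act1 B x \in T) -> (S <= T)%VS.

Lemma stable_act1_span : stable fullv (rho wt_m12) S.
Proof.
move=> A x _; rewrite -(linfun_linear (rho_linear wt_m12 A)) memv_preim; move: x; apply/subvP.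
apply: S_min => B x BT xk; rewrite -memv_preim (linfun_linear (rho_linear wt_m12 A)) rho_act1.
apply: memvD; apply: memS => //.
  by rewrite linearN linearD /= !trmx_mul trmxK BT mulNmx mulmxN -opprD addrC.
exact: (stable_arr_comp m2 (memvf A) xk).
Qed.

(** By irreducibility a single nonzero common element suffices, so each arrow needs only one
    witness. *)
Lemma arr_comp_sub_act1_span x : x \in S -> x \in arr_comp F m wt_m12 j -> x != 0 -> (arr_comp F m wt_m12 j <= S)%VS.
Proof.
move=> xS xj xn; have [stN _ _ _ irN] := irr_arr_comp F m2 wt_m12 j.
have [||||/capv_idPr] // := irN (S :&: arr_comp F m wt_m12 j)%VS.
- move=> A y Af /memv_capP[yS yN]; apply/memv_capP.
  split; [exact: (stable_act1_span Af yS)|exact: (stN A y Af yN)].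
- exact: sub0v.
- exact: capvSr.
- move=> e; have : x \in (S :&: arr_comp F m wt_m12 j)%VS by rewrite memv_cap xS.
  by rewrite e memv0 (negbTE xn).
Qed.

Lemma monom_traceless (a b c : 'I_m) : (a == b) = false -> (a == c) = false -> (b == c) = false ->
  monom a b c \in arr_comp F m wt_m12 true /\ monom a b c != 0.
Proof.
move=> ab ac bc; split; last first.
  apply/eqP => /ffunP/(_ a)/matrixP/(_ b c)/eqP.
  by rewrite !arrE !eqxx bc !mul1r mul0r subr0 oner_eq0.
apply/mem_arr_comp; split; first by apply/mem_sk2=> i p q; rewrite !arrE; ring.
move=> i p q; rewrite /= /etr /ctrace big1 // => l _; rewrite arrE.
by case: (l =P a) => [->|_]; rewrite ?ab ?ac /=; ring.
Qed.

Lemma puret_delta_neq0 (r : 'I_m) : puret (fun k => del k r) != 0.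
Proof.
apply/eqP => e; have := ctrace_puret (fun k => del k r) r; rewrite e eqxx mulr1 /ctrace.
by rewrite big1 => [/esym/eqP|i _]; rewrite ?arrE // (negbTE (m1_neq0 F m2)).
Qed.

Lemma arrow_sub : arrow m j k -> (arr_comp F m wt_m12 j <= S)%VS.
Proof.
have [p [q [r [pq pr qr]]]] := three_indices m2.
have skd := skew_delta.
case: j arr_comp_sub_act1_span => h.
  have good a b c : monom a b c \in S -> (a == b) = false -> (a == c) = false ->
      (b == c) = false -> (arr_comp F m wt_m12 true <= S)%VS.
    move=> yS ab ac bc; have [h1 h2] := monom_traceless ab ac bc; exact: h yS h1 h2.
  case: k memS => mS /= m4.
    (* [monom p p r] has zero cyclic sum, and its repeated index can move to q: three indices are
       enough. *)
    apply: (good q p r) => //; last by rewrite eq_sym.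
    have -> : monom q p r = act1 (delta_mx q p - delta_mx p q) (monom p p r).
      apply: arrP => a b c; rewrite act1_delta !arrE eqxx (eq_sym q p) pq mul1r mul0r mulr0 subr0.
      by [].
    apply: mS => //; apply/mem_arr_comp; split; first by apply/mem_sk2=> a b c; rewrite !arrE; ring.
    by move=> a b c; rewrite /= /ecyc !arrE; ring.
  (* The first index p must move to some s other than p, as B is skew, and other than q and r, for
     the image to be trace-free. This is where m > 3 enters. *)
  have [s [sp sq sr]] : exists s : 'I_m, [/\ (s == p) = false, (s == q) = false & (s == r) = false].
    have /card_gt0P[s] : (0 < #|~: [set p; q; r]|)%N.
      rewrite cardsCs setCK card_ord subn_gt0; apply: leq_ltn_trans m4.
      by rewrite -setUA !cardsU1 cards1; case: (_ \in _); case: (_ \in _).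
    by rewrite !inE !negb_or -andbA => /and3P[/negbTE ? /negbTE ? /negbTE ?]; exists s.
  apply: (good s q r) => //.
  have -> : monom s q r = act1 (delta_mx s p - delta_mx p s) (mix 1 1 p q r).
    apply: arrP => a b c; rewrite act1_delta !arrE eqxx pq pr sp sq sr.
    by rewrite /=; ring.
  by apply: mS => //; exact: mix_alt.
have pureC c : c != 0 -> (forall y, y = c *: puret (fun k0 => del k0 r) -> y \in S -> (arr_comp F m wt_m12 false <= S)%VS).
  move=> c0 y ye yS; apply: (h y) => //; rewrite ye.
    by apply: memvZ; apply/(mem_pureP m2); eexists.
  by rewrite scaler_eq0 (negbTE c0) puret_delta_neq0.
case: k memS => mS _.
  apply: pureC (mix_sum 2 (-1) r) _.
    have -> : 2 + 3 * -1 - m%:R * (2 - 1) = - (m.+1%:R) :> F by rewrite -natr1; ring.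
    by rewrite oppr_eq0 pnatr_eq0.
  do 2!(apply: memv_suml => ? _); apply: mS => //; exact: mix_cyc.
apply: pureC (mix_sum 1 1 r) _.
  have -> : 1 + 3 * 1 - m%:R * (1 + 1) = 2 * (2%:R - m%:R) :> F by ring.
  by rewrite mulf_eq0 pnatr_eq0 /= subr_eq0 eqr_nat; move: m2; case: (m) => [|[|[|]]].
by do 2!(apply: memv_suml => ? _); apply: mS => //; exact: mix_alt.
Qed.

Lemma arrow_not_sub : ~~ arrow m j k -> ~~ (arr_comp F m wt_m12 j <= S)%VS.
Proof.
case: j; case: k S_min => // Smin /=; rewrite -leqNgt => m3'.
have m3 : m = 3%N by lia.
(* For m = 3 a skew [B] is itself a vector contracted with the Levi-Civita symbol, and a contracted
   product of two such symbols is a combination of Kronecker deltas. *)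
apply/negP => h; have : (S <= arr_comp F m wt_m12 false)%VS.
  apply: Smin => B x BT /mem_arr_comp[/mem_sk2 s23 alt].
  have Bs a b : B b a = - B a b by have /matrixP/(_ a b) := BT; rewrite !mxE.
  have B0 a : B a a = 0.
    by have /eqP := Bs a a; rewrite -addr_eq0 -mulr2n mulrn_eq0 /= => /eqP.
  have s12 a b c : x a b c = - x b a c by apply/eqP; rewrite -addr_eq0; apply/eqP/alt.
  have xE a b c : x a b c = levi F m a b c * x (o0 m2) (o1 m2) (o2 m2).
    exact: (@alt3 F m m2 m3 F^o (fun a b c => x a b c)).
  have aE a b c : act1 B x a b c = (B a (o0 m2) * levi F m (o0 m2) b c + B a (o1 m2) * levi F m (o1 m2) b c
     + B a (o2 m2) * levi F m (o2 m2) b c) * x (o0 m2) (o1 m2) (o2 m2).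
    rewrite act1E (sum3 m2 m3) !(xE _ b c); ring.
  have mF : m%:R = 3 :> F by rewrite m3.
  apply/mem_arr_comp; split.
    by apply/mem_sk2=> a b c; rewrite !aE !(levi_s23 F _ b c); ring.
  move=> a b c; rewrite /= /epure /ctrace !(sum3 m2 m3) !aE mF.
  case: (ord3P m2 m3 a) => ->; case: (ord3P m2 m3 b) => ->; case: (ord3P m2 m3 c) => ->;
    rewrite !arr3E !B0 ?(Bs (o0 m2) (o1 m2)) ?(Bs (o0 m2) (o2 m2)) ?(Bs (o1 m2) (o2 m2)) /=; by field.
move=> Sf; apply: (@arr_comp_neq0 F m m2 wt_m12 true).
apply/eqP; rewrite -subv0 -(comp_cap F m2 wt_m12) subv_cap subvv andbT.
exact: subv_trans h Sf.
Qed.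

Lemma arrowE : (arr_comp F m wt_m12 j <= S)%VS = arrow m j k.
Proof.
case e: (arrow m j k); first exact: arrow_sub.
by apply/negbTE/arrow_not_sub; rewrite e.
Qed.
End Arrow.

(** * The components of W, independence of the frame, and both forms of the arrows *)

Section Final.
Variables (F : numFieldType) (m : nat) (D : clifford F m).
Variable xi : 'rV[F]_(2 ^ (m - 1)).
Hypothesis hxi : pure D xi.
Local Notation n := (2 * m)%N.
Local Notation N := (2 ^ (m - 1))%N.
Local Notation vec := 'rV[F]_n.
Local Notation form2 := 'M[F]_n.
Local Notation tensor := {ffun 'I_n -> 'M[F]_n}.
Local Notation arr := {ffun 'I_m -> 'M[F]_m}.
Hypothesis m2 : (2 < m)%N.
Variable eps : 'M[F]_N.
Hypothesis heps : m = 3%N -> spinor_duality D eps.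

Section OneFrame.
Variables (V' : {vspace vec}) (eB fB : 'M[F]_(m, n)).
Hypothesis frm : frame D xi V' eB fB.

Definition Wcomp s b : {vspace tensor} :=
  (Wfil D xi s :&: Kap eB fB s @^-1: arr_comp F m s b)%VS.

Lemma mem_Wcomp s b G :
  (G \in Wcomp s b) = (G \in Wfil D xi s) && (kap eB fB s G \in arr_comp F m s b).
Proof. by rewrite memv_cap -memv_preim KapE. Qed.

Lemma WcompP s b G : G \in Wcomp s b <->
  G \in Wfil D xi s /\ (forall k, k <> b -> Pi_zero D xi eps s k G).
Proof.
rewrite mem_Wcomp; split=> [/andP[h1 h2]|[h1 h2]].
  split=> // k kb; apply/(PiE hxi frm m2 heps k h1).
  by move: kb h2; case: b; case: k.
apply/andP; split=> //; have := (PiE hxi frm m2 heps (~~ b) h1).1; rewrite negbK; apply.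
by apply: h2; case: b.
Qed.

Lemma arr_comp_img s b : (arr_comp F m s b <= Kap eB fB s @: Wfil D xi s)%VS.
Proof. by rewrite (Kap_Wfil frm); exact: comp_sub. Qed.

Lemma KapI s x : x \in sk2 F m -> kap eB fB s (iot D eB fB s x) = x.
Proof. by move=> _; rewrite (kap_iot frm); case: s. Qed.

Lemma Wcomp_add s : (Wcomp s false + Wcomp s true = Wfil D xi s)%VS.
Proof.
apply: subv_anti; rewrite subv_add !capvSl /=; apply/subvP=> G h.
have sk := kap_sk2 eB fB s (subvP (WfilS frm s) _ h).
have a0 := proj0P m2 s sk; have a1 := proj0C m2 s sk.
set x := proj0 s _ in a0 a1; have xs : x \in sk2 F m by exact: (subvP (comp_sub F m s false)).
rewrite -(subrK (iot D eB fB s x) G) addrC; apply: memv_add.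
  by rewrite mem_Wcomp (iot_Wfil frm) // KapI.
rewrite mem_Wcomp memvB ?(iot_Wfil frm) //=.
by rewrite -!KapE linearB /= !KapE KapI.
Qed.

Lemma Wcomp_cap s : (Wcomp s false :&: Wcomp s true = Wnext D xi s)%VS.
Proof.
rewrite (WnextE frm); apply/vspaceP=> G; rewrite !memv_cap -!memv_preim memv_ker !KapE.
case: (G \in Wfil D xi s) => //=; rewrite -memv_cap (comp_cap F m2) memv0.
by [].
Qed.

(** [Aof] maps g_0 onto gl(m), so stability under any [h] containing g_0 is already stability under
    gl(m). It is applied to both p and g_0. *)
Lemma arr_comp_irr_restrict (h : {vspace form2}) s b : (g_0 D xi V' <= h)%VS ->
  irreducible h (fun phi => rho s (Aof eB fB phi)) (arr_comp F m s b) 0%VS.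
Proof.
move=> gh; have [st st0 s0 N0 irr] := irr_arr_comp F m2 s b.
have stE (X : {vspace arr}) : stable h (fun phi => rho s (Aof eB fB phi)) X -> stable fullv (rho s) X.
  move=> sX A x _ xX; have [phi pg <-] := g0_exists frm A.
  by apply: sX => //; exact: subvP gh _ pg.
split=> //.
- by move=> phi x _ xN; apply: st => //; exact: memvf.
- by move=> phi x _ xN; apply: st0 => //; exact: memvf.
- by move=> X /stE; exact: irr.
Qed.

Lemma Wcomp_irr s b : irreducible (par D xi) (act_tensor D) (Wcomp s b) (Wnext D xi s).
Proof.
rewrite (WnextE frm); apply: irreducible_preim (arr_comp_irr_restrict s b (g0_par frm)).
- exact: stable_W frm s.
- by move=> phi G pp h; rewrite !KapE (kap_act_Wfil frm).
- exact: arr_comp_img.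
Qed.

Lemma Wcomp_dim s b : quotient_dim (Wcomp s b) (Wnext D xi s) = \dim (arr_comp F m s b).
Proof. by rewrite (WnextE frm) dim_preim // arr_comp_img. Qed.

Lemma Wcomp_dims :
  [/\ (3`! * quotient_dim (Wcomp wt_m32 false) (Wnext D xi wt_m32)
        = m * (m - 1) * (m - 2))%N,
      (3 * quotient_dim (Wcomp wt_m32 true) (Wnext D xi wt_m32)
        = m * (m ^ 2 - 1))%N,
      quotient_dim (Wcomp wt_m12 false) (Wnext D xi wt_m12) = m &
      (2 * quotient_dim (Wcomp wt_m12 true) (Wnext D xi wt_m12)
        = m * (m + 1) * (m - 2))%N].
Proof.
clear heps; rewrite !Wcomp_dim; have d1 := dim_sk2 F m; have d2 := dim_alt F m2.
have d3 := dim_pure F m2; have d4 := dim_add F m2 wt_m32; have d5 := dim_add F m2 wt_m12.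
move: d1 d2 d3 d4 d5.
move: (\dim _) (\dim _) (\dim _) (\dim _) (\dim _) => s1 s2 s3 s4 s5 d1 d2 d3 d4 d5.
have -> : 3`! = 6 by [].
(* Writing m as q + 3 turns the truncated subtractions into polynomials. *)
move: m2 d1 d2 d3 d4 d5; generalize m => q; case: q => [|[|[|q]]] // *.
by split; nia.
Qed.

Lemma Iot_ker s : lker (Iot D eB fB s) = 0%VS.
Proof.
apply/eqP/lker0P => x y; rewrite !IotE => /(congr1 (kap eB fB s)); rewrite !(kap_iot frm).
by case: s.
Qed.

Lemma Wcomp_iso s b : isomorphic (g_0 D xi V') (act_tensor D) (act_tensor D)
  (Wcomp s b) (Wnext D xi s) (Iot D eB fB s @: arr_comp F m s b)%VS 0%VS.
Proof.
rewrite (WnextE frm); apply: (isomorphic_preim (rho := fun phi => rho s (Aof eB fB phi))).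
- by rewrite Iot_ker capv0.
- by move=> phi x pg _; rewrite !IotE (iot_act frm).
- by move=> phi G pg h; rewrite !KapE (kap_act_Wfil frm) // (subvP (g0_par frm)).
- exact: arr_comp_img.
Qed.

(** This strict inequality singles out the Cartan product and also makes each component unique among
    submodules of its dimension. *)
Lemma dim_lt s : (\dim (arr_comp F m s false) < \dim (arr_comp F m s true))%N.
Proof.
clear heps; have d1 := dim_sk2 F m; have d2 := dim_alt F m2; have d3 := dim_pure F m2.
have d4 := dim_add F m2 wt_m32; have d5 := dim_add F m2 wt_m12.
by case: s; nia.
Qed.

Lemma Iot_irr s b : irreducible (g_0 D xi V') (act_tensor D) (Iot D eB fB s @: arr_comp F m s b)%VS 0%VS.
Proof.
apply: irreducible_img (arr_comp_irr_restrict s b (subvv _)).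
- by case: (arr_comp_irr_restrict s b (subvv (g_0 D xi V'))).
- by rewrite Iot_ker capv0.
- by move=> phi x pg _; rewrite !IotE (iot_act frm).
Qed.

Lemma Wcomp_top s : top_component (g_0 D xi V') (act_tensor D)
  (tensv D (Ugr D xi V' s) (wedge2v D V' V')) (Iot D eB fB s @: arr_comp F m s true)%VS.
Proof.
rewrite (tensv_iot frm) -(comp_add F m2 s) addvC limgD; apply: top_component_sum.
- exact: Iot_irr.
- rewrite -lker0_img_cap ?Iot_ker // capvC (comp_cap F m2) limg0 //.
- by rewrite !limg_dim_eq ?Iot_ker ?capv0 // dim_lt.
Qed.

Lemma Wcomp_vec : isomorphic (g_0 D xi V') (act_tensor D) (act_vec D)
  (Wcomp wt_m12 false) (Wnext D xi wt_m12) V' 0%VS.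
Proof.
(* The target is V' itself rather than a space of tensors, so the contraction written in the basis
   f_i replaces [Iot]. *)
pose v (x : arr) : vec := (\row_k ctrace x k) *m fB.
have vl : linear v.
  move=> a x y; rewrite /v scalemxAl -mulmxDl; congr (_ *m _).
  by apply/rowP=> k; rewrite !mxE ctrace_lin.
have vp t : v (puret t) = (m%:R - 1) *: ((\row_k t k) *m fB).
  by rewrite /v scalemxAl; congr (_ *m _); apply/rowP=> k; rewrite !mxE ctrace_puret.
have m10 := m1_neq0 F m2.
have fB0 (u : 'rV[F]_m) : u *m fB = 0 -> u = 0.
  by move=> h; rewrite -[u]mulmx1 -(fe1 frm) !mulmxA h !mul0mx.
have VE : V' = (linfun v @: arr_comp F m wt_m12 false)%VS.
  apply: subv_anti; apply/andP; split; apply/subvP=> w.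
    case: frm => _ _ _ _ ->; case/submxP=> u ->.
    have -> : u *m fB = linfun v (puret (fun k => (m%:R - 1)^-1 * u 0 k)).
      rewrite linfun_linear // vp scalemxAl; congr (_ *m _).
      by apply/rowP=> k; rewrite !mxE mulrA divff // mul1r.
    by rewrite memv_img //; apply/(mem_pureP m2); eexists.
  case/memv_imgP=> x _ ->; rewrite linfun_linear // (V'E frm) /v.
  by rewrite -!mulmxA (mulmxA fB) (ff0 frm) mulmx0.
rewrite (WnextE frm) [X in isomorphic _ _ _ _ _ X _]VE.
apply: (isomorphic_preim (rho := fun phi => rho wt_m12 (Aof eB fB phi))).
- apply/eqP; rewrite -subv0; apply/subvP=> x; rewrite memv_cap memv_ker linfun_linear // memv0.
  case/andP=> /(mem_pureP m2)[t ->]; rewrite vp scaler_eq0 (negbTE m10) /= => /eqP/fB0/rowP t0.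
  by apply/eqP/arrP => i j k; have := t0 k; have := t0 j; rewrite !arrE !mxE => -> ->; rewrite !mulr0 subr0.
- move=> phi x pg /(mem_pureP m2)[t ->]; have [ps p0 b0] := g0E frm pg.
  rewrite !linfun_linear // rho_puret !vp /act_vec !trmx_mul trmxK ps (ginv_sym D) mulNmx mulmxN.
  rewrite -scalemxAl -scalerN; congr (_ *: _).
  rewrite -mulmxA (f_phi frm ps) b0 mul0mx sub0r mulmxN opprK mulmxA; congr (_ *m _).
  by apply/rowP=> k; rewrite !mxE; apply: eq_bigr => l _; rewrite !mxE mulrC.
- by move=> phi G pg h; rewrite !KapE (kap_act_Wfil frm) // (subvP (g0_par frm)).
- exact: arr_comp_img.
Qed.

Lemma WgradedP s G : G \in Wgraded D xi V' s ->
  G \in Wfil D xi s /\ (kap eB fB s G = 0 -> G \in W_p12 D xi).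
Proof.
rewrite /Wgraded -/(Ugr D xi V' s) (tensv_iot frm) => /memv_addP[_ /memv_imgP[x xs ->] [H hH ->]].
have [H1 H2 H3] := elimT (mem_Wp12 frm _) hH.
have HW : H \in Wfil D xi s by case: (s) => //; apply/(mem_Wm12 frm).
split; first by rewrite IotE memvD ?(iot_Wfil frm).
rewrite -KapE linearD /= !KapE IotE KapI //.
have -> : kap eB fB s H = 0 by case: (s).
by rewrite addr0 => ->; rewrite -IotE linear0 add0r.
Qed.

(** Handles the arbitrary choice of irreducible representatives: [Y] meets the kernel of [Kap] in V
    tensor p only, so its image has the dimension of the component, and dimension determines it. *)
Lemma graded_kap s b (Y : {vspace tensor}) :
  irreducible (g_0 D xi V') (act_tensor D) Y (W_p12 D xi) ->
  (Y <= Wgraded D xi V' s)%VS ->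
  isomorphic (g_0 D xi V') (act_tensor D) (act_tensor D) Y (W_p12 D xi) (Wcomp s b) (Wnext D xi s) ->
  (Kap eB fB s @: Y)%VS = arr_comp F m s b.
Proof.
move=> [stY _ pY _ _] YW /isomorphic_dim; rewrite Wcomp_dim /quotient_dim => dY.
have YF : (Y <= Wfil D xi s)%VS by apply/subvP=> G /(subvP YW)/WgradedP[].
have kY : (Y :&: lker (Kap eB fB s) = W_p12 D xi)%VS.
  apply/vspaceP=> G; rewrite memv_cap memv_ker KapE; apply/andP/idP=> [[gY /eqP k0]|gp].
    by have [_] := WgradedP (subvP YW _ gY); apply.
  rewrite (subvP pY) //; split=> //.
  by have [_ h1 h2] := elimT (mem_Wp12 frm _) gp; case: (s); rewrite ?h1 ?h2.
have dKY : \dim (Kap eB fB s @: Y) = \dim (arr_comp F m s b).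
  by rewrite -dY -(limg_ker_dim (Kap eB fB s) Y) kY addKn.
have ir := fun c => arr_comp_irr_restrict s c (subvv (g_0 D xi V')).
have stK : stable (g_0 D xi V') (fun phi => rho s (Aof eB fB phi)) (Kap eB fB s @: Y).
  move=> phi x pg /memv_imgP[G gY ->]; rewrite KapE -(kap_act_Wfil frm) ?(subvP YF) //.
    by rewrite -KapE memv_img // stY.
  exact: subvP (g0_par frm) _ pg.
apply: (stable_dim_uniq (ir b) (ir (~~ b))) => //.
- by case: (b) => /=; [rewrite capvC|]; exact: comp_cap.
- have := dim_lt s; rewrite ltn_neqAle => /andP[/eqP ne _].
  by case: (b) => //= e; apply: ne.
- move=> phi x pg /memv_addP[x1 h1 [x2 h2 ->]].
  rewrite -(linfun_linear (rho_linear s _)) linearD /= !(linfun_linear (rho_linear s _)).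
  by apply: memv_add; [exact: stK|case: (ir b) => st _ _ _ _; exact: st].
- have -> : (arr_comp F m s b + arr_comp F m s (~~ b) = sk2 F m)%VS.
    by case: (b) => /=; [rewrite addvC|]; exact: comp_add.
  by rewrite -(Kap_Wfil frm s) limgS.
Qed.

Lemma arrow_graded j k (X Y : {vspace tensor}) :
  irreducible (g_0 D xi V') (act_tensor D) X (W_p12 D xi) ->
  (X <= Wgraded D xi V' wt_m12)%VS ->
  isomorphic (g_0 D xi V') (act_tensor D) (act_tensor D) X (W_p12 D xi) (Wcomp wt_m12 j) (Wnext D xi wt_m12) ->
  irreducible (g_0 D xi V') (act_tensor D) Y (W_p12 D xi) ->
  (Y <= Wgraded D xi V' wt_m32)%VS ->
  isomorphic (g_0 D xi V') (act_tensor D) (act_tensor D) Y (W_p12 D xi) (Wcomp wt_m32 k) (Wnext D xi wt_m32) ->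
  (X <= action_span (g_1 D xi) (act_tensor D) Y + W_p12 D xi)%VS = arrow m j k.
Proof.
move=> iX Xg sX iY Yg sY.
have kX := graded_kap iX Xg sX; have kY := graded_kap iY Yg sY.
set Z := (_ + _)%VS; set K := Kap eB fB wt_m12.
have kapY phi G : phi \in g_1 D xi -> G \in Y ->
    K (act_tensor D phi G) = act1 (Bof fB phi) (kap eB fB wt_m32 G).
  move=> pg gY; rewrite KapE (kap_act frm) ?(subvP (g1_par frm)) //.
  have [_ _ ->] := g1E frm pg; rewrite [rho _ _ _](_ : _ = 0) ?add0r //.
  apply: arrP => a b c; rewrite arr3E arrE big1 // => l _.
  by rewrite /= !mxE oppr0 !mul0r !addr0.
have ZW : (Z <= Wfil D xi wt_m12)%VS.
  rewrite subv_add; apply/andP; split.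
    apply: bilin_span_sub => phi G pg gY; have pp := subvP (g1_par frm) _ pg.
    have [hG _] := WgradedP (subvP Yg _ gY); apply/(mem_Wm12 frm); split.
      exact: stable_W frm wt_m32 _ _ pp hG.
    rewrite (kap_act frm) // addr0; have [_ _ ->] := g1E frm pg.
    apply: arrP => a b c; rewrite arr3E arrE big1 // => l _.
    by rewrite /= !mxE !mul0r !addr0.
  by apply/subvP=> G /(mem_Wp12 frm)[h1 h2 _]; apply/(mem_Wm12 frm).
(* [Z] contains V tensor p, the kernel of [K] on W^{-1/2}, so inclusion in [Z] can be tested on
   images. *)
have -> : (X <= Z)%VS = (arr_comp F m wt_m12 j <= K @: Z)%VS.
  rewrite -kX; apply/idP/idP => [|h]; first exact: limgS.
  apply/subvP=> u uX; have /memv_imgP[z zZ e] := subvP h _ (memv_img K uX).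
  rewrite -(subrK z u); apply: memvD => //; apply: (subvP (addvSr _ _)).
  have uW := (WgradedP (subvP Xg _ uX)).1.
  have : u - z \in Wnext D xi wt_m12.
    by rewrite (WnextE frm) memv_cap memvB ?(subvP ZW _ zZ) //= memv_ker linearB /= e subrr.
  by [].
apply: arrowE => // [B x BT|T hT].
  rewrite -kY => /memv_imgP[G gY ->]; have [phi pg <-] := g1_exists frm BT.
  rewrite KapE -kapY // memv_img //; apply: (subvP (addvSl _ _)).
  by apply: mem_bilin_span => // [v|u]; [exact: act_tensor_linl|exact: act_tensor_linr].
apply/subvP=> _ /memv_imgP[z zZ ->]; rewrite memv_preim; move: z zZ; apply/subvP.
rewrite subv_add; apply/andP; split.
  apply: bilin_span_sub => phi G pg gY; rewrite -memv_preim kapY //.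
  apply: hT; first by have [ps _ _] := g1E frm pg; rewrite /Bof !trmx_mul trmxK ps mulNmx mulmxN mulmxA.
  by rewrite -kY -KapE memv_img.
apply/subvP=> G /(mem_Wp12 frm)[_ _ h]; rewrite -memv_preim KapE h; exact: mem0v.
Qed.
End OneFrame.

(** An arrow to both targets holds when the kernel has no weight -3/2 part. This fails only for j =
    1 and m = 3, where the weight -3/2 part is totally skew: the arrow to W^1 survives and the
    Levi-Civita tensor refutes the other. *)
Lemma arrow_Pi j k V' eB fB (frm : frame D xi V' eB fB) :
  (forall G, G \in W_m32 D -> Pi_zero D xi eps wt_m12 j G -> Pi_zero D xi eps wt_m32 k G)
  <-> arrow m j k.
Proof.
have z0 b : (0 : arr) \in arr_comp F m wt_m32 b by exact: mem0v.
have q0P G : G \in W_m32 D -> kap eB fB wt_m32 G = 0 -> Pi_zero D xi eps wt_m32 k G.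
  by move=> h q0; apply/(Pi_m32P frm eps k h); rewrite q0.
case: j; last first.
  have -> : arrow m false k = true by case: (k).
  split=> // _ G h /(Pi0_m12P frm h) P00; exact: q0P (P0_q hxi frm h P00).
case: (m =P 3%N) => [m3|m3].
  case: k q0P => q0P /=.
    split=> // _ G h H; apply/(Pi_m32P frm eps true h).
    exact: (Pi1_q_three hxi frm heps m3 h H).
  split=> [H|m4]; last by exfalso; move: m4; rewrite m3.
  have [G [h Gz /negP]] := exists_Pi1_not_Pi0 hxi frm m2 heps m3; case.
  exact/(Pi_m32P frm eps false h)/H.
have -> : arrow m true k = true by case: (k) => //=; lia.
split=> // _ G h H; apply: q0P => //.
exact: (Pi1_q_gen frm m2 heps m3 h H).
Qed.

(** The description by projections in [WcompP] mentions no frame. *)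
Lemma Wcomp_indep V1 e1 f1 V2 e2 f2 s b :
  frame D xi V1 e1 f1 -> frame D xi V2 e2 f2 -> Wcomp e1 f1 s b = Wcomp e2 f2 s b.
Proof.
move=> fr1 fr2; apply/vspaceP=> G; apply/idP/idP => h.
  by apply/(WcompP fr2)/(WcompP fr1).
by apply/(WcompP fr1)/(WcompP fr2).
Qed.
End Final.

Theorem proposition3p2 (R : realType) (m : nat) (hm : (2 < m)%N)
    (D : clifford R[i] m) (xi : 'rV[R[i]]_(2 ^ (m - 1))) (hxi : pure D xi)
    (eps : 'M[R[i]]_(2 ^ (m - 1))) (heps : m = 3%N -> spinor_duality D eps) :
  (* (i) *)
  [/\ stable (par D xi) (act_tensor D) (W_p12 D xi),
      stable (par D xi) (act_tensor D) (W_m12 D xi),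
      stable (par D xi) (act_tensor D) (W_m32 D),
      (W_p12 D xi <= W_m12 D xi)%VS &
      (W_m12 D xi <= W_m32 D)%VS]
  /\
  exists W : weight -> bool -> {vspace {ffun 'I_(2 * m) -> 'M[R[i]]_(2 * m)}},
  [/\
      (* (ii) *)
      (forall i,
         (W i false + W i true = Wfil D xi i)%VS
         /\ (W i false :&: W i true = Wnext D xi i)%VS)
      /\ (forall i j,
            irreducible (par D xi) (act_tensor D) (W i j) (Wnext D xi i)),
      (forall V' : {vspace 'rV[R[i]]_(2 * m)}, null_complement D xi V' ->
         [/\ isomorphic (g_0 D xi V') (act_tensor D) (act_tensor D)
               (W wt_m32 false) (Wnext D xi wt_m32) (wedge3v D V') 0%VS,
             exists2 N,
               top_component (g_0 D xi V') (act_tensor D)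
                 (tensv D V' (wedge2v D V' V')) N &
               isomorphic (g_0 D xi V') (act_tensor D) (act_tensor D)
                 (W wt_m32 true) (Wnext D xi wt_m32) N 0%VS,
             isomorphic (g_0 D xi V') (act_tensor D) (act_vec D)
               (W wt_m12 false) (Wnext D xi wt_m12) V' 0%VS &
             exists2 N,
               top_component (g_0 D xi V') (act_tensor D)
                 (tensv D (V12 D xi) (wedge2v D V' V')) N &
               isomorphic (g_0 D xi V') (act_tensor D) (act_tensor D)
                 (W wt_m12 true) (Wnext D xi wt_m12) N 0%VS])
      /\ [/\ (3`! * quotient_dim (W wt_m32 false) (Wnext D xi wt_m32)
                = m * (m - 1) * (m - 2))%N,
             (3 * quotient_dim (W wt_m32 true) (Wnext D xi wt_m32)
                = m * (m ^ 2 - 1))%N,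
             quotient_dim (W wt_m12 false) (Wnext D xi wt_m12) = m &
             (2 * quotient_dim (W wt_m12 true) (Wnext D xi wt_m12)
                = m * (m + 1) * (m - 2))%N],
      (* (iii) *)
      (forall i j (G : {ffun 'I_(2 * m) -> 'M[R[i]]_(2 * m)}),
         G \in W i j <->
         G \in Wfil D xi i
         /\ (forall k, k <> j -> Pi_zero D xi eps i k G)) &
      (* (iv) *)
      (forall j k,
         (forall V' : {vspace 'rV[R[i]]_(2 * m)}, null_complement D xi V' ->
          forall X Y,
            irreducible (g_0 D xi V') (act_tensor D) X (W_p12 D xi) ->
            (X <= Wgraded D xi V' wt_m12)%VS ->
            isomorphic (g_0 D xi V') (act_tensor D) (act_tensor D)
              X (W_p12 D xi) (W wt_m12 j) (Wnext D xi wt_m12) ->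
            irreducible (g_0 D xi V') (act_tensor D) Y (W_p12 D xi) ->
            (Y <= Wgraded D xi V' wt_m32)%VS ->
            isomorphic (g_0 D xi V') (act_tensor D) (act_tensor D)
              Y (W_p12 D xi) (W wt_m32 k) (Wnext D xi wt_m32) ->
            (X <= action_span (g_1 D xi) (act_tensor D) Y + W_p12 D xi)%VS
              = arrow m j k)
         /\ ((forall G : {ffun 'I_(2 * m) -> 'M[R[i]]_(2 * m)},
                G \in W_m32 D ->
                Pi_zero D xi eps wt_m12 j G -> Pi_zero D xi eps wt_m32 k G)
             <-> arrow m j k))].

Proof.
(* The statement views R[i] as a fieldType through realFieldType, the lemmas through numFieldType:
   the two structures are convertible, but unification does not identify them. *)
cbv delta [reverse_coercion] beta in *.
change (complex_complex__canonical__GRing_Field (reals_Real__to__Num_RealField R))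
  with (Num_NumField__to__GRing_Field (complex_complex__canonical__Num_NumField
         (reals_Real__to__Num_RealClosedField R))) in *.
(* The components are built from one auxiliary complement and transferred to any other by
   [Wcomp_indep]. *)
have [V0 nc0] := exists_null_complement hxi.
have [eB [fB frm]] := exists_frame hxi nc0.
split.
  split; [exact: stable_Wp12 frm|exact: (stable_W frm (s := wt_m12))
         |exact: (stable_W frm (s := wt_m32))| |exact: WfilS frm wt_m12].
  by apply/subvP=> G /(mem_Wp12 frm)[h1 h2 _]; apply/(mem_Wm12 frm).
exists (Wcomp D xi eB fB); split.
- split=> [s|s b]; last exact (Wcomp_irr hm frm s b).
  by rewrite (Wcomp_add hm frm) (Wcomp_cap hm frm).
- split.
    move=> V' nc; have [eB' [fB' frm']] := exists_frame hxi nc.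
    rewrite !(fun s b => Wcomp_indep hxi hm heps s b frm frm') (wedge3v_iot frm').
    split; [exact: Wcomp_iso| |exact: (Wcomp_vec hm)|].
      by exists (Iot D eB' fB' wt_m32 @: arr_comp _ m wt_m32 true)%VS;
        [exact: (Wcomp_top hm frm' wt_m32)|exact: Wcomp_iso].
    by exists (Iot D eB' fB' wt_m12 @: arr_comp _ m wt_m12 true)%VS;
      [exact: (Wcomp_top hm frm' wt_m12)|exact: Wcomp_iso].
  exact (Wcomp_dims hm frm).
- by move=> s b G; exact: (WcompP hxi hm heps frm).
- move=> j k; split; last exact: (arrow_Pi hxi hm heps j k frm).
  move=> V' nc X Y iX Xg + iY Yg; have [eB' [fB' frm']] := exists_frame hxi nc.
  rewrite !(fun s b => Wcomp_indep hxi hm heps s b frm frm') => sX sY.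
  exact: (arrow_graded hm frm' iX Xg sX iY Yg sY).
Qed.
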